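(* Let $N=1$, so $\Omega=(0,\infty)$, let $\alpha\in(1,2)$, $\bar\beta:=\alpha-1$, and assume $f\in C_b(\overline\Omega)$, that the jumps are censored, and that $\mu$ satisfies $(\mathrm H_\mu'')$ (stated in the context). (a) Any bounded, uniformly continuous viscosity solution of problem (E) is in $C^{0,\beta}(\overline\Omega)$ for some $\beta>\bar\beta$. (b) There exists a viscosity solution of problem (E) in $C^{0,\beta}(\overline\Omega)$ for some $\beta>\bar\beta$.
   Context: **Setting.** $\Omega=(0,\infty)\subset\mathbb R$. $C_b$ denotes bounded continuous functions. Censored jumps: for $x\ge0$, $z\neq0$, $\eta(x,z)=z$ if $x+z\ge0$ and $\eta(x,z)=0$ otherwise. **Problem (E).** $u(x)-I[u](x)-f(x)=0$ in $\Omega$, $-u'(0)=0$ at the boundary point $0$, where $I[u](x)=\lim_{b\to0^+}\int_{|z|>b}[u(x+\eta(x,z))-u(x)]\,d\mu(z)$. **Hypothesis** $(\mathrm H_\mu'')$ (for $N=1$): $\mu=\mu_*+\mu_\#$ with $\mu_*(dz)=\frac{dz}{|z|^{1+\alpha}}$, and $\mu_\#$ a nonnegative Radon measure on $\mathbb R\setminus\{0\}$ with $\int(1\wedge|z|^{\bar\beta})\,d\mu_\#<\infty$ and $\mu_\#(\{a\})=0$ for every $a<0$. **Viscosity solutions of (E).** For $\delta>0$, $I^\delta[u](x)=\int_{|z|\ge\delta}[u(x+\eta(x,z))-u(x)]\,d\mu(z)$ and, for $x>0$, $I_\delta[\phi](x)=\lim_{b\to0^+}\int_{b<|z|<\delta}[\phi(x+\eta(x,z))-\phi(x)]\,d\mu(z)$.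 A bounded usc $u:\overline\Omega\to\mathbb R$ is a subsolution if for every $\delta>0$, $\phi\in C^2(\mathbb R)$ and $x\in\overline\Omega$ that is a maximum point of $u-\phi$ in $(x-\delta,x+\delta)\cap\overline\Omega$: if $x>0$, then $u(x)-I_\delta[\phi](x)-I^\delta[u](x)\le f(x)$; if $x=0$, then $-\phi'(0)\le0$. Supersolutions (bounded lsc functions $v$) are defined with maximum replaced by minimum, $u$ by $v$, and $\le$ by $\ge$. A solution is both a sub- and a supersolution. *)

(* Defs.v *)
From HB Require Import structures.
From mathcomp Require Import all_boot all_order all_algebra.
From mathcomp Require Import all_classical all_reals all_analysis.
From mathcomp Require Import measurable_realfun.
Set Implicit Arguments.
Unset Strict Implicit.
Unset Printing Implicit Defensive.
Import Order.TTheory GRing.Theory Num.Theory.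
Import numFieldNormedType.Exports.
Local Open Scope classical_set_scope.
Local Open Scope ring_scope.

(** Functions on the closed half-line are represented by functions [R -> R]
    all of whose properties below only involve their values on [half_line]. *)
Definition half_line (R : realType) : set R := `[0, +oo[.
Arguments half_line R : clear implicits.

Definition bounded_on_half_line (R : realType) (u : R -> R) : Prop :=
  [bounded u x | x in half_line R].

Definition Cb_half_line (R : realType) (f : R -> R) : Prop :=
  {within half_line R, continuous f} /\ bounded_on_half_line f.

Definition unif_continuous_half_line (R : realType) (u : R -> R) : Prop :=
  unif_continuous (u : subspace (half_line R) -> R).

(** Semicontinuity is relative to the half-line; the library only provides
    the lower, extended-real-valued version. *)
Definition lsc_half_line (R : realType) (v : R -> R) : Prop :=
  lower_semicontinuous
    ((fun x => (v x)%:E) : subspace (half_line R) -> \bar R).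

Definition usc_half_line (R : realType) (u : R -> R) : Prop :=
  lsc_half_line (fun x => - u x).

Definition C0_half_line (R : realType) (beta : R) (u : R -> R) : Prop :=
  bounded_on_half_line u /\
  exists C : R, forall x y : R, half_line R x -> half_line R y ->
    `|u x - u y| <= C * `|x - y| `^ beta.

Definition C2 (R : realType) (phi : R -> R) : Prop :=
  [/\ forall x : R, derivable phi x 1,
      forall x : R, derivable (derive1 phi) x 1
    & continuous (derive1 (derive1 phi))].

Definition eta (R : realType) (x z : R) : R := if 0 <= x + z then z else 0.

(** A measure on the punctured line is represented by a Borel measure on the
    line that does not charge 0. *)

Section mu_star.
Context (R : realType) (alpha : R).

(** The density is 0 at 0, since [0^-1 = 0]. *)
Definition mu_star_density (z : R) : R := (`|z| `^ (1 + alpha))^-1.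

Definition mu_star (A : set (measurableTypeR R)) : \bar R :=
  (\int[@lebesgue_measure R]_(z in A) (mu_star_density z)%:E)%E.

Let mu_star0 : mu_star set0 = 0%E.
Proof. by rewrite /mu_star integral_set0. Qed.

Let mu_star_ge0 A : (0 <= mu_star A)%E.
Proof.
by apply: integral_ge0 => z _; rewrite lee_fin invr_ge0 powR_ge0.
Qed.

Let mu_star_sigma_additive : semi_sigma_additive mu_star.
Proof.
apply: semi_sigma_additive_nng_induced => [|z]; last first.
  by rewrite lee_fin invr_ge0 powR_ge0.
apply/measurable_EFinP.
rewrite (_ : mu_star_density = @powR R ^~ (- (1 + alpha)) \o @Num.norm _ R).
  exact: measurableT_comp (measurable_powR _) (@normr_measurable R setT).
by apply/funext => z; rewrite /mu_star_density /= powRN.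
Qed.

HB.instance Definition _ := isMeasure.Build _ _ _ mu_star
  mu_star0 mu_star_ge0 mu_star_sigma_additive.

End mu_star.

Definition H_mu'' (R : realType) (alpha beta_bar : R)
    (mu : {measure set (measurableTypeR R) -> \bar R}) : Prop :=
  exists mu_sharp : {measure set (measurableTypeR R) -> \bar R},
    [/\ mu_sharp [set 0] = 0%E,
        forall K : set R, compact K -> K `<=` [set~ 0] ->
          (mu_sharp K < +oo)%E,
        (\int[mu_sharp]_(z in [set~ 0%R])
            (Num.min 1 (`|z| `^ beta_bar))%:E < +oo)%E,
        forall a : R, a < 0 -> mu_sharp [set a] = 0%E
      & forall A : set (measurableTypeR R), measurable A ->
          (mu A = mu_star alpha A + mu_sharp A)%E].

Section viscosity.
Context (R : realType) (mu : {measure set (measurableTypeR R) -> \bar R}).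
Implicit Types (delta x : R) (u v f phi : R -> R).

Definition I_outer delta u x : R :=
  \int[mu]_(z in [set z : R | delta <= `|z|]) (u (x + eta x z) - u x).

Definition I_inner delta phi x : R :=
  lim ((\int[mu]_(z in [set z : R | b < `|z| < delta])
          (phi (x + eta x z) - phi x)) @[b --> 0^'+]).

Definition nbhd_half_line x delta : set R :=
  `]x - delta, x + delta[ `&` half_line R.

Definition viscosity_subsolution f u : Prop :=
  [/\ bounded_on_half_line u, usc_half_line u
    & forall delta phi x, 0 < delta -> C2 phi -> half_line R x ->
        (forall y, nbhd_half_line x delta y -> u y - phi y <= u x - phi x) ->
        (0 < x -> u x - I_inner delta phi x - I_outer delta u x <= f x) /\
        (x = 0 -> - derive1 phi 0 <= 0)].

Definition viscosity_supersolution f v : Prop :=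
  [/\ bounded_on_half_line v, lsc_half_line v
    & forall delta phi x, 0 < delta -> C2 phi -> half_line R x ->
        (forall y, nbhd_half_line x delta y -> v x - phi x <= v y - phi y) ->
        (0 < x -> v x - I_inner delta phi x - I_outer delta v x >= f x) /\
        (x = 0 -> - derive1 phi 0 >= 0)].

Definition viscosity_solution f u : Prop :=
  viscosity_subsolution f u /\ viscosity_supersolution f u.

End viscosity.

(* Main.v *)
(** Everything rests on one doubling estimate with psi(d) = L d^b, where
    1 - b = 7/8 (2 - alpha), so that b > alpha - 1.  At an approximate maximum
    of u(x) - u(y) - psi(x - y), x = y + d, let both points make the same jump z.
    For 0 < z < d the two one-sided inequalities add up to the second difference
    of psi, a gain of order L d^(b-2) z^2, whose integral against mu_star is
    7/16 L b d^(b-alpha) up to the truncation of the small jumps.  The only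
    loss against mu_star comes from the jumps censored at y but not at x, whose
    sizes fill a window of length d beyond y; it is at most L b d^(b-alpha) / 4.
    The part mu_sharp costs O(1 + L) since b > alpha - 1.  For L large, hence d
    small, this is contradictory.

    For (a) the maximum is localised by quadratic penalties.  The test functions
    are then affine plus a small quadratic: at x the drift cancels by symmetry of
    mu_star, at y it has the good sign because censoring leaves a mean jump to
    the right, and y = 0 is excluded by the Neumann condition.

    For (b) the equation is solved approximately by Picard iteration on the grid
    hN, the jumps being rounded away from 0 to multiples of h.  On the grid d is
    at least h, so the same estimate gives a Holder bound uniform in h, and a
    locally uniform limit is a viscosity solution.  At x = 0 the inequality
    phi'(0) >= 0 appears in the limit because the mean censored jump at distance
    s from the boundary is of order s^(1-alpha). *)

Require Import Defs.
From HB Require Import structures.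
From mathcomp Require Import all_boot all_order all_algebra.
From mathcomp Require Import all_classical all_reals all_analysis.
From mathcomp Require Import measurable_realfun ring lra.
Set Implicit Arguments.
Unset Strict Implicit.
Unset Printing Implicit Defensive.
Import Order.TTheory GRing.Theory Num.Theory.
Import numFieldNormedType.Exports.
Local Open Scope classical_set_scope.
Local Open Scope ring_scope.
(* HB.structures also defines eta. *)
Import Defs.

(** * The measure mu_star *)

(** The obstacle is the order of choices. A pair that maximises only up to an error k loses 2 k
    mu(|z| >= r) in the nonlocal term, and mu has infinite mass near 0. So the truncation r must be
    fixed before k, while r must be small against d: a lower bound on d is needed beforehand. In (a)
    uniform continuity provides it, since a pair at which u(x) - u(y) exceeds a fixed positive level
    cannot be close; in (b) it is the mesh h. This bound enters no constant, so the final estimate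
    does not see it.

    On the grid the truncated equation holds pointwise, so approximate maxima suffice and neither
    penalties nor test functions are needed for the Holder bound. Rounding by an odd map away from 0
    keeps the symmetry under which drifts cancel, cannot shrink the gain, and does not widen the
    window of censored jumps, because y and d are multiples of h. The countably many jump sizes make
    all integrands measurable without any regularity of the iterates. *)

Section mu_star_theory.
Context (R : realType) (alpha : R).
Notation leb := (@lebesgue_measure R).
Notation mstar := (@mu_star R alpha).
Notation dens := (@mu_star_density R alpha).
Import HBNNSimple.

Lemma mu_star_density_ge0 z : 0 <= dens z.
Proof. by rewrite invr_ge0 powR_ge0. Qed.

Lemma measurable_mu_star_density :
  measurable_fun [set: measurableTypeR R] (dens : measurableTypeR R -> R).
Proof.
rewrite (_ : dens = @powR R ^~ (- (1 + alpha)) \o @Num.norm _ R).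
  exact: measurableT_comp (measurable_powR _) (@normr_measurable R setT).
by apply/funext => z; rewrite /mu_star_density /= powRN.
Qed.

(** For an indicator this is the definition of [mu_star]; linearity gives simple functions, and
    monotone convergence on both sides gives [f]. *)
Lemma ge0_integral_mu_star (D : set (measurableTypeR R))
    (f : measurableTypeR R -> \bar R) :
  measurable D -> measurable_fun D f -> {in D, forall y, (0 <= f y)%E} ->
  (\int[mstar]_(y in D) f y = \int[leb]_(y in D) (f y * (dens y)%:E))%E.
Proof.
move=> mD mf f0.
have md : measurable_fun D (EFin \o (dens : measurableTypeR R -> R)).
  by apply/measurable_EFinP; apply: measurable_funTS;
     exact: measurable_mu_star_density.
have d0 y : (0 <= (dens y)%:E)%E by rewrite lee_fin mu_star_density_ge0.
pose f_ := nnsfun_approx mD mf.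
transitivity (limn (fun n => \int[mstar]_(x in D) (f_ n x)%:E))%E.
  rewrite -monotone_convergence//.
  - apply: eq_integral => y /[!inE] yD; apply/esym/cvg_lim => //.
    by apply: cvg_nnsfun_approx => // *; apply: f0; rewrite inE.
  - by move=> n; exact/measurable_EFinP/measurable_funP.
  - by move=> n y _; rewrite lee_fin.
  - by move=> y _ m n mn; rewrite lee_fin; exact/lefP/nd_nnsfun_approx.
rewrite [X in limn X](_ : _ =
    (fun n => \int[leb]_(x in D) ((f_ n x)%:E * (dens x)%:E)))%E.
  rewrite -monotone_convergence//; last 3 first.
    - move=> n /=; apply: emeasurable_funM => //.
      exact/measurable_EFinP/measurable_funP.
    - by move=> n x _ /=; apply: mule_ge0 => //; rewrite lee_fin.
    - move=> x _ m n mn; rewrite lee_wpmul2r// lee_fin.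
      exact/lefP/nd_nnsfun_approx.
  apply: eq_integral => x /[!inE] Dx /=; apply/cvg_lim => //.
  apply: cvgeZr => //.
  by apply: cvg_nnsfun_approx => // y Dy; apply: f0; rewrite inE.
apply/funext => n.
under eq_integral do rewrite fimfunE -fsumEFin//.
rewrite ge0_integral_fsum//; last 2 first.
- by move=> y; exact/measurable_EFinP/measurable_funM.
- by move=> y x _; rewrite nnfun_muleindic_ge0.
transitivity (\int[leb]_(x in D) (\sum_(y \in range (f_ n))
    ((y * \1_(f_ n @^-1` [set y]) x)%:E * (dens x)%:E)))%E; last first.
  apply: eq_integral => x _; rewrite [in RHS]fimfunE -fsumEFin//.
  by rewrite ge0_mule_fsuml// => y; rewrite nnfun_muleindic_ge0.
rewrite ge0_integral_fsum//; last 2 first.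
- move=> y; apply: emeasurable_funM => //.
  exact/measurable_EFinP/measurable_funM.
- by move=> y x _; rewrite mule_ge0// nnfun_muleindic_ge0.
apply: eq_fsbigr => y yr.
rewrite (integralZl_indic mD (fun y => f_ n @^-1` [set y]))//; last first.
  by move=> y0; rewrite preimage_nnfun0.
have mfy : measurable (f_ n @^-1` [set y]) by exact: measurable_sfunP.
rewrite integral_indic// /mu_star/=.
transitivity (\int[leb]_(x in D) (y%:E * ((\1_(f_ n @^-1` [set y]) x)%:E * (dens x)%:E)))%E; last first.
  by apply: eq_integral => x _; rewrite EFinM muleA.
have y0 : 0 <= y by move: yr; rewrite inE => -[t _ <-].
rewrite ge0_integralZl//; last 2 first.
- by apply: emeasurable_funM => //; apply/measurable_EFinP; exact: measurable_indic.
- by move=> x _; rewrite mule_ge0// lee_fin.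
congr (_ * _)%E; rewrite setIC [LHS]integral_mkcondr.
apply: eq_integral => x _; rewrite patchE indicE.
by case: ifPn => xy; rewrite ?mul1e ?mul0e.
Qed.

(** The density is even and Lebesgue measure is invariant under reflection. This symmetry is the
    source of every cancellation of drifts below. *)
Lemma mu_starN (A : set (measurableTypeR R)) : measurable A ->
  pushforward mstar (-%R : _ -> measurableTypeR R) A = mstar A.
Proof.
move=> mA.
transitivity (\int[pushforward leb (-%R : _ -> measurableTypeR R)]_(z in A)
    (dens z)%:E)%E.
  rewrite (ge0_integral_pushforward _ _ mA).
  - by apply: eq_integral => z _; rewrite /mu_star_density/= normrN.
  - exact: oppr_measurable.
  - apply/measurable_EFinP; apply: measurable_funTS.
    exact: measurable_mu_star_density.
  - by move=> z _; rewrite lee_fin mu_star_density_ge0.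
by apply: eq_measure_integral => B mB _; exact: lebesgue_measureN.
Qed.

Lemma ge0_integral_mu_starN (D : set (measurableTypeR R))
    (f : measurableTypeR R -> \bar R) :
  measurable D -> measurable_fun D f -> {in D, forall y, (0 <= f y)%E} ->
  (\int[mstar]_(y in D) f y = \int[mstar]_(y in -%R @^-1` D) f (- y)%R)%E.
Proof.
move=> mD mf f0.
transitivity (\int[pushforward mstar (-%R : _ -> measurableTypeR R)]_(z in D)
    f z)%E.
  by apply: eq_measure_integral => A mA AS; exact/esym/mu_starN.
by rewrite ge0_integral_pushforward.
Qed.

End mu_star_theory.

(** * Integrals of powers over intervals and rays *)

Section powR_integrals.
Context (R : realType).
Notation leb := (@lebesgue_measure R).

Lemma powR_continuous_at (s x : R) : 0 < x -> {for x, continuous (fun x : R => x `^ s)}.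
Proof.
move=> x0; apply: differentiable_continuous; apply/derivable1_diffP.
by apply: derivable_powR; rewrite in_itv/= andbT.
Qed.

Lemma integral_powR_itv (s a b : R) : s != 0 -> 0 < a -> a < b ->
  (\int[leb]_(x in `[a, b]) (x `^ (s - 1))%:E = ((b `^ s - a `^ s) / s)%:E)%E.
Proof.
move=> s0 a0 ab.
have pos x : x \in `]a, b[ -> 0 < x.
  by rewrite in_itv/= => /andP[ax _]; exact: lt_trans ax.
have pos' x : x \in `[a, b] -> 0 < x.
  by rewrite in_itv/= => /andP[ax _]; exact: lt_le_trans ax.
have dF (x : R) : 0 < x -> is_derive x 1 (fun x : R => s^-1 * x `^ s) (x `^ (s - 1)).
  move=> x0; have := is_derive1_powR s x0 => dd.
  have -> : x `^ (s - 1) = s^-1 *: (s * x `^ (s - 1)).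
    by rewrite /GRing.scale/= mulrA mulVf// mul1r.
  exact: is_deriveZ.
have cF (x : R) : 0 < x -> {for x, continuous (fun x : R => s^-1 * x `^ s)}.
  move=> x0; apply: differentiable_continuous; apply/derivable1_diffP.
  by have [] := dF x x0.
rewrite (@continuous_FTC2 _ _ (fun x : R => s^-1 * x `^ s))//.
- by rewrite -EFinB -mulrBr mulrC.
- apply: continuous_in_subspaceT => x /[!inE]/= xab.
  by apply: powR_continuous_at; exact: pos'.
- split.
  + by move=> x xab; have [] := dF x (pos _ xab).
  + by apply: cvg_at_right_filter; exact: cF.
  + by apply: cvg_at_left_filter; apply: cF; exact: lt_trans ab.
- move=> x xab; rewrite derive1E; exact: (@derive_val _ _ _ _ _ _ _ (dF x (pos _ xab))).
Qed.

Lemma integral_powR_ray (s a : R) : s < 0 -> 0 < a ->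
  (\int[leb]_(x in `[a, +oo[) (x `^ (s - 1))%:E = (- (a `^ s) / s)%:E)%E.
Proof.
move=> s0 a0; have sn0 : s != 0 by rewrite lt_eqF.
have dF (x : R) : 0 < x -> is_derive x 1 (fun x : R => s^-1 * x `^ s) (x `^ (s - 1)).
  move=> x0; have := is_derive1_powR s x0 => dd.
  have -> : x `^ (s - 1) = s^-1 *: (s * x `^ (s - 1)).
    by rewrite /GRing.scale/= mulrA mulVf// mul1r.
  exact: is_deriveZ.
have cF (x : R) : 0 < x -> {for x, continuous (fun x : R => s^-1 * x `^ s)}.
  move=> x0; apply: differentiable_continuous; apply/derivable1_diffP.
  by have [] := dF x x0.
rewrite (@ge0_continuous_FTC2y _ _ (fun x : R => s^-1 * x `^ s) a 0)//.
- by rewrite -EFinB sub0r mulrC mulNr.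
- by move=> x _; exact: powR_ge0.
- apply: continuous_in_subspaceT => x /[!inE]/=; rewrite in_itv/= andbT => ax.
  by apply: powR_continuous_at; exact: lt_le_trans ax.
(* Since s < 0, x^s <= e as soon as x >= e^(1/s). *)
- rewrite -(mulr0 s^-1); apply: cvgMr; apply/cvgrPdist_le => e e0.
  near=> x; rewrite sub0r normrN ger0_norm ?powR_ge0//.
  have e1 : 0 < e `^ s^-1 by exact: powR_gt0.
  have x1 : e `^ s^-1 <= x by near: x; exact: nbhs_pinfty_ge (num_real _).
  have x0 : 0 < x by exact: lt_le_trans x1.
  rewrite -(opprK s) powRN invf_ple ?posrE ?powR_gt0//.
  have -> : e^-1 = (e `^ s^-1) `^ (- s).
    by rewrite -powRrM mulrN mulVf// -powR_inv1// ltW.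
  by apply: ge0_ler_powR; rewrite ?nnegrE ?oppr_ge0 ?(ltW s0) ?(ltW e1)// (le_trans (ltW e1)).
- by move=> x ax; have [] := dF x (lt_trans a0 ax).
- by apply: cvg_at_right_filter; exact: cF.
- move=> x; rewrite in_itv/= andbT => ax.
  by rewrite derive1E; exact: (@derive_val _ _ _ _ _ _ _ (dF x (lt_trans a0 ax))).
Unshelve. all: by end_near. Qed.

End powR_integrals.

(** * Second moments and masses of intervals under [mu_star] *)

Section mu_star_estimates.
Context (R : realType) (alpha : R).
Hypotheses (alpha_gt1 : 1 < alpha) (alpha_lt2 : alpha < 2).
Notation leb := (@lebesgue_measure R).
Notation mstar := (@mu_star R alpha).
Notation dens := (@mu_star_density R alpha).

Let alpha_gt0 : 0 < alpha. Proof. exact: lt_trans alpha_gt1. Qed.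

Let alpha1_ge0 : 0 <= 1 + alpha. Proof. by rewrite addr_ge0// ltW. Qed.

Lemma measurable_sqr_EFin (D : set (measurableTypeR R)) :
  measurable_fun D (fun z : measurableTypeR R => (z ^+ 2 : R)%:E).
Proof.
by apply/measurable_EFinP; apply: measurable_funX; exact: measurable_id.
Qed.

Lemma integral_sqr_mu_star_itv (a b : R) : 0 < a -> a < b ->
  (\int[mstar]_(z in `[a, b]) (z ^+ 2)%:E =
   ((b `^ (2 - alpha) - a `^ (2 - alpha)) / (2 - alpha))%:E)%E.
Proof.
move=> a0 ab; rewrite ge0_integral_mu_star//; last 2 first.
- exact: measurable_sqr_EFin.
- by move=> z _; rewrite lee_fin sqr_ge0.
rewrite -integral_powR_itv//; last by rewrite subr_eq0 gt_eqF.
apply: eq_integral => z; rewrite inE/= in_itv/= => /andP[az _].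
have z0 : 0 < z by exact: lt_le_trans az.
rewrite -EFinM /mu_star_density gtr0_norm// -powRN -powR_mulrn ?ltW//.
rewrite -powRD; last by rewrite (gt_eqF z0) implybT.
by congr (_ `^ _)%:E; ring.
Qed.

Lemma mu_star_ray (a : R) : 0 < a -> mstar `[a, +oo[ = (a `^ (- alpha) / alpha)%:E.
Proof.
move=> a0; have -> : a `^ (- alpha) / alpha = - (a `^ (- alpha)) / (- alpha).
  by rewrite invrN mulrNN.
rewrite -integral_powR_ray//; last by rewrite oppr_lt0.
apply: eq_integral => z; rewrite inE/= in_itv/= andbT => az.
have z0 : 0 < z by exact: lt_le_trans az.
rewrite /mu_star_density gtr0_norm// -powRN.
by congr (_ `^ _)%:E; ring.
Qed.

(** Length times the density at the end nearer to 0. It will bound the mass of the window of jumps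
    censored at one point only. *)
Lemma mu_star_itv_le (a b : R) : 0 < a -> a <= b ->
  (mstar `[a, b] <= ((b - a) * a `^ (- (1 + alpha)))%:E)%E.
Proof.
move=> a0 ab; rewrite /mu_star/=.
apply: (@le_trans _ _ (\int[leb]_(z in `[a, b]) (a `^ (- (1 + alpha)))%:E)%E).
  apply: ge0_le_integral => //.
  - by move=> z _; rewrite lee_fin mu_star_density_ge0.
  - by apply/measurable_EFinP; apply: measurable_funTS; exact: measurable_mu_star_density.
  - move=> z /=; rewrite in_itv/= => /andP[az _].
    have z0 : 0 < z by exact: lt_le_trans az.
    rewrite lee_fin /mu_star_density gtr0_norm// powRN lef_pV2 ?posrE ?powR_gt0//.
    by apply: ge0_ler_powR => //; rewrite nnegrE ltW//.
rewrite integral_cst//= lebesgue_measure_itv/= lte_fin.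
case: ltP => [_|ba]; first by rewrite -EFinB -EFinM mulrC.
by rewrite mule0 lee_fin mulr_ge0 ?powR_ge0// subr_ge0.
Qed.

(** Length times the density at the end farther from 0; it will bound the mean jump near the
    boundary from below. *)
Lemma le_mu_star_itv (a b : R) : 0 < a -> a <= b ->
  (((b - a) * b `^ (- (1 + alpha)))%:E <= mstar `[a, b])%E.
Proof.
move=> a0 ab; rewrite /mu_star/=.
apply: (@le_trans _ _ (\int[leb]_(z in `[a, b]) (b `^ (- (1 + alpha)))%:E)%E).
  rewrite integral_cst//= lebesgue_measure_itv/= lte_fin.
  case: ltP => [_|ba]; first by rewrite -EFinB -EFinM mulrC.
  by rewrite mule0 lee_fin mulr_le0_ge0 ?powR_ge0// subr_le0.
apply: ge0_le_integral => //.
- by move=> z _; rewrite lee_fin powR_ge0.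
- by apply/measurable_EFinP; apply: measurable_funTS; exact: measurable_mu_star_density.
- move=> z /=; rewrite in_itv/= => /andP[az zb].
  have z0 : 0 < z by exact: lt_le_trans az.
  rewrite lee_fin /mu_star_density gtr0_norm// powRN lef_pV2 ?posrE ?powR_gt0//; last exact: lt_le_trans zb.
  by apply: ge0_ler_powR => //; rewrite nnegrE ltW// (lt_le_trans _ zb).
Qed.

Lemma mu_star_opp_itv (a b : R) : mstar `[- b, - a] = mstar `[a, b].
Proof.
rewrite -(mu_starN alpha (A := `[a, b])); last exact: measurable_itv.
by rewrite /pushforward opp_preimage_itvbndbnd.
Qed.

Lemma mu_star_set1 (a : R) : mstar [set a] = 0%E.
Proof. by rewrite /mu_star/= integral_set1. Qed.

End mu_star_estimates.

(** * Integration against mu *)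

Section levy_measure.
Context (R : realType) (alpha : R).
Hypotheses (alpha_gt1 : 1 < alpha) (alpha_lt2 : alpha < 2).
Notation TR := (measurableTypeR R).
Variables mu ms : {measure set (measurableTypeR R) -> \bar R}.
Hypothesis ms_fin : (\int[ms]_(z in [set~ 0%R])
  (Num.min 1 (`|z| `^ (alpha - 1)))%:E < +oo)%E.
Hypothesis muE : forall A : set TR, measurable A ->
  (mu A = mu_star alpha A + ms A)%E.
Notation mstar := (@mu_star R alpha).

Definition far (r : R) : set (measurableTypeR R) := [set z | r <= `|z|].
(** The weight whose integral against [ms] is assumed finite; every integral against [ms] is
    estimated by comparison with it. *)
Definition tau (z : R) : R := Num.min 1 (`|z| `^ (alpha - 1)).
Definition Csharp : R := fine (\int[ms]_(z in [set~ 0%R]) (tau z)%:E).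

Lemma measurable_far r : measurable (far r).
Proof.
rewrite (_ : far r = Num.norm @^-1` `[r, +oo[); last first.
  by apply/seteqP; split => z; rewrite /far/= in_itv/= andbT.
rewrite -[X in measurable X]setTI; apply: (@normr_measurable R setT) => //.
Qed.

Lemma far_ne0 r z : 0 < r -> far r z -> z != 0.
Proof. by move=> r0; rewrite /far/= => rz; rewrite -normr_gt0 (lt_le_trans r0). Qed.

Lemma tau_ge0 z : 0 <= tau z.
Proof. by rewrite /tau le_min ler01 powR_ge0. Qed.

Lemma tau_le1 z : tau z <= 1.
Proof. by rewrite /tau ge_min lexx. Qed.

Lemma measurable_tau (D : set TR) : measurable_fun D (tau : TR -> R).
Proof.
apply: measurable_funTS; apply: measurable_minr => //.
by apply: measurableT_comp (measurable_powR _) _; exact: (@normr_measurable R setT).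
Qed.

Lemma Csharp_ge0 : 0 <= Csharp.
Proof. by apply/fine_ge0/integral_ge0 => z _; rewrite lee_fin tau_ge0. Qed.

Lemma CsharpE : (\int[ms]_(z in [set~ 0%R]) (tau z)%:E = Csharp%:E)%E.
Proof.
rewrite /Csharp fineK// ge0_fin_numE//.
by apply: integral_ge0 => z _; rewrite lee_fin tau_ge0.
Qed.

Lemma integral_tau_le r (S : set TR) : 0 < r -> measurable S -> S `<=` far r ->
  (\int[ms]_(z in S) (tau z)%:E <= Csharp%:E)%E.
Proof.
move=> r0 mS Sr; rewrite -CsharpE; apply: ge0_subset_integral => //.
- by apply: measurableC; exact: measurable_set1.
- by apply/measurable_EFinP; exact: measurable_tau.
- by move=> z _; rewrite lee_fin tau_ge0.
- by move=> z /Sr /(far_ne0 r0) /eqP.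
Qed.

(** Markov's inequality: on [far r] the weight [tau] is at least min(1, r^(alpha - 1)). *)
Lemma ms_far_fin r : 0 < r -> (ms (far r) < +oo)%E.
Proof.
move=> r0; pose c := Num.min 1 (r `^ (alpha - 1)).
have c0 : 0 < c by rewrite lt_min ltr01 powR_gt0.
have H : (c%:E * ms (far r) <= Csharp%:E)%E.
  apply: le_trans (integral_tau_le r0 (measurable_far r) (@subset_refl _ _)).
  rewrite -integral_cst//; last exact: measurable_far.
  apply: ge0_le_integral => //.
  - exact: measurable_far.
  - by move=> z _; rewrite lee_fin ltW.
  - by apply/measurable_EFinP; exact: measurable_tau.
  - move=> z /= rz; rewrite lee_fin /c /tau le_min ge_min lexx/= ge_min.
    apply/orP; right; apply: ge0_ler_powR => //; rewrite ?nnegrE ?subr_ge0 ?ltW//.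
rewrite -(@lte_pmul2l _ c%:E)// gt0_muley ?lte_fin//.
exact: le_lt_trans H (ltry _).
Qed.

Lemma far_itv r : 0 < r ->
  far r = `[r, +oo[ `|` (-%R : TR -> TR) @^-1` `[r, +oo[.
Proof.
move=> r0; apply/seteqP; split => z /=; rewrite /far/= !in_itv/= !andbT.
  have [z0|z0] := leP 0 z; first by rewrite ger0_norm//; left.
  by rewrite ltr0_norm//; right.
by move=> [|] zr; [|rewrite -normrN]; exact: le_trans zr (ler_norm _).
Qed.

Lemma mu_star_far_fin r : 0 < r -> (mstar (far r) < +oo)%E.
Proof.
move=> r0; rewrite far_itv//.
have m1 : measurable (`[r, +oo[ : set TR) by exact: measurable_itv.
have m2 : measurable ((-%R : TR -> TR) @^-1` `[r, +oo[).
  by rewrite -[X in measurable X]setTI; exact: oppr_measurable.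
apply: le_lt_trans (measureU2 _ m1 m2) _.
have ry : (mstar `[r, +oo[ < +oo)%E by rewrite mu_star_ray// ltry.
apply: lte_add_pinfty => //; apply: le_lt_trans ry.
by rewrite -(mu_starN alpha m1).
Qed.

Lemma mu_far_fin r : 0 < r -> (mu (far r) < +oo)%E.
Proof.
move=> r0; rewrite muE; last exact: measurable_far.
by rewrite lte_add_pinfty ?mu_star_far_fin ?ms_far_fin.
Qed.

Lemma bounded_integrable (m : {measure set TR -> \bar R}) (S : set TR) (g : TR -> R) (M : R) :
  (m S < +oo)%E -> measurable S -> measurable_fun S g ->
  (forall z, S z -> `|g z| <= M) -> m.-integrable S (EFin \o g).
Proof.
move=> fS mS mg gM; apply: measurable_bounded_integrable => //.
by exists M; split; [exact: num_real|move=> x Mx z Sz; apply: le_trans (gM _ Sz) (ltW Mx)].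
Qed.

Lemma sub_far_fin (m : {measure set TR -> \bar R}) (S : set TR) r :
  (m (far r) < +oo)%E -> measurable S -> S `<=` far r -> (m S < +oo)%E.
Proof.
move=> mf mS Sr; apply: le_lt_trans mf.
by apply: le_measure; rewrite ?inE//; exact: measurable_far.
Qed.

Section bounded_functions.
Context (r : R) (S : set TR) (g : TR -> R) (M : R).
Hypotheses (r0 : 0 < r) (mS : measurable S) (Sr : S `<=` far r).
Hypotheses (mg : measurable_fun S g) (gM : forall z, S z -> `|g z| <= M).

Lemma mu_integrable : mu.-integrable S (EFin \o g).
Proof. exact: (bounded_integrable (sub_far_fin (mu_far_fin r0) mS Sr) mS mg gM). Qed.

Lemma mu_star_integrable : mstar.-integrable S (EFin \o g).
Proof. exact: (bounded_integrable (sub_far_fin (mu_star_far_fin r0) mS Sr) mS mg gM). Qed.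

Lemma ms_integrable : ms.-integrable S (EFin \o g).
Proof. exact: (bounded_integrable (sub_far_fin (ms_far_fin r0) mS Sr) mS mg gM). Qed.

(** The decomposition of [mu] is known on measurable sets only, so it passes through [measure_add];
    real-valued integrals add up because both parts are integrable on sets away from 0. *)
Lemma Rintegral_muE :
  \int[mu]_(z in S) g z = \int[mstar]_(z in S) g z + \int[ms]_(z in S) g z.
Proof.
rewrite /Rintegral -fineD; last 2 first.
- by apply: integrable_fin_num => //; exact: mu_star_integrable.
- by apply: integrable_fin_num => //; exact: ms_integrable.
congr fine.
transitivity (\int[measure_add mstar ms]_(z in S) (g z)%:E)%E.
  by apply: eq_measure_integral => A mA _; exact: etrans (muE mA) (esym (measure_addE _ _ _)).
apply: integral_measure_add => //; first exact: mu_star_integrable.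
exact: ms_integrable.
Qed.

End bounded_functions.

End levy_measure.

(** * The mean censored jump under [mu_star] *)

Section mean_jump.
Context (R : realType) (alpha : R).
Hypotheses (alpha_gt1 : 1 < alpha) (alpha_lt2 : alpha < 2).
Notation TR := (measurableTypeR R).
Notation mstar := (@mu_star R alpha).

(** Reflection turns the integral into its opposite. *)
Lemma Rintegral_mu_star_odd (S : set TR) (g : TR -> R) :
  measurable S -> (forall z, S z -> S (- z)) ->
  measurable_fun setT g -> (forall z, g (- z) = - g z) ->
  mstar.-integrable S (EFin \o g) -> \int[mstar]_(z in S) g z = 0.
Proof.
move=> mS SN mg gN ig.
have SNE : (-%R : TR -> TR) @^-1` S = S.
  by apply/seteqP; split => z /= /SN //; rewrite opprK.
have igN : mstar.-integrable ((-%R : TR -> TR) @^-1` S)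
    ((EFin \o g) \o (-%R : TR -> TR)).
  rewrite SNE (_ : _ \o _ = (fun z => - (g z)%:E)%E); last first.
    by apply/funext => z /=; rewrite gN.
  exact: integrableN.
have H : \int[mstar]_(z in S) g z = \int[mstar]_(z in S) g (- z).
  rewrite /Rintegral; congr fine.
  transitivity (\int[pushforward mstar (-%R : _ -> TR)]_(z in S) (g z)%:E)%E.
    by apply: eq_measure_integral => A mA AS; exact/esym/mu_starN.
  rewrite (integral_pushforward _ _ igN)//; first by rewrite SNE.
  exact/measurable_EFinP.
have : \int[mstar]_(z in S) g (- z) = - \int[mstar]_(z in S) g z.
  rewrite -mulN1r -RintegralZl//; apply: eq_Rintegral => z _.
  by rewrite gN mulN1r.
rewrite -H => /eqP; rewrite -subr_eq0 opprK -mulr2n mulrn_eq0/=.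
by move/eqP.
Qed.

(** * Jumps rounded by an odd map [zeta]: the identity with K = 1, or rounding to a grid *)

Section zeta.
Variables (r rho K : R) (zeta : TR -> R) (S : set TR).
Hypotheses (r0 : 0 < r) (r_rho : r < rho) (K1 : 1 <= K).
Hypothesis mzeta : measurable_fun setT zeta.
Hypothesis zetaN : forall z, zeta (- z) = - zeta z.
Hypothesis zetaP : forall z, r <= z -> z <= zeta z <= K * z.
Hypotheses (mS : measurable S) (SN : forall z, S z -> S (- z)).
Hypothesis (Srho : forall z, S z -> r <= `|z| <= rho).

Lemma normr_zeta z : r <= `|z| -> `|zeta z| <= K * `|z|.
Proof.
have K0 : 0 <= K by apply: le_trans K1.
wlog z0 : z / 0 <= z.
  move=> H; have [/H//|z0] := leP 0 z.
  by have := H (- z); rewrite zetaN !normrN oppr_ge0 (ltW z0); apply.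
rewrite ger0_norm// => rz; have /andP[z1 z2] := zetaP rz.
by rewrite ger0_norm// (le_trans z0).
Qed.

Lemma normr_zeta_rho z : S z -> `|zeta z| <= K * rho.
Proof.
move=> /Srho/andP[z1 z2]; apply: le_trans (normr_zeta z1) _.
by rewrite ler_wpM2l// (le_trans _ K1).
Qed.

Lemma measurable_eta (x : R) : measurable_fun setT (fun z : TR => eta x (zeta z)).
Proof.
apply: measurable_fun_if => //.
- apply: measurable_fun_ler => //; exact: measurable_funD.
- exact: measurable_funTS.
Qed.

Lemma sub_S_far : S `<=` far r.
Proof. by move=> z /Srho/andP[]. Qed.

Lemma normr_eta (x w : R) : `|eta x w| <= `|w|.
Proof. by rewrite /eta; case: ifP => // _; rewrite normr0. Qed.

(** Jumps with |zeta z| <= x are censored in neither direction and cancel by oddness; of the longer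
    ones exactly those to the right survive. *)
Lemma mean_jumpE (x : R) : 0 <= x ->
  \int[mstar]_(z in S) eta x (zeta z) =
  \int[mstar]_(z in S) (if x < zeta z then zeta z else 0).
Proof.
move=> x0.
have m1 : measurable_fun setT
    (fun z : TR => if x < zeta z then zeta z else 0 : R).
  apply: measurable_fun_if => //; first exact: measurable_fun_ltr.
  exact: measurable_funTS.
have m2 : measurable_fun setT
    (fun z : TR => if `|zeta z| <= x then zeta z else 0 : R).
  apply: measurable_fun_if => //.
    by apply: measurable_fun_ler => //; exact: measurableT_comp.
  exact: measurable_funTS.
have i1 : mstar.-integrable S
    (EFin \o (fun z : TR => if x < zeta z then zeta z else 0 : R)).
  apply: (@mu_star_integrable _ _ alpha_gt1 r _ _ (K * rho)) => //.
  - exact: sub_S_far.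
  - exact: measurable_funTS.
  - move=> z Sz; case: ifP => _; first exact: normr_zeta_rho.
    by rewrite normr0 (le_trans _ (normr_zeta_rho Sz)).
have i2 : mstar.-integrable S
    (EFin \o (fun z : TR => if `|zeta z| <= x then zeta z else 0 : R)).
  apply: (@mu_star_integrable _ _ alpha_gt1 r _ _ (K * rho)) => //.
  - exact: sub_S_far.
  - exact: measurable_funTS.
  - move=> z Sz; case: ifP => _; first exact: normr_zeta_rho.
    by rewrite normr0 (le_trans _ (normr_zeta_rho Sz)).
rewrite -[RHS]add0r -[X in _ = X + _](@Rintegral_mu_star_odd S
   (fun z : TR => if `|zeta z| <= x then zeta z else 0 : R)) //; last first.
  by move=> z; rewrite zetaN normrN; case: ifP => // _; rewrite oppr0.
rewrite -RintegralD//; apply: eq_Rintegral => z _.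
rewrite /eta; set w := zeta z.
have [w0|w0] := leP 0 w.
  rewrite addr_ge0// ger0_norm//.
  by case: leP; rewrite ?addr0 ?add0r.
rewrite ltr0_norm// ltNge (le_trans (ltW w0) x0)/= addr0.
by rewrite -[in RHS]subr_ge0 opprK.
Qed.

Lemma mean_jump_ge0 (x : R) : 0 <= x -> 0 <= \int[mstar]_(z in S) eta x (zeta z).
Proof.
move=> x0; rewrite mean_jumpE//; apply: Rintegral_ge0 => z Sz.
by case: ifP => // /ltW; exact: le_trans.
Qed.

(** K rho bounds every rounded jump, so at distance at least K rho from the boundary nothing is
    censored. *)
Lemma mean_jump_eq0 (x : R) : K * rho <= x ->
  \int[mstar]_(z in S) eta x (zeta z) = 0.
Proof.
move=> Kx; have rho0 : 0 < rho by exact: lt_trans r_rho.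
have x0 : 0 <= x.
  by apply: le_trans Kx; rewrite mulr_ge0 ?(ltW rho0)// (le_trans _ K1).
rewrite mean_jumpE// -[RHS](@Rintegral_set0 _ _ _ mstar (fun=> 0)).
rewrite [RHS]Rintegral_set0.
transitivity (\int[mstar]_(z in S) (0 : R)); last first.
  by rewrite Rintegral_cst// mul0r.
apply: eq_Rintegral => z; rewrite inE => Sz; rewrite ltNge.
by rewrite (le_trans (ler_norm _))// (le_trans (normr_zeta_rho Sz)).
Qed.

(** Every jump in [[s, 2 * s]] survives, since it exceeds x, and moves the point by at least s. The
    mass of these jumps is at least s times the density at 2 s. *)
Lemma mean_jump_ge (x s : R) : 0 <= x -> x < s -> r <= s -> `[s, 2 * s] `<=` S ->
  s * (s * (2 * s) `^ (- (1 + alpha))) <= \int[mstar]_(z in S) eta x (zeta z).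
Proof.
move=> x0 xs rs sS; have s0 : 0 < s by exact: le_lt_trans xs.
have mT : measurable (`[s, 2 * s] : set TR) by exact: measurable_itv.
have m1 : measurable_fun setT
    (fun z : TR => if x < zeta z then zeta z else 0 : R).
  apply: measurable_fun_if => //; first exact: measurable_fun_ltr.
  exact: measurable_funTS.
apply: (@le_trans _ _ (\int[mstar]_(z in S) (s * \1_(`[s, 2 * s] : set TR) z))).
  have fT : (mstar (`[s, (2 * s)%R] : set TR) < +oo)%E.
    apply: (sub_far_fin (mu_star_far_fin alpha_gt1 r0)) => //.
    by apply: subset_trans sS _; exact: sub_S_far.
  rewrite RintegralZl//; last first.
    apply: (@mu_star_integrable _ _ alpha_gt1 r _ _ 1) => //.
    - exact: sub_S_far.
    - by move=> z _; rewrite indicE; case: (_ \in _); rewrite ?normr1 ?normr0.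
  rewrite ler_wpM2l ?(ltW s0)// /Rintegral integral_indic// setIidl//.
  rewrite -lee_fin fineK ?ge0_fin_numE//.
  have := le_mu_star_itv alpha_gt1 s0 (_ : s <= 2 * s).
  rewrite (_ : 2 * s - s = s); last by ring.
  by apply; rewrite ler_peMl ?(ltW s0)// ler1n.
rewrite mean_jumpE//; apply: le_Rintegral => //.
- apply: (@mu_star_integrable _ _ alpha_gt1 r _ _ s) => //.
  + exact: sub_S_far.
  + by apply: measurable_funM => //; exact: measurable_indic.
  + move=> z _; rewrite indicE normrM (gtr0_norm s0).
    by case: (_ \in _); rewrite ?normr1 ?normr0 ?mulr1 ?mulr0// ltW.
- apply: (@mu_star_integrable _ _ alpha_gt1 r _ _ (K * rho)) => //.
  + exact: sub_S_far.
  + exact: measurable_funTS.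
  + move=> z Sz; case: ifP => _; first exact: normr_zeta_rho.
    by rewrite normr0 (le_trans _ (normr_zeta_rho Sz)).
- move=> z Sz; rewrite indicE; case: (boolP (z \in _)) => [|_].
    rewrite inE/= in_itv/= => /andP[sz _]; rewrite mulr1.
    have /andP[z1 _] := zetaP (le_trans rs sz).
    by rewrite (lt_le_trans xs (le_trans sz z1)) (le_trans sz z1).
  by rewrite mulr0; case: ifP => // /ltW; exact: le_trans.
Qed.

End zeta.

End mean_jump.

Section second_moment.
Context (R : realType) (alpha : R).
Hypotheses (alpha_gt1 : 1 < alpha) (alpha_lt2 : alpha < 2).
Notation TR := (measurableTypeR R).
Notation mstar := (@mu_star R alpha).

Lemma integral_sqr_mu_star_annulus (r rho : R) (S : set TR) : 0 < r -> r < rho ->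
  measurable S -> (forall z, S z -> r <= `|z| <= rho) ->
  (\int[mstar]_(z in S) (z ^+ 2)%:E <=
    (2 / (2 - alpha) * rho `^ (2 - alpha))%:E)%E.
Proof.
move=> r0 rrho mS Srho.
have m1 : measurable (`[r, rho] : set TR) by exact: measurable_itv.
have m2 : measurable ((-%R : TR -> TR) @^-1` `[r, rho]).
  by rewrite -[X in measurable X]setTI; exact: oppr_measurable.
have e0 z : (0 <= (z ^+ 2 : R)%:E)%E by rewrite lee_fin sqr_ge0.
have i1 := integral_sqr_mu_star_itv alpha_lt2 r0 rrho.
have i2 : (\int[mstar]_(z in (-%R : TR -> TR) @^-1` `[r, rho]) (z ^+ 2)%:E =
   ((rho `^ (2 - alpha) - r `^ (2 - alpha)) / (2 - alpha))%:E)%E.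
  rewrite -i1 [RHS]ge0_integral_mu_starN//; last exact: measurable_sqr_EFin.
  by apply: eq_integral => z _; rewrite sqrrN.
apply: (@le_trans _ _ (\int[mstar]_(z in `[r, rho] `|`
    (-%R : TR -> TR) @^-1` `[r, rho]) (z ^+ 2)%:E)%E).
  apply: ge0_subset_integral => //.
  - exact: measurableU.
  - exact: measurable_sqr_EFin.
  - move=> z /Srho; rewrite /= !in_itv/=.
    by have [z0|z0] := leP 0 z; [rewrite ger0_norm//; left|rewrite ltr0_norm//; right].
rewrite ge0_integral_setU//; last 2 first.
- exact: measurable_sqr_EFin.
- apply/disj_setPS => z [] /=; rewrite !in_itv/= => /andP[a _] /andP[b _].
  by have := ltr_leD r0 a; have := ltr_leD r0 b; lra.
rewrite i1 i2 -EFinD lee_fin -mulrDl [leRHS]mulrAC.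
have a2 : 0 < 2 - alpha by rewrite subr_gt0.
have := powR_ge0 r (2 - alpha); set u := powR r _; set v := powR rho _ => u0.
by rewrite ler_wpM2r ?invr_ge0 ?(ltW a2)//; lra.
Qed.

End second_moment.

(** * One-sided bounds for integrals over small jumps *)

Section jump_expansion.
Context (R : realType) (alpha : R).
Hypotheses (alpha_gt1 : 1 < alpha) (alpha_lt2 : alpha < 2).
Notation TR := (measurableTypeR R).
Variables mu ms : {measure set (measurableTypeR R) -> \bar R}.
Hypothesis ms_fin : (\int[ms]_(z in [set~ 0%R])
  (Num.min 1 (`|z| `^ (alpha - 1)))%:E < +oo)%E.
Hypothesis muE : forall A : set TR, measurable A ->
  (mu A = mu_star alpha A + ms A)%E.
Notation mstar := (@mu_star R alpha).

(** The coefficient of rho^(2 - alpha): the first summand comes from the second moment of [mu_star]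
    over the two halves of an annulus, the second from [ms]. *)
Definition levy_cst : R := 2 / (2 - alpha) + Csharp alpha ms.

Lemma levy_cst_ge0 : 0 <= levy_cst.
Proof. by rewrite addr_ge0 ?Csharp_ge0// divr_ge0// subr_ge0 ltW. Qed.

(** Split |z| = |z|^(2 - alpha) |z|^(alpha - 1); for |z| <= 1 the second factor is [tau]. Thus
    first-order terms against [ms] have the same order rho^(2 - alpha) as second-order terms against
    [mu_star]. *)
Lemma normr_le_tau (z rho : R) : 0 < `|z| -> `|z| <= rho -> rho <= 1 ->
  `|z| <= rho `^ (2 - alpha) * tau alpha z.
Proof.
move=> z0 zrho rho1.
have -> : tau alpha z = `|z| `^ (alpha - 1).
  have e1 : 1 `^ (alpha - 1) = 1 :> R by rewrite powR1.
  rewrite /tau; apply/min_idPr; rewrite -[leRHS]e1.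
  by apply: ge0_ler_powR; rewrite ?nnegrE ?subr_ge0 ?(ltW alpha_gt1)// (le_trans zrho).
have {1}-> : `|z| = `|z| `^ (2 - alpha) * `|z| `^ (alpha - 1).
  rewrite -powRD; last by rewrite (gt_eqF z0) implybT.
  by rewrite (_ : 2 - alpha + (alpha - 1) = 1) ?powRr1//; ring.
apply: ler_wpM2r; first exact: powR_ge0.
by apply: ge0_ler_powR; rewrite ?nnegrE ?subr_ge0 ?(ltW alpha_lt2)// (le_trans _ zrho).
Qed.

Lemma Rintegral_ms_le (r M c : R) (S : set TR) (g : TR -> R) :
  0 < r -> measurable S -> S `<=` far r -> measurable_fun S g ->
  (forall z, S z -> `|g z| <= M) -> 0 <= c ->
  (forall z, S z -> g z <= c * tau alpha z) ->
  \int[ms]_(z in S) g z <= c * Csharp alpha ms.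
Proof.
move=> r0 mS Sr mg gM c0 gc.
have it : ms.-integrable S (EFin \o tau alpha).
  apply: (@ms_integrable _ alpha alpha_gt1 ms ms_fin r _ _ 1) => //.
    exact: measurable_tau.
  by move=> z _; rewrite ger0_norm ?tau_ge0// tau_le1.
apply: (@le_trans _ _ (\int[ms]_(z in S) (c * tau alpha z))).
  apply: le_Rintegral => //.
  - exact: (@ms_integrable _ alpha alpha_gt1 ms ms_fin r _ _ M).
  - rewrite (_ : _ \o _ = (fun z => c%:E * (tau alpha z)%:E)%E)//.
    exact: integrableZl.
rewrite RintegralZl// ler_wpM2l//.
rewrite -lee_fin /Rintegral fineK; last exact: integrable_fin_num.
exact: integral_tau_le r0 mS Sr.
Qed.

Section zeta.
Variables (r rho K : R) (zeta : TR -> R) (S : set TR).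
Hypotheses (r0 : 0 < r) (r_rho : r < rho) (rho1 : rho <= 1) (K1 : 1 <= K).
Hypothesis mzeta : measurable_fun setT zeta.
Hypothesis zetaN : forall z, zeta (- z) = - zeta z.
Hypothesis zetaP : forall z, r <= z -> z <= zeta z <= K * z.
Hypotheses (mS : measurable S) (SN : forall z, S z -> S (- z)).
Hypothesis (Srho : forall z, S z -> r <= `|z| <= rho).

Let S_far : S `<=` far r. Proof. exact: (sub_S_far Srho). Qed.

Let K0 : 0 <= K. Proof. exact: le_trans K1. Qed.

Let rho0 : 0 < rho. Proof. exact: lt_trans r_rho. Qed.

Let sqr_zeta z : S z -> zeta z ^+ 2 <= K ^+ 2 * z ^+ 2.
Proof.
move=> Sz; rewrite -exprMn -[leLHS]real_normK ?num_real//.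
rewrite -[leRHS]real_normK ?num_real// ler_pXn2r ?nnegrE//.
rewrite normrM (ger0_norm K0).
by have /andP[rz _] := Srho Sz; exact: (normr_zeta K1 zetaN zetaP).
Qed.

Let sqr_bound z : S z -> `|zeta z ^+ 2| <= (K * rho) ^+ 2.
Proof.
move=> Sz; rewrite ger0_norm ?sqr_ge0// (le_trans (sqr_zeta Sz))// exprMn.
rewrite ler_wpM2l ?sqr_ge0// -[leLHS]real_normK ?num_real//.
by rewrite ler_pXn2r ?nnegrE ?(ltW rho0)//; have /andP[] := Srho Sz.
Qed.

Let msqr : measurable_fun S (fun z : TR => zeta z ^+ 2 : R).
Proof. by apply: measurable_funTS; exact: measurable_funX. Qed.

Lemma Rintegral_sqr_zeta :
  \int[mstar]_(z in S) (zeta z ^+ 2) <=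
    K ^+ 2 * (2 / (2 - alpha) * rho `^ (2 - alpha)).
Proof.
have isq : mstar.-integrable S (EFin \o (fun z : TR => zeta z ^+ 2 : R)).
  exact: (@mu_star_integrable _ _ alpha_gt1 r _ _ ((K * rho) ^+ 2)).
rewrite -lee_fin /Rintegral fineK; last exact: integrable_fin_num.
apply: (@le_trans _ _ (\int[mstar]_(z in S) ((K ^+ 2)%:E * (z ^+ 2)%:E))%E).
  apply: ge0_le_integral => //.
  - by move=> z _; rewrite lee_fin sqr_ge0.
  - exact/measurable_EFinP.
  - by apply: measurable_funeM; exact: measurable_sqr_EFin.
rewrite ge0_integralZl//; last 3 first.
- exact: measurable_sqr_EFin.
- by move=> z _; rewrite lee_fin sqr_ge0.
- by rewrite lee_fin sqr_ge0.
rewrite [leRHS]EFinM; apply: lee_wpmul2l; first by rewrite lee_fin sqr_ge0.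
exact: (integral_sqr_mu_star_annulus alpha_lt2 r0 r_rho).
Qed.

(* The drift contributes p times the mean jump under mu_star, where the odd
   part cancels; everything else is of order rho^(2 - alpha). *)
Lemma Rintegral_jump_le (x p C M : R) (G : TR -> R) :
  0 <= x -> 0 <= C -> measurable_fun S G -> (forall z, S z -> `|G z| <= M) ->
  (forall z, S z -> G z <= p * eta x (zeta z) + C * zeta z ^+ 2) ->
  \int[mu]_(z in S) G z <= p * (\int[mstar]_(z in S) eta x (zeta z)) +
    (`|p| + C) * K ^+ 2 * levy_cst * rho `^ (2 - alpha).
Proof.
move=> x0 C0 mG GM Gle.
have K21 : K <= K ^+ 2 by rewrite expr2 ler_peMl.
rewrite (Rintegral_muE alpha_gt1 ms_fin muE r0 mS S_far mG GM).
have ieta : mstar.-integrable S (EFin \o (fun z : TR => eta x (zeta z))).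
  apply: (@mu_star_integrable _ _ alpha_gt1 r _ _ (K * rho)) => //.
    by apply: measurable_funTS; exact: measurable_eta.
  move=> z Sz; apply: le_trans (normr_eta _ _) _.
  exact: (normr_zeta_rho K1 zetaN zetaP Srho).
have isq : mstar.-integrable S (EFin \o (fun z : TR => zeta z ^+ 2 : R)).
  exact: (@mu_star_integrable _ _ alpha_gt1 r _ _ ((K * rho) ^+ 2)).
have ipe : mstar.-integrable S (EFin \o (fun z : TR => p * eta x (zeta z))).
  rewrite (_ : _ \o _ = (fun z => p%:E * (eta x (zeta z))%:E)%E)//.
  exact: integrableZl.
have iCs : mstar.-integrable S (EFin \o (fun z : TR => C * zeta z ^+ 2)).
  rewrite (_ : _ \o _ = (fun z => C%:E * (zeta z ^+ 2)%:E)%E)//.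
  exact: integrableZl.
have H1 : \int[mstar]_(z in S) G z <=
    p * (\int[mstar]_(z in S) eta x (zeta z)) +
    C * (K ^+ 2 * (2 / (2 - alpha) * rho `^ (2 - alpha))).
  apply: (@le_trans _ _ (\int[mstar]_(z in S)
      (p * eta x (zeta z) + C * zeta z ^+ 2))).
    apply: le_Rintegral => //.
      exact: (@mu_star_integrable _ _ alpha_gt1 r _ _ M).
    exact: (integrableD mS ipe iCs).
  rewrite RintegralD// RintegralZl// RintegralZl// lerD2l ler_wpM2l//.
  exact: Rintegral_sqr_zeta.
(* No cancellation is available here. Drift and square are both bounded by multiples of |z|, the
   square because |z| <= rho <= 1. *)
have H2 : \int[ms]_(z in S) G z <=
    (`|p| + C) * K ^+ 2 * rho `^ (2 - alpha) * Csharp alpha ms.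
  apply: (Rintegral_ms_le r0 mS S_far mG GM).
    by rewrite !mulr_ge0 ?powR_ge0 ?sqr_ge0// addr_ge0.
  move=> z Sz; apply: le_trans (Gle _ Sz) _.
  have /andP[rz zrho] := Srho Sz.
  have nz : `|z| <= rho `^ (2 - alpha) * tau alpha z.
    by apply: normr_le_tau => //; exact: lt_le_trans rz.
  rewrite -[leRHS]mulrA; apply: (@le_trans _ _ ((`|p| + C) * K ^+ 2 * `|z|)); last first.
    by apply: ler_wpM2l => //; rewrite mulr_ge0 ?sqr_ge0// addr_ge0.
  rewrite -mulrA mulrDl; apply: lerD.
    apply: le_trans (ler_norm _) _; rewrite normrM ler_wpM2l//.
    apply: le_trans (normr_eta _ _) _.
    apply: le_trans (normr_zeta K1 zetaN zetaP rz) _.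
    by rewrite ler_wpM2r.
  apply: ler_wpM2l => //; apply: le_trans (sqr_zeta Sz) _.
  rewrite ler_wpM2l ?sqr_ge0// -[leLHS]real_normK ?num_real// expr2.
  by rewrite ler_piMr// (le_trans zrho).
apply: le_trans (lerD H1 H2) _; rewrite -addrA lerD2l.
rewrite /levy_cst.
set w := rho `^ _; set c := Csharp _ _; set q := 2 / _.
have w0 : 0 <= w by exact: powR_ge0.
have q0 : 0 <= q by rewrite divr_ge0// subr_ge0 ltW.
have -> : (`|p| + C) * K ^+ 2 * (q + c) * w =
   C * (K ^+ 2 * (q * w)) + (`|p| + C) * K ^+ 2 * w * c + `|p| * K ^+ 2 * q * w.
  by ring.
rewrite lerDl; do 2 (apply: mulr_ge0; last by []).
by rewrite mulr_ge0 ?sqr_ge0.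
Qed.

End zeta.

End jump_expansion.

(** * Test functions and the inner operator *)

Section C2_functions.
Context (R : realType).
Implicit Type phi : R -> R.

(** The points may come in either order, and the intermediate point is no farther from x than y is.
    This lets the theorem be applied again to the derivative with a quadratic remainder. *)
Lemma derivable_mvt phi (a b x y : R) : (forall t, derivable phi t 1) ->
  a <= x <= b -> a <= y <= b ->
  exists2 s, a <= s <= b /\ `|s - x| <= `|y - x|
    & phi y - phi x = derive1 phi s * (y - x).
Proof.
move=> dphi /andP[ax xb] /andP[ay yb].
have H u v : u <= v -> exists2 c, c \in `[u, v] &
    phi v - phi u = derive1 phi c * (v - u).
  move=> uv; apply: MVT_segment => //.
    by move=> t _; rewrite derive1E; exact/derivableP.
  by apply: derivable_within_continuous => t _; exact: dphi.
have [xy|/ltW yx] := leP x y.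
  have [c] := H _ _ xy; rewrite in_itv/= => /andP[xc cy] e; exists c => //.
  split; first by rewrite (le_trans ax xc) (le_trans cy yb).
  by rewrite !ger0_norm ?subr_ge0// lerD2r.
have [c] := H _ _ yx; rewrite in_itv/= => /andP[yc cx] e; exists c.
  split; first by rewrite (le_trans ay yc) (le_trans cx xb).
  by rewrite ler0_norm ?subr_le0// ler0_norm ?subr_le0// lerN2 lerD2r.
by rewrite -(opprB (phi x)) e -mulrN opprB.
Qed.

Lemma continuous_bounded_itv (g : R -> R) (a b : R) : continuous g ->
  exists2 C, 0 <= C & forall t, a <= t <= b -> `|g t| <= C.
Proof.
move=> cg; have [ab|ba] := leP a b; last first.
  by exists 0 => // t /andP[a1 a2]; have := le_trans a1 a2; rewrite leNgt ba.
have ch : {within `[a, b], continuous (fun t => `|g t|)}.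
  apply: continuous_subspaceT => t.
  by apply: cvg_norm; exact: cg.
have [c _ cmax] := EVT_max ab ch.
by exists `|g c| => // t tab; apply: cmax; rewrite in_itv.
Qed.

(** Taylor's formula by two mean values in a row; this loses the factor 1/2 in the remainder, which
    is immaterial. One constant serves for the slope and the remainder. *)
Lemma C2_bounds phi (a b : R) : C2 phi ->
  exists2 C, 0 <= C & (forall t, a <= t <= b -> `|derive1 phi t| <= C) /\
   (forall x y, a <= x <= b -> a <= y <= b ->
     `|phi y - phi x - derive1 phi x * (y - x)| <= C * (y - x) ^+ 2).
Proof.
move=> [d1 d2 c2].
have [C0 C0ge C0P] := @continuous_bounded_itv _ a b c2.
have c1 : continuous (derive1 phi).
  by move=> t; apply: differentiable_continuous; exact/derivable1_diffP.
have [C1 C1ge C1P] := @continuous_bounded_itv _ a b c1.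
exists (C0 + C1); first exact: addr_ge0.
split=> [t tab|x y xab yab]; first by rewrite (le_trans (C1P _ tab))// lerDr.
have [s [sab sx] ->] := derivable_mvt d1 xab yab.
have [t [tab tx] e] := derivable_mvt d2 xab sab.
rewrite -mulrBl e -mulrA normrM; apply: ler_pM => //.
  by rewrite (le_trans (C0P _ tab))// lerDl.
by rewrite normrM -real_normK ?num_real// expr2 ler_wpM2r.
Qed.

Lemma C2_continuous phi : C2 phi -> continuous phi.
Proof.
by move=> [d1 _ _] t; apply: differentiable_continuous; exact/derivable1_diffP.
Qed.

End C2_functions.

(** * Existence of the limit defining the inner operator *)

Section inner_limit.
Context (R : realType) (alpha : R).
Hypotheses (alpha_gt1 : 1 < alpha) (alpha_lt2 : alpha < 2).
Notation TR := (measurableTypeR R).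
Variables mu ms : {measure set (measurableTypeR R) -> \bar R}.
Hypothesis ms_fin : (\int[ms]_(z in [set~ 0%R])
  (Num.min 1 (`|z| `^ (alpha - 1)))%:E < +oo)%E.
Hypothesis muE : forall A : set TR, measurable A ->
  (mu A = mu_star alpha A + ms A)%E.
Notation mstar := (@mu_star R alpha).

Lemma measurable_annulus (i j : bool) (b c : R) :
  measurable [set z : TR | (b < `|z| ?<= if i) && (`|z| < c ?<= if j)].
Proof.
rewrite (_ : [set _ | _] = Num.norm @^-1`
   [set` Interval (BSide i b) (BSide (~~ j) c)]); last first.
  by apply/seteqP; split => z; rewrite /= in_itv/=; case: i; case: j.
by rewrite -[X in measurable X]setTI; apply: (@normr_measurable R setT).
Qed.

Lemma measurable_jump_increment (phi : R -> R) (x : R) : continuous phi ->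
  measurable_fun setT (fun z : TR => phi (x + eta x z) - phi x).
Proof.
move=> cphi; apply: measurable_funB => //.
apply: (measurableT_comp (continuous_measurable_fun cphi)).
by apply: measurable_funD => //; exact: measurable_eta.
Qed.

(** Since c <= x, no jump in the annulus is censored and the drift has mean zero under [mu_star];
    only terms of order c^(2 - alpha) remain. *)
Lemma inner_increment (phi : R -> R) (x delta : R) : C2 phi -> 0 < x ->
  0 < delta ->
  exists2 C, 0 <= C & forall b c, 0 < b -> b < c -> c <= x -> c <= delta ->
    c <= 1 ->
    `|\int[mu]_(z in [set z : TR | (b < `|z|) && (`|z| <= c)])
        (phi (x + eta x z) - phi x)| <= C * c `^ (2 - alpha).
Proof.
move=> Cphi x0 d0.
have [C C0 [C1 CT]] := C2_bounds (x - delta) (x + delta) Cphi.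
have lc0 : 0 <= levy_cst alpha ms by exact: levy_cst_ge0.
exists ((C + C) * 1 ^+ 2 * levy_cst alpha ms).
  by rewrite expr1n mulr1 mulr_ge0// addr_ge0.
move=> b c b0 bc cx cd c1; set S := [set _ | _].
have mS : measurable S by exact: (measurable_annulus false true).
have Sbc z : S z -> b <= `|z| <= c by move=> /andP[/ltW -> ->].
have SN z : S z -> S (- z) by rewrite /S/= normrN.
pose G (z : TR) := phi (x + eta x z) - phi x.
have mG : measurable_fun setT G.
  by apply: measurable_jump_increment; exact: C2_continuous.
have Seta z : S z -> `|eta x z| <= delta.
  move=> /andP[_ zc]; apply: le_trans (normr_eta _ _) _.
  exact: le_trans zc cd.
have xx : x - delta <= x <= x + delta.
  by rewrite lerBlDr !lerDl ltW.
have xeta z : S z -> x - delta <= x + eta x z <= x + delta.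
  by move=> /Seta; rewrite ler_norml !lerD2l.
have GT z : S z -> `|G z - derive1 phi x * eta x z| <= C * eta x z ^+ 2.
  by move=> Sz; have := CT _ _ xx (xeta _ Sz); rewrite [x + _ - x]addrAC subrr add0r.
have eta2 z : eta x z ^+ 2 <= z ^+ 2.
  by rewrite /eta; case: ifP => // _; rewrite expr0n sqr_ge0.
have GM z : S z -> `|G z| <= C * delta + C * delta ^+ 2.
  move=> Sz; rewrite -(subrK (derive1 phi x * eta x z) (G z)) addrC.
  apply: le_trans (ler_normD _ _) _; apply: lerD.
    by rewrite normrM ler_pM// ?C1 ?Seta.
  apply: le_trans (GT _ Sz) _; rewrite ler_wpM2l//.
  rewrite -real_normK ?num_real// ler_pXn2r ?nnegrE ?Seta//.
  exact: ltW.
have cE : \int[mstar]_(z in S) eta x z = 0.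
  apply: (@mean_jump_eq0 _ _ alpha_gt1 b c 1 (fun z => z)) => //.
    by move=> z _; rewrite mul1r lexx.
  by rewrite mul1r.
(* A one-sided bound, used below for G with the slope of phi and for -G with the opposite slope. *)
have bnd p (H : TR -> R) : measurable_fun setT H ->
    `|p| <= C ->
    (forall z, S z -> `|H z| <= C * delta + C * delta ^+ 2) ->
    (forall z, S z -> H z <= p * eta x z + C * z ^+ 2) ->
    \int[mu]_(z in S) H z <= (C + C) * 1 ^+ 2 * levy_cst alpha ms * c `^ (2 - alpha).
  move=> mH pC HM Hle.
  have zP z : b <= z -> z <= z <= 1 * z by rewrite mul1r lexx.
  have mid : measurable_fun setT (fun z : TR => z) by exact: measurable_id.
  have mHS : measurable_fun S H by exact: measurable_funTS.
  have := @Rintegral_jump_le _ _ alpha_gt1 alpha_lt2 mu ms ms_fin muE b c 1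
    (fun z => z) S b0 bc c1 (lexx _) mid (fun=> erefl) zP mS Sbc x p C _ H
    (ltW x0) C0 mHS HM Hle.
  rewrite cE mulr0 add0r => HH; apply: le_trans HH _.
  by rewrite !ler_wpM2r ?powR_ge0 ?sqr_ge0// lerD2r.
rewrite ler_norml; apply/andP; split.
  rewrite lerNl -mulN1r -RintegralZl//; last first.
    apply: (@mu_integrable _ _ alpha_gt1 mu ms ms_fin muE b _ _ _ b0 mS _ _ GM).
      by move=> z /Sbc/andP[].
    exact: measurable_funTS.
  apply: (bnd (- derive1 phi x)).
  - by apply: measurable_funM.
  - by rewrite normrN C1.
  - by move=> z /GM; rewrite mulN1r normrN.
  - move=> z Sz; rewrite mulN1r mulNr -/(G z).
    have := GT _ Sz; rewrite ler_norml => /andP[+ _].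
    have := eta2 z; move: (eta x z ^+ 2) => e e1 h.
    have : C * e <= C * z ^+ 2 by rewrite ler_wpM2l.
    by lra.
apply: (bnd (derive1 phi x)) => //; first exact: C1.
move=> z Sz; rewrite -/(G z); have := GT _ Sz; rewrite ler_norml => /andP[_].
have : C * eta x z ^+ 2 <= C * z ^+ 2 by rewrite ler_wpM2l.
by lra.
Qed.

(** [I_inner] is written with [lim], which means something only once the limit is known to exist.
    The Cauchy criterion holds because two truncations differ by the integral over an annulus. *)
Lemma inner_cvg (phi : R -> R) (x delta : R) : C2 phi -> 0 < x -> 0 < delta ->
  cvg ((\int[mu]_(z in [set z : R | b < `|z| < delta])
          (phi (x + eta x z) - phi x)) @[b --> 0^'+]).
Proof.
move=> Cphi x0 d0; have [C C0 HC] := inner_increment Cphi x0 d0.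
apply: cauchy_cvg; apply: cauchy_exP => e e0.
have a2 : 0 < 2 - alpha by rewrite subr_gt0.
have [b0 [b00 [b0x b0d b01] Hb0]] : exists b0, [/\ 0 < b0,
    [/\ b0 <= x, b0 < delta & b0 <= 1] & C * b0 `^ (2 - alpha) < e].
  have : C * b `^ (2 - alpha) @[b --> 0^'+] --> 0.
    rewrite -[X in _ --> X](mulr0 C).
    by apply: cvgM; [exact: cvg_cst|exact: powR_cvg0].
  move=> /cvgr0_norm_lt/(_ e e0) H.
  near (0 : R)^'+ => b0.
  exists b0; split; [near: b0; exact: nbhs_right_gt| split |].
  - by near: b0; exact: nbhs_right_le.
  - by near: b0; exact: nbhs_right_lt.
  - by near: b0; exact: nbhs_right_le.
  - by apply: le_lt_trans (ler_norm _) _; near: b0.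
pose F b := \int[mu]_(z in [set z : R | b < `|z| < delta])
          (phi (x + eta x z) - phi x).
suff H : \forall b \near (0 : R)^'+, `|F b0 - F b| < e by exists (F b0).
near=> b; rewrite /F.
have bb0 : b < b0 by near: b; exact: nbhs_right_lt.
have bgt : 0 < b by near: b; exact: nbhs_right_gt.
have [M _ MP] := continuous_bounded_itv (x - delta) (x + delta) (C2_continuous Cphi).
have -> : [set z : R | b < `|z| < delta] =
    [set z : TR | (b < `|z|) && (`|z| <= b0)] `|` [set z : TR | b0 < `|z| < delta].
  apply/seteqP; split => z /=.
    by move=> /andP[-> ->]; rewrite andbT/=; have [|] := leP `|z| b0; [left|right].
  move=> [/andP[-> zb]|/andP[zb ->]]; first by rewrite (le_lt_trans zb).
  by rewrite (lt_trans bb0 zb).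
have m1 := measurable_annulus false true b b0.
have m2 := measurable_annulus false false b0 delta.
rewrite Rintegral_setU//.
- rewrite opprD addrCA subrr addr0 normrN.
  by apply: le_lt_trans (HC _ _ _ _ _ _ _) Hb0 => //; exact: ltW.
- apply: (@mu_integrable _ _ alpha_gt1 mu ms ms_fin muE b _ _ (M + M)) => //.
  + exact: measurableU.
  + move=> z /= [/andP[/ltW]|/andP[bz _]]//.
    by rewrite /far/= (le_trans (ltW bb0) (ltW bz)).
  + by apply: measurable_funTS; apply: measurable_jump_increment; exact: C2_continuous.
  + move=> z zS; apply: le_trans (ler_normB _ _) _.
    have zd : `|eta x z| <= delta.
      apply: le_trans (normr_eta _ _) _.
      case: zS => /= /andP[_]; last exact: ltW.
      by move=> /le_trans; apply; exact: ltW.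
    apply: lerD; apply: MP; last by rewrite lerBlDr !lerDl ltW.
    by move: zd; rewrite ler_norml !lerD2l.
- apply/disj_setPS => z [] /= /andP[_ zb0] /andP[b0z _].
  by move: b0z; rewrite ltNge zb0.
Unshelve. all: by end_near. Qed.

End inner_limit.

(** * The doubling estimate *)

Section powR_concavity.
Context (R : realType) (b : R).
Hypotheses (b0 : 0 < b) (b1 : b < 1).

(** Young's inequality for x^b and 1 with exponents 1/b and 1/(1 - b). *)
Lemma powR_le_affine (x : R) : 0 <= x -> x `^ b <= 1 + b * (x - 1).
Proof.
move=> x0; have nb0 : b != 0 by rewrite gt_eqF.
have c0 : 0 < 1 - b by rewrite subr_gt0.
have := @conjugate_powR R (x `^ b) 1 b^-1 (1 - b)^-1 (powR_ge0 _ _) ler01.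
rewrite !invrK !invr_gt0 b0 c0 mulr1 powR1 -powRrM divff// powRr1//.
rewrite (_ : b + (1 - b) = 1); last by ring.
move=> /(_ isT isT erefl) H; apply: le_trans H _.
by rewrite mul1r mulrC; lra.
Qed.

Lemma powR_le_tangent (x d : R) : 0 <= x -> 0 < d ->
  x `^ b - d `^ b <= b * d `^ (b - 1) * (x - d).
Proof.
move=> x0 d0.
have d0' : d != 0 by rewrite gt_eqF.
have xd : 0 <= x / d by rewrite divr_ge0// ltW.
have -> : x `^ b = d `^ b * (x / d) `^ b.
  by rewrite -powRM ?(ltW d0)// mulrC divfK.
have -> : d `^ (b - 1) = d `^ b / d.
  by rewrite powRB ?d0' ?implybT// powRr1// ltW.
have := ler_wpM2l (powR_ge0 d b) (powR_le_affine xd).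
rewrite mulrDr mulr1 => H.
have -> : b * (d `^ b / d) * (x - d) = d `^ b * (b * (x / d - 1)).
  by field.
by rewrite lerBlDr addrC.
Qed.

Lemma powR_le_second_order (t : R) : 0 <= t -> t <= 1 ->
  (1 - t) `^ b <= 1 - b * t - b * (1 - b) / 2 * t ^+ 2.
Proof.
(* The case t = 1 is separate because the derivative used below exists only for s < 1; there the
   claim reads 0 <= (1 - b) (1 - b/2). *)
move=> t0; rewrite le_eqVlt => /predU1P[->|t1].
  rewrite subrr powR0 ?gt_eqF// expr1n mulr1 mulr1.
  have : 0 <= (1 - b) * (1 - b / 2).
    by rewrite mulr_ge0// subr_ge0 ?(ltW b1)//; have := b1; lra.
  by lra.
have [->|tn0] := eqVneq t 0; first by rewrite expr0n/= !mulr0 !subr0 powR1.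
have tp : 0 < t by rewrite lt0r tn0.
pose g s := (1 - s) `^ b + b * s + b * (1 - b) / 2 * s ^+ 2.
pose dg s := - (b * (1 - s) `^ (b - 1)) + b + b * (1 - b) * s.
have dG (s : R) : s < 1 -> is_derive s 1 g (dg s).
  move=> s1; have s10 : 0 < 1 - s by rewrite subr_gt0.
  rewrite /g /dg.
  have h1 : is_derive s 1 (fun s : R => (1 - s) `^ b) (- (b * (1 - s) `^ (b - 1))).
    have d1 : is_derive s 1 (fun s : R => 1 - s) (- 1).
      by apply: (is_derive_eq (is_deriveB (is_derive_cst (1 : R) s 1)
        (is_derive_id s 1))); rewrite sub0r.
    apply: (is_derive_eq (@is_derive1_comp R (fun y => y `^ b)
      (fun s => 1 - s) s _ _ (is_derive1_powR b s10) d1)).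
    by rewrite mulrN1.
  have h2 := is_deriveZ b (is_derive_id s (1 : R)).
  have h3 := is_deriveZ (b * (1 - b) / 2) (is_deriveX 2 (is_derive_id s (1 : R))).
  apply: (is_derive_eq (is_deriveD (is_deriveD h1 h2) h3)).
  by rewrite /GRing.scale/= expr1; field.
have cg : {within `[0, t], continuous g}.
  apply: derivable_within_continuous => s; rewrite in_itv/= => /andP[_ st].
  by have [] := dG s (le_lt_trans st t1).
have dg' s : s \in `]0, t[ -> is_derive s 1 g (dg s).
  by rewrite in_itv/= => /andP[_ st]; apply: dG; exact: lt_trans st t1.
have [s] := MVT_segment (ltW tp) dg' cg.
rewrite in_itv/= => /andP[s0 st]; rewrite /g !mulr0 expr0n/= mulr0 !addr0 !subr0 powR1.
have s1 : s < 1 by exact: le_lt_trans t1.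
have s10 : 0 < 1 - s by rewrite subr_gt0.
suff : dg s * t <= 0 by move=> H e; move: H; rewrite -e; lra.
rewrite pmulr_lle0// /dg.
have B1 : 0 < (1 - s) `^ (1 - b) by exact: powR_gt0.
(* This is dg(s) <= 0 divided by b. The tangent bound at 1/(1 - s) gives (1 - s)^(1 - b) <= 1 - q
   with q = (1 - b) s, and (1 - q) (1 + q) <= 1 concludes. *)
suff : 1 + (1 - b) * s <= (1 - s) `^ (b - 1).
  by move=> /(ler_wpM2l (ltW b0)); rewrite mulrDr mulr1 mulrA; lra.
have -> : (1 - s) `^ (b - 1) = ((1 - s) `^ (1 - b))^-1 by rewrite -powRN opprB.
have B2 : (1 - s) `^ (1 - b) <= 1 - (1 - b) * s.
  have -> : (1 - s) `^ (1 - b) = (1 - s) / (1 - s) `^ b.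
    by rewrite powRB ?powRr1 ?(ltW s10)// (gt_eqF s10) implybT.
  have nz : (1 - s) `^ b != 0 by rewrite gt_eqF// powR_gt0.
  have B3 : (1 - s)^-1 `^ b <= 1 + b * ((1 - s)^-1 - 1).
    by apply: powR_le_affine; rewrite invr_ge0 ltW.
  rewrite -powRN; move: B3; rewrite -powR_inv1 ?(ltW s10)// -powRrM mulN1r => B3.
  have := ler_wpM2l (ltW s10) B3; rewrite powR_inv1 ?(ltW s10)//.
  move/le_trans; apply.
  have -> : (1 - s) * (1 + b * ((1 - s)^-1 - 1)) = 1 - s + b * (1 - (1 - s)).
    by field; rewrite gt_eqF.
  by lra.
rewrite -[leLHS]invrK lef_pV2 ?posrE ?invr_gt0//; last first.
  by rewrite ltr_wpDr// mulr_ge0// subr_ge0 ltW.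
apply: le_trans B2 _.
have q0 : 0 < 1 + (1 - b) * s by rewrite ltr_wpDr// mulr_ge0// subr_ge0 ltW.
rewrite -(ler_pM2r q0) mulVf ?gt_eqF//.
have : 0 <= ((1 - b) * s) ^+ 2 by exact: sqr_ge0.
by lra.
Qed.

(** After scaling by d, the increment to the right is bounded by its tangent alone; the whole
    second-order gain comes from the increment to the left. *)
Lemma powR_second_difference (d w : R) : 0 < d -> 0 <= w -> w <= d ->
  (d + w) `^ b + (d - w) `^ b - 2 * d `^ b <=
  - (b * (1 - b) / 2 * d `^ (b - 2) * w ^+ 2).
Proof.
move=> d0 w0 wd; have dn0 : d != 0 by rewrite gt_eqF.
pose t := w / d.
have t0 : 0 <= t by rewrite divr_ge0// ltW.
have t1 : t <= 1 by rewrite ler_pdivrMr// mul1r.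
have wE : w = d * t by rewrite /t mulrC divfK.
have -> : d + w = d * (1 + t) by rewrite mulrDr mulr1 -wE.
have -> : d - w = d * (1 - t) by rewrite mulrBr mulr1 -wE.
have -> : d `^ (b - 2) = d `^ b / d ^+ 2.
  by rewrite powRB ?dn0 ?implybT// powR_mulrn// ltW.
rewrite !powRM ?(ltW d0) ?subr_ge0 ?addr_ge0//.
have h1 : (1 + t) `^ b <= 1 + b * t.
  by have := powR_le_affine (addr_ge0 ler01 t0); rewrite (addrC 1 t) addrK addrC.
have h2 := powR_le_second_order t0 t1.
have := ler_wpM2l (powR_ge0 d b) (lerD h1 h2).
rewrite wE.
have -> : b * (1 - b) / 2 * (d `^ b / d ^+ 2) * (d * t) ^+ 2 =
  d `^ b * (b * (1 - b) / 2 * t ^+ 2) by field.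
by rewrite !mulrDr; lra.
Qed.

End powR_concavity.

(** * Common jumps at an approximate maximum; [G] stands for the half-line or the grid *)

Section coupling.
Context (R : realType) (b L k B d y : R) (u : R -> R) (G : set R).
Hypotheses (b0 : 0 < b) (b1 : b < 1) (L0 : 0 <= L) (k0 : 0 <= k).
Hypotheses (d0 : 0 < d) (y0 : 0 <= y).
Let x := y + d.
Hypotheses (Gx : G x) (Gy : G y).
Hypothesis near_max : forall x' y', G x' -> G y' ->
  u x' - u y' <= u x - u y + L * (`|x' - y'| `^ b - d `^ b) + k.
Variable w : R.
Hypotheses (Gxw : G (x + eta x w)) (Gyw : G (y + eta y w)).

Definition jump_difference : R :=
  (u (x + eta x w) - u x) - (u (y + eta y w) - u y).

(** As y < x, a jump censored at x is censored at y. If both points jump their distance is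
    unchanged, if neither does nothing happens; the second alternative is the jump censored at y
    only. *)
Lemma jump_difference_cases :
  jump_difference <= k \/
  [/\ - y - d <= w, w < - y,
      jump_difference <= k + L * (`|d + w| `^ b - d `^ b)
    & jump_difference = u (x + eta x w) - u x].
Proof.
rewrite /jump_difference.
have [yw|yw] := leP 0 (y + w).
  left; have xw : 0 <= x + w by rewrite /x addrAC addr_ge0// ltW.
  have := near_max Gxw Gyw; rewrite /eta yw xw.
  rewrite (_ : x + w - (y + w) = d); last by rewrite /x; ring.
  by rewrite (gtr0_norm d0) subrr mulr0; lra.
have ye : eta y w = 0 by rewrite /eta leNgt yw.
have [xw|xw] := leP 0 (x + w); last first.
  have xe : eta x w = 0 by rewrite /eta leNgt xw.
  by left; rewrite ye xe !addr0 !subrr.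
right; have xe : eta x w = w by rewrite /eta xw.
move: Gxw; rewrite ye xe addr0 subrr => Gxw'.
have := near_max Gxw' Gy.
rewrite (_ : x + w - y = d + w); last by rewrite /x; ring.
by move: xw; rewrite /x => xw H; split; lra.
Qed.

(** The pair (x, y) is compared with (x + w, y) and with (x, y + w), whence the error 2 k. The
    condition w <= d keeps y + w to the left of x. *)
Lemma jump_difference_gain : 0 <= w -> w <= d ->
  jump_difference <= 2 * k - L * (b * (1 - b) / 2 * d `^ (b - 2)) * w ^+ 2.
Proof.
move=> w0 wd; rewrite /jump_difference.
have xw : 0 <= x + w by rewrite /x addr_ge0// addr_ge0// ltW.
have yw : 0 <= y + w by rewrite addr_ge0.
have N1 := near_max Gxw Gy; have N2 := near_max Gx Gyw.
move: N1 N2; rewrite /eta yw xw.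
rewrite (_ : x + w - y = d + w); last by rewrite /x; ring.
rewrite (_ : x - (y + w) = d - w); last by rewrite /x; ring.
rewrite [`|d + w|]ger0_norm ?addr_ge0 ?(ltW d0)//.
rewrite [`|d - w|]ger0_norm ?subr_ge0//.
have := ler_wpM2l L0 (powR_second_difference b0 b1 d0 w0 wd).
by rewrite -mulrA; lra.
Qed.

(** When only x jumps, d + w lies in [-y, d - y), so the new distance is at most max(d, y). It does
    not increase if y <= d; otherwise the tangent of the power at d bounds the loss. *)
Lemma jump_difference_mu_star :
  jump_difference <= k + (if (- y - d <= w < - y) && (d < y)
    then L * (b * d `^ (b - 1) * (y - d)) else 0).
Proof.
have [H|[w1 w2 H _]] := jump_difference_cases.
  apply: le_trans H _; rewrite lerDl; case: ifP => // /andP[_ dy].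
  by rewrite !mulr_ge0 ?powR_ge0 ?(ltW b0)// subr_ge0 ltW.
rewrite w1 w2/=; apply: le_trans H _; rewrite lerD2l.
have dwy : `|d + w| <= Num.max d y.
  have h0 := y0; rewrite ler_norml; apply/andP; split.
    by rewrite lerNl le_max; apply/orP; right; lra.
  by rewrite le_max; apply/orP; left; lra.
have Pdw : `|d + w| `^ b <= Num.max d y `^ b.
  by apply: ge0_ler_powR; rewrite ?nnegrE ?(ltW b0)// le_max y0 orbT.
case: ltP => [dy|yd].
  rewrite ler_wpM2l//; apply: le_trans (powR_le_tangent b0 b1 y0 d0).
  by rewrite lerD2r; move: Pdw; rewrite (max_idPr (ltW dy)).
move: Pdw; rewrite (max_idPl yd) => Pdw.
by rewrite mulr_ge0_le0// subr_le0.
Qed.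

(** Consider a jump made by x only. If -w <= 2 d the distance does not increase. Otherwise |z| >= d
    and |d + w| <= |w| <= 2 |z|: for |z| <= 1 the loss is at most L (2 |z|)^b <= 2 L |z|^(alpha -
    1), and for |z| > 1 the bound on u gives 2 B. *)
Lemma jump_difference_mu_sharp (alpha z : R) : 1 < alpha -> alpha - 1 <= b ->
  (forall t, G t -> `|u t| <= B) ->
  (`|z| < d -> `|w| <= d) -> (d <= `|z| -> `|w| <= 2 * `|z|) ->
  jump_difference <= k + (2 * L + 2 * B) * tau alpha z.
Proof.
move=> a1 ab uB wd wz.
have B0 : 0 <= B by apply: le_trans (uB _ Gy).
have c0 : 0 <= 2 * L + 2 * B by rewrite addr_ge0// mulr_ge0.
have t0 : 0 <= (2 * L + 2 * B) * tau alpha z by rewrite mulr_ge0// tau_ge0.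
have [H|[w1 w2 H1 H2]] := jump_difference_cases.
  by apply: le_trans H _; rewrite lerDl.
have wn : w < 0 by apply: lt_le_trans w2 _; rewrite oppr_le0.
have [wd2|wd2] := leP (- w) (2 * d).
  apply: le_trans H1 _; rewrite lerD2l; apply: le_trans t0.
  rewrite mulr_ge0_le0// subr_le0; apply: ge0_ler_powR; rewrite ?nnegrE ?(ltW b0) ?(ltW d0)//.
  by have h0 := d0; rewrite ler_norml; apply/andP; split; lra.
have dz : d <= `|z|.
  rewrite leNgt; apply/negP => /wd; rewrite ltr0_norm// => h.
  by have := d0; lra.
have [z1|z1] := leP `|z| 1.
  apply: le_trans H1 _; rewrite lerD2l.
  have -> : tau alpha z = `|z| `^ (alpha - 1).
    have e1 : 1 `^ (alpha - 1) = 1 :> R by rewrite powR1.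
    rewrite /tau; apply/min_idPr; rewrite -[leRHS]e1.
    by apply: ge0_ler_powR; rewrite ?nnegrE ?subr_ge0 ?(ltW a1).
  apply: (@le_trans _ _ (L * (2 * `|z| `^ (alpha - 1)))); last first.
    by rewrite mulrA ler_wpM2r ?powR_ge0// mulrC lerDl mulr_ge0.
  rewrite ler_wpM2l// lerBlDr.
  apply: (@le_trans _ _ (2 * `|z| `^ (alpha - 1))); last by rewrite lerDl powR_ge0.
  have zp : 0 < `|z| by exact: lt_le_trans dz.
  apply: (@le_trans _ _ ((2 * `|z|) `^ b)).
    apply: ge0_ler_powR; rewrite ?nnegrE ?(ltW b0) ?mulr_ge0//.
    have := wz dz; rewrite ltr0_norm// => h.
    have h0 := d0; rewrite ler_norml; apply/andP; split; lra.
  rewrite powRM//; apply: ler_pM; rewrite ?powR_ge0//.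
    by apply: ler1_powR; rewrite ?ler1n// ltW.
  by apply: ger_powR; rewrite // zp.
have -> : tau alpha z = 1.
  rewrite /tau; apply/min_idPl; rewrite -[leLHS](powRr0 `|z|).
  by apply: ler_powR; rewrite ?subr_ge0 ltW.
have := uB _ Gxw; have := uB _ Gx; rewrite H2 !ler_norml mulr1.
move=> /andP[h1 h2] /andP[h3 h4].
by have := L0; have := k0; lra.
Qed.

End coupling.

(** * Integrating the coupled jumps *)

Section coupled_integral.
Context (R : realType) (alpha : R).
Hypotheses (alpha_gt1 : 1 < alpha) (alpha_lt2 : alpha < 2).
Notation TR := (measurableTypeR R).
Variables mu ms : {measure set (measurableTypeR R) -> \bar R}.
Hypothesis ms_fin : (\int[ms]_(z in [set~ 0%R])
  (Num.min 1 (`|z| `^ (alpha - 1)))%:E < +oo)%E.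
Hypothesis muE : forall A : set TR, measurable A ->
  (mu A = mu_star alpha A + ms A)%E.
Notation mstar := (@mu_star R alpha).

Lemma Rintegral_sqr_mu_star_itvo (a c : R) : 0 < a -> a < c ->
  \int[mstar]_(z in `[a, c[) z ^+ 2 =
   (c `^ (2 - alpha) - a `^ (2 - alpha)) / (2 - alpha).
Proof.
move=> a0 ac; rewrite /Rintegral.
have e0 z : (0 <= (z ^+ 2 : R)%:E)%E by rewrite lee_fin sqr_ge0.
rewrite -[RHS]/(fine (_%:E)) -(integral_sqr_mu_star_itv alpha_lt2 a0 ac); congr fine.
have md (D : set TR) : measurable_fun D (fun z : TR =>
    ((z ^+ 2 : R)%:E * (mu_star_density alpha z)%:E)%E).
  apply: emeasurable_funM; first exact: measurable_sqr_EFin.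
  by apply/measurable_EFinP; apply: measurable_funTS; exact: measurable_mu_star_density.
rewrite ge0_integral_mu_star//; last exact: measurable_sqr_EFin.
rewrite ge0_integral_mu_star//; last exact: measurable_sqr_EFin.
by apply: (@integral_itv_bndo_bndc R (BLeft a) c); exact: md.
Qed.

(** One pointwise bound is integrated against each part of [mu]: the window weight W and the gain g
    against [mu_star], the multiple Q of [tau] against [ms]. The requirement d < y when W is nonzero
    keeps the window inside [far r], where its mass is at most d times the density at y. *)
Lemma Rintegral_coupled_le (r d y k Q W g M : R) (D : TR -> R) :
  0 < r -> r < d -> 0 <= W -> 0 <= Q -> (W != 0 -> d < y) ->
  measurable_fun setT D -> (forall z, far r z -> `|D z| <= M) ->
  (forall z, far r z -> D z <= 2 * k +
     ((if - y - d <= z <= - y then W else 0) -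
      (if r <= z < d then g * z ^+ 2 else 0))) ->
  (forall z, far r z -> D z <= 2 * k + Q * tau alpha z) ->
  \int[mu]_(z in far r) D z <= 2 * k * fine (mu (far r)) + Q * Csharp alpha ms
    + W * (d * y `^ (- (1 + alpha)))
    - g * ((d `^ (2 - alpha) - r `^ (2 - alpha)) / (2 - alpha)).
Proof.
move=> r0 rd W0 Q0 Wy mD DM D1 D2.
have d0 : 0 < d by exact: lt_trans rd.
have mF := @measurable_far R r.
have mDS : measurable_fun (far r) D by exact: measurable_funTS.
have FF : far r `<=` far r by [].
have muF := mu_star_far_fin alpha_gt1 r0.
have msF := ms_far_fin alpha_gt1 ms_fin r0.
rewrite (Rintegral_muE alpha_gt1 ms_fin muE r0 mF FF mDS DM).
have -> : fine (mu (far r)) = fine (mstar (far r)) + fine (ms (far r)).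
  by rewrite muE// fineD// ge0_fin_numE.
have is_ := @mu_star_integrable _ _ alpha_gt1 r (far r).
have im := @ms_integrable _ alpha alpha_gt1 ms ms_fin r (far r).
have H2 : \int[ms]_(z in far r) D z <= 2 * k * fine (ms (far r)) + Q * Csharp alpha ms.
  have it : ms.-integrable (far r) (EFin \o tau alpha).
    apply: (im _ 1) => //; first exact: measurable_tau.
    by move=> z _; rewrite ger0_norm ?tau_ge0// tau_le1.
  have iQ : ms.-integrable (far r) (EFin \o (fun z => Q * tau alpha z)).
    rewrite (_ : _ \o _ = (fun z => Q%:E * (tau alpha z)%:E)%E)//.
    exact: integrableZl.
  have ic : ms.-integrable (far r) (EFin \o (fun=> 2 * k)).
    by apply: (im _ `|2 * k|).
  apply: (@le_trans _ _ (\int[ms]_(z in far r) (2 * k + Q * tau alpha z))).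
    apply: le_Rintegral => //; first exact: (im _ M).
    exact: (integrableD mF ic iQ).
  rewrite RintegralD// Rintegral_cst// lerD2l RintegralZl// ler_wpM2l//.
  rewrite -lee_fin /Rintegral fineK; last exact: integrable_fin_num.
  exact: integral_tau_le r0 mF FF.
have H1 : \int[mstar]_(z in far r) D z <= 2 * k * fine (mstar (far r)) +
    (W * (d * y `^ (- (1 + alpha))) -
     g * ((d `^ (2 - alpha) - r `^ (2 - alpha)) / (2 - alpha))).
  pose A : set TR := `[- y - d, - y]%classic.
  pose E : set TR := `[r, d[%classic.
  have mA : measurable A by exact: measurable_itv.
  have mE : measurable E by exact: measurable_itv.
  pose hA z := if z \in A then W else 0.
  pose hE (z : TR) := if z \in E then g * z ^+ 2 else 0.
  have mhA : measurable_fun setT hA.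
    rewrite (_ : hA = (fun z => W * \1_A z)).
      by apply: measurable_funM => //; exact: measurable_indic.
    by apply/funext => z; rewrite /hA indicE; case: (_ \in _); rewrite ?mulr1 ?mulr0.
  have mhE : measurable_fun setT hE.
    rewrite (_ : hE = (fun z : TR => (g * z ^+ 2) * \1_E z)).
      apply: measurable_funM; last exact: measurable_indic.
      by apply: measurable_funM => //; exact: measurable_funX.
    by apply/funext => z; rewrite /hE indicE; case: (_ \in _); rewrite ?mulr1 ?mulr0.
  have ihA : mstar.-integrable (far r) (EFin \o hA).
    apply: (is_ _ W) => //; first exact: measurable_funTS.
    by move=> z _; rewrite /hA; case: (_ \in _); rewrite ?normr0// ger0_norm.
  have ihE : mstar.-integrable (far r) (EFin \o hE).
    apply: (is_ _ (`|g| * d ^+ 2)) => //; first exact: measurable_funTS.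
    move=> z _; rewrite /hE; case: ifPn; last first.
      by rewrite normr0 mulr_ge0// sqr_ge0.
    rewrite inE /E/= in_itv/= => /andP[rz zd]; rewrite normrM ler_wpM2l//.
    have z0 : 0 <= z by rewrite (le_trans (ltW r0)).
    by rewrite ger0_norm ?sqr_ge0// ler_pXn2r ?nnegrE ?(ltW d0) ?(ltW zd).
  have ic : mstar.-integrable (far r) (EFin \o (fun=> 2 * k)).
    by apply: (is_ _ `|2 * k|).
  have iB := integrableB mF ihA ihE.
  apply: (@le_trans _ _ (\int[mstar]_(z in far r) (2 * k + (hA z - hE z)))).
    apply: le_Rintegral => //; first exact: (is_ _ M).
      exact: (integrableD mF ic iB).
    by move=> z /D1; rewrite /hA /hE !mem_setE !in_itv/=.
  rewrite RintegralD// Rintegral_cst// lerD2l RintegralB//; apply: lerB.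
    have [W00|Wn0] := eqVneq W 0.
      rewrite /hA W00 mul0r (_ : (fun=> _) = (fun=> 0)) ?Rintegral_cst ?mul0r//.
      by apply/funext => z; case: ifP.
    have dy := Wy Wn0.
    have Ar : A `<=` far r.
      move=> z; rewrite /A/= in_itv/= => /andP[_ zy].
      rewrite /far/= -normrN (le_trans _ (ler_norm _))//.
      by rewrite lerNr in zy; apply: le_trans zy; rewrite ltW// (lt_trans rd).
    have hAE : \int[mstar]_(z in far r) hA z = W * \int[mstar]_(z in far r) \1_A z.
      rewrite -RintegralZl//.
        by apply: eq_Rintegral => z _; rewrite /hA indicE; case: (_ \in _); rewrite ?mulr1 ?mulr0.
      apply: (is_ _ 1) => //.
      by move=> z _; rewrite indicE; case: (_ \in _); rewrite ?normr1 ?normr0.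
    rewrite hAE ler_wpM2l// /Rintegral integral_indic// setIidl//.
    have y0 : 0 < y by exact: lt_trans dy.
    have AE : A = `[- (y + d), - y]%classic by rewrite /A opprD.
    have := mu_star_itv_le alpha_gt1 y0 (_ : y <= y + d).
    rewrite lerDl (ltW d0) -(mu_star_opp_itv alpha) -AE => /(_ isT) h.
    rewrite -lee_fin fineK; last by rewrite ge0_fin_numE// (le_lt_trans h) ?ltry.
    by rewrite (_ : d = y + d - y)//; ring.
  rewrite -(Rintegral_sqr_mu_star_itvo r0 rd) -RintegralZl//; last first.
    apply: (@mu_star_integrable _ _ alpha_gt1 r _ _ (d ^+ 2)) => //.
    - by move=> z; rewrite /far/= in_itv/= => /andP[/le_trans + _]; apply; exact: ler_norm.
    - move=> z /=; rewrite in_itv/= => /andP[rz zd].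
      have z0 : 0 <= z by rewrite (le_trans (ltW r0)).
      by rewrite ger0_norm ?sqr_ge0// ler_pXn2r ?nnegrE ?(ltW d0) ?(ltW zd).
  have -> : `[r, d[%classic = far r `&` E.
    apply/seteqP; split => z; rewrite /E/= in_itv/=; last by case.
    by move=> /andP[rz zd]; rewrite rz zd; split => //; apply: le_trans rz (ler_norm _).
  by rewrite Rintegral_mkcondr le_eqVlt; apply/orP; left; apply/eqP; apply: eq_Rintegral => z _.
by apply: le_trans (lerD H1 H2) _; lra.
Qed.

End coupled_integral.

(** In 1 - b = 7/8 (2 - alpha), any factor strictly between 2/3 and 1 could replace 7/8: a factor c
    < 1 gives b > alpha - 1, and c > 2/3 makes the truncated gain 3 c / 8 larger than the window
    loss 1/4. *)
Definition holder_exponent (R : realType) (alpha : R) : R := (7 * alpha - 6) / 8.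

Section holder_exponent.
Context (R : realType) (alpha : R).
Hypotheses (alpha_gt1 : 1 < alpha) (alpha_lt2 : alpha < 2).
Notation b := (holder_exponent alpha).

Lemma holder_exponent_gt : alpha - 1 < b.
Proof. by have := alpha_lt2; rewrite /holder_exponent; lra. Qed.

Lemma holder_exponent_lt1 : b < 1.
Proof. by have := alpha_lt2; rewrite /holder_exponent; lra. Qed.

Lemma holder_exponentE : 1 - b = 7 / 8 * (2 - alpha).
Proof. by rewrite /holder_exponent; field. Qed.

End holder_exponent.

Section coupling_estimate.
Context (R : realType) (alpha : R).
Hypotheses (alpha_gt1 : 1 < alpha) (alpha_lt2 : alpha < 2).
Notation TR := (measurableTypeR R).
Variables mu ms : {measure set (measurableTypeR R) -> \bar R}.
Hypothesis ms_fin : (\int[ms]_(z in [set~ 0%R])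
  (Num.min 1 (`|z| `^ (alpha - 1)))%:E < +oo)%E.
Hypothesis muE : forall A : set TR, measurable A ->
  (mu A = mu_star alpha A + ms A)%E.
Notation mstar := (@mu_star R alpha).

Variable b : R.
Hypothesis holder_exponentE : 1 - b = 7 / 8 * (2 - alpha).

Let ab : alpha - 1 < b.
Proof. by have := alpha_lt2; have := holder_exponentE; lra. Qed.

Let b0 : 0 < b. Proof. by apply: lt_trans ab; rewrite subr_gt0. Qed.

Let b1 : b < 1.
Proof. by have := alpha_lt2; have := holder_exponentE; lra. Qed.

Variables (L k B d y r : R) (u : R -> R) (G : set R) (zeta : TR -> R).
Let x := y + d.
Hypotheses (L0 : 0 <= L) (k0 : 0 <= k) (d0 : 0 < d) (y0 : 0 <= y) (r0 : 0 < r).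
Hypothesis rd : r `^ (2 - alpha) <= d `^ (2 - alpha) / 4.
Hypotheses (Gx : G x) (Gy : G y) (uB : forall t, G t -> `|u t| <= B).
Hypothesis near_max : forall x' y', G x' -> G y' ->
  u x' - u y' <= u x - u y + L * (`|x' - y'| `^ b - d `^ b) + k.
Hypothesis Gjump : forall z, far r z ->
  G (x + eta x (zeta z)) /\ G (y + eta y (zeta z)).
Hypothesis zeta_ge : forall z, r <= z -> z <= zeta z.
Hypothesis zeta_le : forall z, far r z -> `|z| < d -> `|zeta z| <= d.
Hypothesis zeta_le2 : forall z, far r z -> d <= `|z| -> `|zeta z| <= 2 * `|z|.
Hypothesis zeta_window : forall z, far r z -> - y - d <= zeta z -> zeta z < - y ->
  - y - d <= z <= - y.
Hypothesis mux : measurable_fun setT (fun z : TR => u (x + eta x (zeta z))).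
Hypothesis muy : measurable_fun setT (fun z : TR => u (y + eta y (zeta z))).

(** The constant 1/4 comes from (y - d) d <= y^2 / 4; the remaining powers are compared by d^(alpha
    - 1) <= y^(alpha - 1). *)
Lemma window_weight_le : d < y ->
  d `^ (b - 1) * (y - d) * (d * y `^ (- (1 + alpha))) <= d `^ (b - alpha) / 4.
Proof.
move=> dy; have yp : 0 < y by exact: lt_trans dy.
have dn : d != 0 by rewrite gt_eqF.
have yn : y != 0 by rewrite gt_eqF.
have -> : d `^ (b - 1) = d `^ (b - alpha) * d `^ (alpha - 1).
  by rewrite -powRD ?dn ?implybT//; congr (_ `^ _); ring.
have -> : y `^ (- (1 + alpha)) = (y ^+ 2 * y `^ (alpha - 1))^-1.
  rewrite -powR_mulrn ?(ltW yp)// -powRD ?yn ?implybT// -powRN.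
  by congr (_ `^ _); ring.
rewrite -!mulrA ler_wpM2l ?powR_ge0//.
have Y0 : 0 < y `^ (alpha - 1) by exact: powR_gt0.
have DY : d `^ (alpha - 1) <= y `^ (alpha - 1).
  by apply: ge0_ler_powR; rewrite ?nnegrE ?subr_ge0 ?ltW.
have H : (y - d) * d <= y ^+ 2 / 4.
  have : 0 <= (y / 2 - d) ^+ 2 by exact: sqr_ge0.
  by lra.
rewrite !mulrA ler_pdivrMr ?mulr_gt0 ?exprn_gt0//.
rewrite -mulrA (mulrC (d `^ _)) [leRHS](_ : _ = y ^+ 2 / 4 * y `^ (alpha - 1)); last by field.
by apply: ler_pM => //; rewrite ?powR_ge0// mulr_ge0 ?ltW// subr_gt0.
Qed.

(** The hypothesis on r says that truncation costs at most a quarter of the second moment up to d.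
    The gain is thus 3/4 of 7/16, that is 21/64, against a window loss of 16/64, and 5/64 remains.
    Rounding is harmless because [zeta z] is at least z for z >= r and stays at most d when |z| < d,
    and because the window for [zeta z] pulls back into the window for z. *)
Lemma coupling_estimate :
  \int[mu]_(z in far r) (u (x + eta x (zeta z)) - u x) -
  \int[mu]_(z in far r) (u (y + eta y (zeta z)) - u y) <=
  2 * k * fine (mu (far r)) + (2 * L + 2 * B) * Csharp alpha ms
   - 5 / 64 * (L * b * d `^ (b - alpha)).
Proof.
have a20 : 0 < 2 - alpha by rewrite subr_gt0.
have r_lt_d : r < d.
  rewrite ltNge; apply/negP => dr.
  have : d `^ (2 - alpha) <= r `^ (2 - alpha).
    by apply: ge0_ler_powR; rewrite ?nnegrE ?(ltW a20) ?(ltW d0) ?(ltW r0).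
  have := powR_gt0 (2 - alpha) d0; have := rd; lra.
have B0 : 0 <= B by apply: le_trans (uB Gy).
have mF := @measurable_far R r.
pose D (z : TR) := jump_difference d y u (zeta z).
have mD : measurable_fun setT D.
  have m1 := measurable_funB mux (measurable_cst (u x)).
  have m2 := measurable_funB muy (measurable_cst (u y)).
  exact: (measurable_funB m1 m2).
have iu s : G s -> measurable_fun setT (fun z : TR => u (s + eta s (zeta z))) ->
    (forall z, far r z -> G (s + eta s (zeta z))) ->
    mu.-integrable (far r) (EFin \o (fun z : TR => u (s + eta s (zeta z)) - u s)).
  move=> Gs ms_ Gj.
  apply: (@mu_integrable _ _ alpha_gt1 mu ms ms_fin muE r _ _ (B + B)) => //.
    by apply: measurable_funTS; exact: measurable_funB.
  move=> z fz; apply: le_trans (ler_normB _ _) _.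
  by apply: lerD; apply: uB => //; exact: Gj.
have ix := iu _ Gx mux (fun z fz => (Gjump fz).1).
have iy := iu _ Gy muy (fun z fz => (Gjump fz).2).
rewrite -RintegralB//.
pose W := if d < y then L * (b * d `^ (b - 1) * (y - d)) else 0.
pose g := L * (b * (1 - b) / 2 * d `^ (b - 2)).
have W0 : 0 <= W.
  rewrite /W; case: ifP => // dy.
  by rewrite !mulr_ge0 ?powR_ge0 ?(ltW b0)// subr_ge0 ltW.
have Q0 : 0 <= 2 * L + 2 * B by rewrite addr_ge0// mulr_ge0.
have g0 : 0 <= g.
  by rewrite /g !mulr_ge0 ?powR_ge0 ?(ltW b0)// subr_ge0 ltW.
have Wy : W != 0 -> d < y by rewrite /W; case: ifP => //; rewrite eqxx.
have DM z : far r z -> `|D z| <= B + B + (B + B).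
  move=> fz; apply: le_trans (ler_normB _ _) _.
  by apply: lerD; apply: le_trans (ler_normB _ _) _; apply: lerD; apply: uB;
     rewrite // ?(Gjump fz).1 ?(Gjump fz).2//; case: (Gjump fz).
have D1 z : far r z -> D z <= 2 * k +
     ((if - y - d <= z <= - y then W else 0) -
      (if r <= z < d then g * z ^+ 2 else 0)).
  move=> fz; have [Gj1 Gj2] := Gjump fz.
  have [/andP[rz zd]|nrz] := boolP (r <= z < d).
    have z0 : 0 < z by exact: lt_le_trans rz.
    rewrite ifF; last by apply/negbTE; rewrite negb_and -!ltNge; apply/orP; right; apply: le_lt_trans z0; rewrite oppr_le0.
    have zz := zeta_ge rz.
    have zd' : zeta z <= d.
      by apply: le_trans (ler_norm _) _; apply: zeta_le => //; rewrite gtr0_norm.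
    have := jump_difference_gain b0 b1 L0 d0 y0 Gx Gy near_max Gj1 Gj2
       (le_trans (ltW z0) zz) zd'.
    rewrite -/(D z) -/g sub0r => h; apply: le_trans h _; rewrite lerD2l lerN2.
    by rewrite ler_wpM2l// ler_pXn2r ?nnegrE ?(ltW z0)// (le_trans (ltW z0)).
  rewrite subr0.
  have := jump_difference_mu_star b0 b1 L0 k0 d0 y0 Gy near_max Gj1 Gj2.
  rewrite -/(D z) => h; apply: le_trans h _.
  have k2 : k <= 2 * k by have := k0; lra.
  apply: lerD => //; case: ifPn => [/andP[/andP[w1 w2] dy]|_].
    by rewrite (zeta_window fz w1 w2) /W dy.
  by case: ifP.
have D2 z : far r z -> D z <= 2 * k + (2 * L + 2 * B) * tau alpha z.
  move=> fz; have [Gj1 Gj2] := Gjump fz.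
  have := jump_difference_mu_sharp b0 b1 L0 k0 d0 y0 Gx Gy near_max Gj1 Gj2
    alpha_gt1 (ltW ab) uB (zeta_le fz) (zeta_le2 fz).
  rewrite -/(D z) => h; apply: le_trans h _; rewrite lerD2r.
  by have := k0; lra.
have := Rintegral_coupled_le alpha_gt1 alpha_lt2 ms_fin muE r0 r_lt_d W0 Q0 Wy mD DM D1 D2.
move=> /le_trans; apply.
have gain : 21 / 64 * (L * b * d `^ (b - alpha)) <=
    g * ((d `^ (2 - alpha) - r `^ (2 - alpha)) / (2 - alpha)).
  have e1 : d `^ (b - alpha) = d `^ (b - 2) * d `^ (2 - alpha).
    have dn : d != 0 by rewrite gt_eqF.
    by rewrite -powRD ?dn ?implybT//; congr (_ `^ _); ring.
  rewrite /g holder_exponentE e1.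
  have -> : L * (b * (7 / 8 * (2 - alpha)) / 2 * d `^ (b - 2)) *
     ((d `^ (2 - alpha) - r `^ (2 - alpha)) / (2 - alpha)) =
     L * b * d `^ (b - 2) * (7 / 16 * (d `^ (2 - alpha) - r `^ (2 - alpha))).
    by field; rewrite gt_eqF.
  have -> : 21 / 64 * (L * b * (d `^ (b - 2) * d `^ (2 - alpha))) =
     L * b * d `^ (b - 2) * (21 / 64 * d `^ (2 - alpha)) by ring.
  rewrite ler_wpM2l ?mulr_ge0 ?powR_ge0 ?(ltW b0)//.
  by have := rd; lra.
have bad : W * (d * y `^ (- (1 + alpha))) <= 16 / 64 * (L * b * d `^ (b - alpha)).
  rewrite /W; case: ifP => [dy|_]; last first.
    by rewrite mul0r !mulr_ge0 ?powR_ge0 ?(ltW b0).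
  have := ler_wpM2l (mulr_ge0 L0 (ltW b0)) (window_weight_le dy).
  set q := d `^ (b - alpha); set v := y `^ _; set s := d `^ _.
  by lra.
by move: gain bad; set q := L * b * _; lra.
Qed.

End coupling_estimate.

(** * Choice of the Holder constant *)

Section constant_choice.
Context (R : realType).

(** As b < alpha, d^(b - alpha) is large for small d: for d <= d0 it dominates (c0 + c1 + 1) 64 / (5
    b). Then L is taken so large that L d^b <= 2 B forces d <= d0. With L >= 1 the left side is at
    most (c0 + c1) L, and the extra 1 makes the inequality strict. *)
Lemma choose_holder_constant (alpha b c0 c1 B : R) : 0 < b -> b < alpha ->
  0 <= c0 -> 0 <= c1 -> 0 <= B ->
  exists2 L : R, 0 < L & forall d, 0 < d -> L * d `^ b <= 2 * B ->
    d <= 1 /\ c0 + c1 * L < 5 / 64 * (L * b * d `^ (b - alpha)).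
Proof.
move=> b0 ba c00 c10 B0; set c := c0 + c1.
have cge0 : 0 <= c by rewrite addr_ge0.
have e0 : 0 < alpha - b by rewrite subr_gt0.
pose q := 5 * b / (64 * (c + 1)).
have c10' : 0 < c + 1 by rewrite ltr_wpDl.
have q0 : 0 < q by rewrite divr_gt0 ?mulr_gt0.
pose d0 := Num.min 1 (q `^ (alpha - b)^-1).
have d00 : 0 < d0 by rewrite lt_min ltr01 powR_gt0.
have D0 : 0 < d0 `^ b by exact: powR_gt0.
exists (Num.max 1 ((2 * B + 1) / d0 `^ b)); first by rewrite lt_max ltr01.
set L := Num.max _ _ => d dp Ld.
have L1 : 1 <= L by rewrite le_max lexx.
have L2 : (2 * B + 1) / d0 `^ b <= L by rewrite le_max lexx orbT.
have L0 : 0 < L by exact: lt_le_trans L1.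
have dd0 : d <= d0.
  rewrite leNgt; apply/negP => d0d.
  have h : d0 `^ b <= d `^ b.
    by apply: ge0_ler_powR; rewrite ?nnegrE ?(ltW b0) ?(ltW d00) ?(ltW dp) ?(ltW d0d).
  have h2 : 2 * B + 1 <= L * d `^ b.
    by rewrite -ler_pdivrMr ?(lt_le_trans D0)//; apply: le_trans L2; rewrite ler_wpM2l ?addr_ge0 ?mulr_ge0// lef_pV2 ?posrE// (lt_le_trans D0).
  by have := le_trans h2 Ld; lra.
split; first by rewrite (le_trans dd0)// ge_min lexx.
have h3 : (c + 1) <= 5 / 64 * b * d `^ (b - alpha).
  have dq : d `^ (alpha - b) <= q.
    have -> : q = (q `^ (alpha - b)^-1) `^ (alpha - b).
      by rewrite -powRrM mulVf ?gt_eqF// powRr1// ltW.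
    apply: ge0_ler_powR; rewrite ?nnegrE ?(ltW e0) ?(ltW dp) ?powR_ge0//.
    by rewrite (le_trans dd0)// ge_min lexx orbT.
  have -> : d `^ (b - alpha) = (d `^ (alpha - b))^-1 by rewrite -powRN opprB.
  have dp' : 0 < d `^ (alpha - b) by exact: powR_gt0.
  rewrite ler_pdivlMr//; apply: le_trans (ler_wpM2l (ltW c10') dq) _.
  by rewrite /q le_eqVlt; apply/orP; left; apply/eqP; field; rewrite gt_eqF.
have : c0 + c1 * L <= c * L.
  by rewrite /c mulrDl lerD2r ler_peMr.
move=> /le_lt_trans; apply.
have := ler_wpM2l (ltW L0) h3; set w := d `^ _; move=> h4.
by lra.
Qed.

End constant_choice.

(** * Affine plus quadratic test functions *)

Section quadratic_test_functions.
Context (R : realType).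
Variables p k c : R.

(** The slope p will be that of L d^b up to sign. A concave power lies below its tangent, so the
    tangent may replace it in a test; the test function is then a polynomial and is C2 on the whole
    line although the power is not. *)
Definition quadratic_test (t : R) : R := p * t + k * (t - c) ^+ 2.

Lemma is_derive_quadratic_test (t : R) :
  is_derive t 1 quadratic_test (p + 2 * k * (t - c)).
Proof.
have h1 := is_deriveZ p (is_derive_id t (1 : R)).
have h2 := is_deriveB (is_derive_id t (1 : R)) (is_derive_cst c t (1 : R)).
have h3 := is_deriveZ k (is_deriveX 2 h2).
apply: (is_derive_eq (is_deriveD h1 h3)).
by rewrite /GRing.scale/= expr1 -[(id - cst c) t]/(t - c); ring.
Qed.

Lemma derive1_quadratic_test :
  derive1 quadratic_test = fun t => p + 2 * k * (t - c).
Proof.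
apply/funext => t; rewrite derive1E.
exact: (@derive_val _ _ _ _ _ _ _ (is_derive_quadratic_test t)).
Qed.

Lemma C2_quadratic_test : C2 quadratic_test.
Proof.
have D2 (t : R) : is_derive t 1 (fun t : R => p + 2 * k * (t - c)) (2 * k).
  have h2 := is_deriveB (is_derive_id t (1 : R)) (is_derive_cst c t (1 : R)).
  apply: (is_derive_eq (is_deriveD (is_derive_cst p t (1 : R))
     (is_deriveZ (2 * k) h2))).
  by rewrite /GRing.scale/=; ring.
split.
- by move=> t; have [] := is_derive_quadratic_test t.
- by rewrite derive1_quadratic_test => t; have [] := D2 t.
- have -> : derive1 (derive1 quadratic_test) = cst (2 * k).
    rewrite derive1_quadratic_test; apply/funext => t; rewrite derive1E.
    exact: (@derive_val _ _ _ _ _ _ _ (D2 t)).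
  by move=> t; exact: cvg_cst.
Qed.

Lemma quadratic_test_increment (x e : R) :
  quadratic_test (x + e) - quadratic_test x =
  (p + 2 * k * (x - c)) * e + k * e ^+ 2.
Proof. by rewrite /quadratic_test; ring. Qed.

End quadratic_test_functions.

(** * Holder regularity of viscosity solutions *)

Section half_line_extension.
Context (R : realType).
Implicit Types u : R -> R.

(** Constant extension to the left of 0, which makes continuity and measurability results on the
    whole line applicable. Censored jumps never leave the half-line, so the added values are not
    visited. *)
Definition clamp u : R -> R := fun t => u (Num.max 0 t).

Lemma clampE u t : 0 <= t -> clamp u t = u t.
Proof. by move=> t0; rewrite /clamp (max_idPr t0). Qed.

Lemma half_lineE (t : R) : half_line R t = (0 <= t) :> Prop.
Proof. by rewrite /half_line/= in_itv/= andbT. Qed.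

Lemma add_eta_ge0 (x z : R) : 0 <= x -> 0 <= x + eta x z.
Proof. by move=> x0; rewrite /eta; case: ifP => //; rewrite addr0. Qed.

Lemma bounded_on_half_lineP u : bounded_on_half_line u ->
  exists2 B, 0 <= B & forall t, 0 <= t -> `|u t| <= B.
Proof.
move=> [M [_ MP]]; exists (`|M| + 1); first by rewrite addr_ge0.
move=> t t0; apply: (MP (`|M| + 1)); last by rewrite /= half_lineE.
by rewrite ltr_pwDr// ler_norm.
Qed.

Lemma bounded_on_half_line_intro u B : (forall t, 0 <= t -> `|u t| <= B) ->
  bounded_on_half_line u.
Proof.
move=> uB; exists B; split; first exact: num_real.
by move=> M BM t /=; rewrite half_lineE => t0; rewrite (le_trans (uB _ t0))// ltW.
Qed.

Lemma continuous_clamp u : {within half_line R, continuous u} ->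
  continuous (clamp u).
Proof.
move=> cu t.
have m0 : half_line R (Num.max 0 t) by rewrite half_lineE le_max lexx.
have H := (subspace_continuousP _ _).1 cu _ m0.
apply: (@cvg_comp _ _ _ (fun s => Num.max 0 s) u (nbhs t)
  (within (half_line R) (nbhs (Num.max 0 t)))); last exact: H.
move=> A; rewrite /within/= => HA.
have cm : Num.max 0 s @[s --> t] --> Num.max 0 t.
  exact: (@continuous_max R R (cst 0) id t (@cst_continuous _ _ 0 t) (fun _ => id)).
change (\forall s \near t, A (Num.max 0 s)).
have : \forall s \near t, half_line R (Num.max 0 s) -> A (Num.max 0 s).
  exact: (cm _ HA).
by apply: filterS => s; apply; rewrite half_lineE le_max lexx.
Qed.

Lemma unif_continuous_half_lineP u : unif_continuous_half_line u ->
  forall e, 0 < e -> exists2 d, 0 < d &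
    forall x y, 0 <= x -> 0 <= y -> `|x - y| < d -> `|u x - u y| < e.
Proof.
move=> H e e0.
have := H _ (@entourage_ball _ R (PosNum e0)).
rewrite /= /entourage/= /nbhs/= => -[E]; rewrite -entourage_ballE.
move=> [d d0 dE] EP; exists d => // x y x0 y0 xy.
apply: (EP (x, y)); right; split; first by rewrite /= half_lineE.
by split; [rewrite /= half_lineE|exact: dE].
Qed.

End half_line_extension.

(** * Exchange of sub- and supersolutions under negation *)

Section negation.
Context (R : realType) (alpha : R).
Hypotheses (alpha_gt1 : 1 < alpha) (alpha_lt2 : alpha < 2).
Notation TR := (measurableTypeR R).
Variables mu ms : {measure set (measurableTypeR R) -> \bar R}.
Hypothesis ms_fin : (\int[ms]_(z in [set~ 0%R])
  (Num.min 1 (`|z| `^ (alpha - 1)))%:E < +oo)%E.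
Hypothesis muE : forall A : set TR, measurable A ->
  (mu A = mu_star alpha A + ms A)%E.

Lemma C2N (phi : R -> R) : C2 phi -> C2 (fun t => - phi t).
Proof.
move=> [d1 d2 c2].
have e1 : derive1 (fun t => - phi t) = fun t => - derive1 phi t.
  by apply/funext => t; rewrite !derive1E deriveN.
have e2 : derive1 (derive1 (fun t => - phi t)) = fun t => - derive1 (derive1 phi) t.
  by rewrite e1; apply/funext => t; rewrite !derive1E deriveN.
split.
- by move=> t; apply: derivableN.
- by rewrite e1 => t; apply: derivableN.
- by rewrite e2 => t; apply: cvgN; exact: c2.
Qed.

Lemma derive1N (phi : R -> R) t : derivable phi t 1 ->
  derive1 (fun t => - phi t) t = - derive1 phi t.
Proof. by move=> dphi; rewrite !derive1E deriveN. Qed.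

Lemma integrable_outer u x r (S : set TR) : continuous (clamp u) ->
  bounded_on_half_line u -> 0 <= x -> 0 < r -> measurable S -> S `<=` far r ->
  mu.-integrable S (EFin \o (fun z : TR => u (x + eta x z) - u x)).
Proof.
move=> cu /bounded_on_half_lineP[B B0 uB] x0 r0 mS Sr.
apply: (@mu_integrable _ _ alpha_gt1 mu ms ms_fin muE r _ _ (B + B)) => //.
  apply: measurable_funTS; rewrite (_ : (fun _ => _) =
    (fun z : TR => clamp u (x + eta x z) - u x)); last first.
    by apply/funext => z; rewrite clampE// add_eta_ge0.
  apply: measurable_funB => //.
  apply: (measurableT_comp (continuous_measurable_fun cu)).
  by apply: measurable_funD => //; exact: measurable_eta.
move=> z _; apply: le_trans (ler_normB _ _) _.
by apply: lerD; apply: uB => //; exact: add_eta_ge0.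
Qed.

Lemma I_outerN (u : R -> R) x delta : continuous (clamp u) ->
  bounded_on_half_line u -> 0 <= x -> 0 < delta ->
  I_outer mu delta (fun t => - u t) x = - I_outer mu delta u x.
Proof.
move=> cu bu x0 d0; rewrite /I_outer.
transitivity (\int[mu]_(z in far delta) (-1 * (u (x + eta x z) - u x))).
  by apply: eq_Rintegral => z _; ring.
rewrite RintegralZl ?mulN1r//; first exact: measurable_far.
exact: (integrable_outer cu bu x0 d0 (@measurable_far R delta)).
Qed.

Lemma integrable_inner (phi : R -> R) x b delta : continuous phi -> 0 < b ->
  mu.-integrable [set z : TR | b < `|z| < delta]
    (EFin \o (fun z : TR => phi (x + eta x z) - phi x)).
Proof.
move=> cphi b0.
have [C C0 CP] := continuous_bounded_itv (x - delta) (x + delta) cphi.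
have mS := measurable_annulus false false b delta.
apply: (@mu_integrable _ _ alpha_gt1 mu ms ms_fin muE b _ _ (C + C)) => //.
- by move=> z /= /andP[/ltW].
- by apply: measurable_funTS; exact: measurable_jump_increment.
- move=> z /= /andP[_ zd]; apply: le_trans (ler_normB _ _) _.
  have ed : `|eta x z| <= delta by apply: le_trans (normr_eta _ _) (ltW zd).
  have d0 : 0 <= delta by apply: le_trans ed.
  apply: lerD; apply: CP; last by rewrite lerBlDr !lerDl d0.
  by move: ed; rewrite ler_norml !lerD2l.
Qed.

(** Taking the sign out of [lim] requires the limit to exist, hence x > 0 and [inner_cvg]. *)
Lemma I_innerN (phi : R -> R) x delta : C2 phi -> 0 < x -> 0 < delta ->
  I_inner mu delta (fun t => - phi t) x = - I_inner mu delta phi x.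
Proof.
move=> Cphi x0 d0; rewrite /I_inner.
have := inner_cvg alpha_gt1 alpha_lt2 ms_fin muE Cphi x0 d0.
set F := fun b : R => _ => cF.
have -> : - lim (F b @[b --> 0^'+]) = lim ((- F) b @[b --> 0^'+]) by rewrite limN.
apply/cvg_lim => //; apply: cvg_trans (is_cvgN cF).
apply: near_eq_cvg; near=> b.
have b0 : 0 < b by near: b; exact: nbhs_right_gt.
rewrite -[(- F) b]/(- F b) -mulN1r /F -RintegralZl//.
- by apply: eq_Rintegral => z _; ring.
- exact: (measurable_annulus false false b delta).
- by apply: integrable_inner => //; exact: C2_continuous.
Unshelve. all: by end_near. Qed.

Lemma bounded_on_half_lineN u : bounded_on_half_line u ->
  bounded_on_half_line (fun t : R => - u t).
Proof.
move=> /bounded_on_half_lineP[B _ uB].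
by apply: (@bounded_on_half_line_intro _ _ B) => t t0; rewrite normrN uB.
Qed.

Lemma viscosity_subsolutionN f u : continuous (clamp u) ->
  viscosity_subsolution mu f u ->
  viscosity_supersolution mu (fun t => - f t) (fun t => - u t).
Proof.
move=> cu [bu usc sub]; split => //; first exact: bounded_on_half_lineN.
move=> delta phi x d0 Cphi xh xmin.
have [|s1 s2] := sub delta (fun t => - phi t) x d0 (C2N Cphi) xh.
  by move=> y /xmin; lra.
rewrite half_lineE in xh; split.
  move=> x0; have := s1 x0.
  by rewrite I_innerN// I_outerN//; lra.
by move=> xE; have := s2 xE; rewrite derive1N ?opprK//; [lra|case: Cphi].
Qed.

Lemma viscosity_supersolutionN f u : continuous (clamp u) ->
  viscosity_supersolution mu f u ->
  viscosity_subsolution mu (fun t => - f t) (fun t => - u t).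
Proof.
move=> cu [bu lsc sup]; split; first exact: bounded_on_half_lineN.
  rewrite /usc_half_line (_ : (fun t => - - u t) = u)//.
  by apply/funext => t; rewrite opprK.
move=> delta phi x d0 Cphi xh xmax.
have [|s1 s2] := sup delta (fun t => - phi t) x d0 (C2N Cphi) xh.
  by move=> y /xmax; lra.
rewrite half_lineE in xh; split.
  move=> x0; have := s1 x0.
  by rewrite I_innerN// I_outerN//; lra.
by move=> xE; have := s2 xE; rewrite derive1N ?opprK//; [lra|case: Cphi].
Qed.

End negation.

(** * Contradiction at a penalised maximum *)

Section doubling.
Context (R : realType) (alpha : R).
Hypotheses (alpha_gt1 : 1 < alpha) (alpha_lt2 : alpha < 2).
Notation TR := (measurableTypeR R).
Variables mu ms : {measure set (measurableTypeR R) -> \bar R}.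
Hypothesis ms_fin : (\int[ms]_(z in [set~ 0%R])
  (Num.min 1 (`|z| `^ (alpha - 1)))%:E < +oo)%E.
Hypothesis muE : forall A : set TR, measurable A ->
  (mu A = mu_star alpha A + ms A)%E.
Variable b : R.
Hypothesis bE : 1 - b = 7 / 8 * (2 - alpha).

Let ab : alpha - 1 < b. Proof. by have := alpha_lt2; have := bE; lra. Qed.

Let b0 : 0 < b. Proof. by apply: lt_trans ab; rewrite subr_gt0. Qed.

Let b1 : b < 1. Proof. by have := alpha_lt2; have := bE; lra. Qed.

(** The disjunction makes the drift nonpositive: its mean jump is nonnegative, so a nonpositive
    slope suffices, and it vanishes once delta <= x. The first case serves the left point, which may
    be arbitrarily close to the boundary, the second the right one. *)
Lemma I_inner_quadratic_le (p k c x delta : R) :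
  0 <= k -> 0 < x -> 0 < delta -> delta <= 1 ->
  p + 2 * k * (x - c) <= 0 \/ delta <= x ->
  I_inner mu delta (quadratic_test p k c) x <=
    (`|p + 2 * k * (x - c)| + k) * levy_cst alpha ms * delta `^ (2 - alpha).
Proof.
move=> k0 x0 d0 d1 qx; set q := p + _.
apply: limr_le.
  exact: (inner_cvg alpha_gt1 alpha_lt2 ms_fin muE (C2_quadratic_test _ _ _)).
near=> r.
have r0 : 0 < r by near: r; exact: nbhs_right_gt.
have rd : r < delta by near: r; exact: nbhs_right_lt.
set S : set TR := [set z : TR | r < `|z| < delta].
have mS : measurable S by exact: (measurable_annulus false false r delta).
have Srd z : S z -> r <= `|z| <= delta by move=> /andP[/ltW -> /ltW ->].
have SN z : S z -> S (- z) by rewrite /S/= normrN.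
have mid : measurable_fun setT (fun z : TR => z) by exact: measurable_id.
have zP z : r <= z -> z <= z <= 1 * z by rewrite mul1r lexx.
have cphi : continuous (quadratic_test p k c).
  by apply: C2_continuous; exact: C2_quadratic_test.
pose H (z : TR) := quadratic_test p k c (x + eta x z) - quadratic_test p k c x.
have mH : measurable_fun S H.
  by apply: measurable_funTS; exact: measurable_jump_increment.
have [M _ MP] := continuous_bounded_itv (x - delta) (x + delta) cphi.
have HM z : S z -> `|H z| <= M + M.
  move=> /andP[_ zd]; apply: le_trans (ler_normB _ _) _.
  have ed : `|eta x z| <= delta by apply: le_trans (normr_eta _ _) (ltW zd).
  apply: lerD; apply: MP; last by rewrite lerBlDr !lerDl ltW.
  by move: ed; rewrite ler_norml !lerD2l.
have Hle z : S z -> H z <= q * eta x z + k * z ^+ 2.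
  move=> _; rewrite /H quadratic_test_increment lerD2l ler_wpM2l//.
  by rewrite /eta; case: ifP => // _; rewrite expr0n sqr_ge0.
have := @Rintegral_jump_le _ _ alpha_gt1 alpha_lt2 mu ms ms_fin muE r delta 1
  (fun z => z) S r0 rd d1 (lexx _) mid (fun=> erefl) zP mS Srd x q k _ H
  (ltW x0) k0 mH HM Hle.
move/le_trans; apply; rewrite expr1n mulr1 gerDr.
case: qx => [q0|dx].
  apply: mulr_le0_ge0 => //.
  exact: (mean_jump_ge0 alpha_gt1 r0 (lexx 1) mid (fun=> erefl) zP mS SN Srd (ltW x0)).
rewrite (mean_jump_eq0 alpha_gt1 r0 rd (lexx 1) mid (fun=> erefl) zP mS SN Srd) ?mulr0//.
by rewrite mul1r.
Unshelve. all: by end_near. Qed.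

Notation A := (levy_cst alpha ms).
Notation C := (Csharp alpha ms).

(** The maximum is used in two forms. The exact penalised one yields the two test functions; the
    weaker one, with the penalties absorbed into k, is what the coupled jumps of arbitrary size
    need. In the last hypothesis 2 Bf bounds the difference of f, 2 (L + 3) A the two inner
    operators, 2 the term 2 k mu([far delta]), and (2 L + 2 B) C the contribution of [ms]. *)
Lemma doubling_absurd (u f : R -> R) (L B Bf k y d delta xb yb : R) :
  continuous (clamp u) -> (forall t, 0 <= t -> `|u t| <= B) ->
  (forall t, 0 <= t -> `|f t| <= Bf) ->
  viscosity_subsolution mu f u -> viscosity_supersolution mu f u ->
  0 < L -> 0 < d -> d <= 1 -> 0 <= y -> 0 < delta -> delta <= 1 ->
  delta `^ (2 - alpha) <= d `^ (2 - alpha) / 4 ->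
  0 < k -> k <= 1 -> 2 * k <= L * b -> k * fine (mu (far delta)) <= 1 ->
  0 <= yb -> `|y + d - xb| <= 1 -> `|y - yb| <= 1 ->
  (forall x' y', 0 <= x' -> 0 <= y' ->
    u x' - u y' - L * `|x' - y'| `^ b - k * (x' - xb) ^+ 2 - k * (y' - yb) ^+ 2
    <= u (y + d) - u y - L * d `^ b - k * (y + d - xb) ^+ 2 - k * (y - yb) ^+ 2) ->
  (forall x' y', 0 <= x' -> 0 <= y' ->
    u x' - u y' <= u (y + d) - u y + L * (`|x' - y'| `^ b - d `^ b) + k) ->
  0 <= u (y + d) - u y ->
  (2 * Bf + 6 * A + 2 + 2 * B * C) + (2 * A + 2 * C) * L <
    5 / 64 * (L * b * d `^ (b - alpha)) -> False.
Proof.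
move=> cu uB fB sub sup L0 d0 d1 y0 dl0 dl1 dld k0 k1 kL kLam yb0 xxb yyb pen near_max pos contra.
set x := y + d in xxb pen near_max pos *.
have a20 : 0 < 2 - alpha by rewrite subr_gt0.
have A0 : 0 <= A by exact: levy_cst_ge0.
have x0 : 0 < x by rewrite ltr_wpDl.
have dl_d : delta < d.
  rewrite ltNge; apply/negP => ddl.
  have : d `^ (2 - alpha) <= delta `^ (2 - alpha).
    by apply: ge0_ler_powR; rewrite ?nnegrE ?(ltW a20) ?(ltW d0) ?(ltW dl0).
  by have := powR_gt0 (2 - alpha) d0; lra.
pose p := L * (b * d `^ (b - 1)).
have dn : d != 0 by rewrite gt_eqF.
have db1 : 1 <= d `^ (b - 1).
  rewrite -(opprK (b - 1)) powRN opprB.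
  rewrite invf_ge1 ?powR_gt0//.
  have e1 : 1 `^ (1 - b) = 1 :> R by rewrite powR1.
  rewrite -[leRHS]e1.
  by apply: ge0_ler_powR; rewrite ?nnegrE ?subr_ge0 ?(ltW b1) ?(ltW d0).
have pL : L * b <= p by rewrite /p ler_wpM2l ?(ltW L0)// ler_peMr// ltW.
have p0 : 0 < p by apply: lt_le_trans pL; rewrite mulr_gt0.
have dl1' : delta `^ (2 - alpha) <= 1.
  have e1 : 1 `^ (2 - alpha) = 1 :> R by rewrite powR1.
  rewrite -[leRHS]e1.
  by apply: ge0_ler_powR; rewrite ?nnegrE ?(ltW a20) ?(ltW dl0).
have dlge0 : 0 <= delta `^ (2 - alpha) by exact: powR_ge0.
(* Replacing delta by d leaves L b d^(b - 1 + 2 - alpha), whose exponent is positive because b >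
   alpha - 1; with d <= 1 this is at most L. *)
have pdl : p * delta `^ (2 - alpha) <= L.
  apply: (@le_trans _ _ (p * d `^ (2 - alpha))).
    rewrite ler_wpM2l ?(ltW p0)//.
    by apply: ge0_ler_powR; rewrite ?nnegrE ?(ltW a20) ?(ltW dl0) ?(ltW d0) ?(ltW dl_d).
  rewrite /p -!mulrA ler_piMr ?(ltW L0)// -powRD ?dn ?implybT//.
  rewrite mulr_ile1 ?powR_ge0 ?(ltW b0) ?(ltW b1)//.
  have e1 : 1 `^ (b - 1 + (2 - alpha)) = 1 :> R by rewrite powR1.
  rewrite -[leRHS]e1.
  apply: ge0_ler_powR; rewrite ?nnegrE ?(ltW d0)//.
  by have := ab; lra.
have tangent t : 0 <= t -> L * (t `^ b - d `^ b) <= p * (t - d).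
  move=> t0; rewrite /p -mulrA ler_wpM2l ?(ltW L0)//.
  exact: powR_le_tangent.
have inner (q m : R) : `|q| <= p + 2 * k * m -> m <= 1 ->
    (`|q| + k) * A * delta `^ (2 - alpha) <= (L + 3) * A.
  move=> qp m1; rewrite mulrAC ler_wpM2r//.
  apply: (@le_trans _ _ ((p + 3) * delta `^ (2 - alpha))).
    rewrite ler_wpM2r//; apply: (@le_trans _ _ (p + 2 * k * m + k)); first by rewrite lerD2r.
    have : k * m <= k by rewrite ler_piMr// ltW.
    by have := k1; lra.
  by rewrite mulrDl lerD// ler_piMr.
have [bu _ subP] := sub; have [_ _ supP] := sup.
have Hx : u x - (L + 3) * A - I_outer mu delta u x <= f x.
  have [||s1 _] := subP delta (quadratic_test p k xb) x dl0 (C2_quadratic_test _ _ _).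
  - by rewrite half_lineE ltW.
  - move=> x' [/=]; rewrite in_itv/= half_lineE => /andP[x1 x2] x'0.
    have := pen _ _ x'0 y0.
    (* Within delta < d of x the competitor stays to the right of y, where the tangent bound
       applies. *)
    have x'y : 0 <= x' - y by rewrite /x in x1; lra.
    have := tangent _ x'y; rewrite (ger0_norm x'y) /quadratic_test.
    by rewrite /x; lra.
  - have := s1 x0.
    have dx : delta <= x by rewrite /x (le_trans (ltW dl_d))// lerDr.
    have := I_inner_quadratic_le (p := p) (c := xb) (ltW k0) x0 dl0 dl1 (or_intror dx).
    have := inner (p + 2 * k * (x - xb)) `|x - xb| _ xxb.
    have h : `|p + 2 * k * (x - xb)| <= p + 2 * k * `|x - xb|.
      apply: le_trans (ler_normD _ _) _.
      by rewrite (gtr0_norm p0) !normrM (gtr0_norm k0) ger0_norm.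
    by move=> /(_ h); lra.
have y_gt0 : 0 < y /\ f y <= u y + (L + 3) * A - I_outer mu delta u y.
  have [||s1 s2] := supP delta (quadratic_test p (- k) yb) y dl0 (C2_quadratic_test _ _ _).
  - by rewrite half_lineE.
  - move=> y' [/=]; rewrite in_itv/= half_lineE => /andP[y1 y2] y'0.
    have := pen _ _ (ltW x0) y'0.
    have xy' : 0 <= x - y' by rewrite /x; lra.
    have := tangent _ xy'; rewrite (ger0_norm xy') /quadratic_test.
    by rewrite /x; lra.
  (* At y = 0 the test function has derivative p + 2 k yb > 0, against the Neumann inequality; the
     penalty has the right sign because yb >= 0. *)
  have yp : 0 < y.
    rewrite lt0r y0 andbT; apply/negP => /eqP yE; have := s2 yE.
    rewrite derive1_quadratic_test => h.
    have : 0 <= k * yb by rewrite mulr_ge0// ltW.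
    by have := p0; lra.
  split => //; have := s1 yp.
  have E : I_inner mu delta (quadratic_test p (- k) yb) y =
     - I_inner mu delta (quadratic_test (- p) k yb) y.
    rewrite -(I_innerN alpha_gt1 alpha_lt2 ms_fin muE (C2_quadratic_test _ _ _) yp dl0).
    by congr (I_inner mu delta _ y); apply/funext => t; rewrite /quadratic_test; ring.
  have yyb1 : y - yb <= 1 by apply: le_trans (ler_norm _) yyb.
  (* The penalty cannot reverse the slope, because 2 k <= L b <= p. *)
  have q0 : - p + 2 * k * (y - yb) <= 0.
    have : k * (y - yb) <= k by rewrite ler_piMr// ltW.
    by lra.
  have := I_inner_quadratic_le (p := - p) (c := yb) (ltW k0) yp dl0 dl1 (or_introl q0).
  have := inner (- p + 2 * k * (y - yb)) `|y - yb| _ yyb.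
  have h : `|- p + 2 * k * (y - yb)| <= p + 2 * k * `|y - yb|.
    apply: le_trans (ler_normD _ _) _.
    by rewrite normrN (gtr0_norm p0) !normrM (gtr0_norm k0) ger0_norm.
  by move=> /(_ h); rewrite E; lra.
have {y_gt0} [yp Hy] := y_gt0.
have mu_jump s : 0 <= s -> measurable_fun setT (fun z : TR => u (s + eta s z)).
  move=> s0; rewrite (_ : (fun _ => _) = (fun z : TR => clamp u (s + eta s z))).
    apply: (measurableT_comp (continuous_measurable_fun cu)).
    by apply: measurable_funD => //; exact: measurable_eta.
  by apply/funext => z; rewrite clampE// add_eta_ge0.
have := @coupling_estimate _ _ alpha_gt1 alpha_lt2 mu ms ms_fin muE b bE
  L k B d y delta u [set t | 0 <= t] id (ltW L0) (ltW k0) d0 y0 dl0 dld.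
move=> /(_ (ltW x0) y0 uB near_max).
have jmp (z : TR) : far delta z -> 0 <= x + eta x z /\ 0 <= y + eta y z.
  by move=> _; split; apply: add_eta_ge0 => //; exact: ltW.
move=> /(_ jmp (fun z _ => lexx z)).
have j1 (z : TR) : far delta z -> `|z| < d -> `|z| <= d by move=> _ /ltW.
have j2 (z : TR) : far delta z -> d <= `|z| -> `|z| <= 2 * `|z|.
  by move=> _ _; rewrite ler_peMl// ler1n.
have j3 (z : TR) : far delta z -> - y - d <= z -> z < - y -> - y - d <= z <= - y.
  by move=> _ -> /ltW ->.
move=> /(_ j1 j2 j3 (mu_jump _ (ltW x0)) (mu_jump _ y0)).
rewrite -[\int[mu]_(z in far delta) (u (x + eta x (id z)) - u x)]/(I_outer mu delta u x).
rewrite -[\int[mu]_(z in far delta) (u (y + eta y (id z)) - u y)]/(I_outer mu delta u y).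
have fx := fB _ (ltW x0); have fy := fB _ y0.
move: fx fy; rewrite !ler_norml => /andP[fx1 fx2] /andP[fy1 fy2].
have C0 : 0 <= C by exact: Csharp_ge0.
move: Hx Hy; set Ix := I_outer _ _ _ x; set Iy := I_outer _ _ _ y.
by lra.
Qed.

End doubling.

Section holder_regularity.
Context (R : realType) (b : R).
Hypothesis b0 : 0 < b.

Lemma continuous_normr_powR : continuous (fun t : R => `|t| `^ b).
Proof.
move=> t; have [->|t0] := eqVneq t 0; last first.
  have nt : 0 < `|t| by rewrite normr_gt0.
  apply: (@continuous_comp _ _ _ (fun s : R => `|s|) (fun s => s `^ b)).
    exact: norm_continuous.
  exact: powR_continuous_at.
apply/cvgrPdist_le => e e0; near=> s.
rewrite normr0 powR0 ?gt_eqF// sub0r normrN ger0_norm ?powR_ge0//.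
have e1 : 0 < e `^ b^-1 by exact: powR_gt0.
have eE : (e `^ b^-1) `^ b = e by rewrite -powRrM mulVf ?gt_eqF// powRr1// ltW.
rewrite -[leRHS]eE.
apply: ge0_ler_powR; rewrite ?nnegrE ?(ltW b0) ?(ltW e1)//.
near: s; apply/nbhs_ballP; exists (e `^ b^-1); first exact: powR_gt0.
move=> s.
by rewrite /ball/= sub0r normrN => /ltW.
Unshelve. all: by end_near. Qed.

(** Compactness gives a maximum on a box only. The side 1 beyond the centre is chosen so that a
    competitor outside pays a penalty of at least k. *)
Lemma penalised_max (v : R -> R) (L k xb yb : R) : continuous v ->
  0 <= xb -> 0 <= yb ->
  exists2 q : R * R, [/\ 0 <= q.1, 0 <= q.2, q.1 <= xb + 1 & q.2 <= yb + 1] &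
   forall x' y', 0 <= x' -> 0 <= y' -> x' <= xb + 1 -> y' <= yb + 1 ->
    v x' - v y' - L * `|x' - y'| `^ b - k * (x' - xb) ^+ 2 - k * (y' - yb) ^+ 2
    <= v q.1 - v q.2 - L * `|q.1 - q.2| `^ b
       - k * (q.1 - xb) ^+ 2 - k * (q.2 - yb) ^+ 2.
Proof.
move=> cv xb0 yb0.
pose K := `[0, xb + 1]%classic `*` `[0, yb + 1]%classic : set (R * R).
have cK : compact K by apply: compact_setX; exact: segment_compact.
have Kn : K !=set0.
  by exists (xb, yb); split; rewrite /= in_itv/= ?xb0 ?yb0 lerDl ler01.
pose F (p : R * R) := v p.1 - v p.2 - L * `|p.1 - p.2| `^ b
       - k * (p.1 - xb) ^+ 2 - k * (p.2 - yb) ^+ 2.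
have cF : continuous F.
  move=> p.
  have c1 : {for p, continuous (fun p : R * R => p.1)} by exact: cvg_fst.
  have c2 : {for p, continuous (fun p : R * R => p.2)} by exact: cvg_snd.
  have sq (h : R * R -> R) (c : R) : {for p, continuous h} ->
      {for p, continuous (fun p => k * (h p - c) ^+ 2)}.
    move=> ch.
    have cs : {for p, continuous (fun p => h p - c)} by apply: cvgB => //; exact: cvg_cst.
    by apply: cvgM; [exact: cvg_cst|rewrite expr2; exact: cvgM].
  apply: cvgB; last exact: sq.
  apply: cvgB; last exact: sq.
  apply: cvgB.
    apply: cvgB.
      by apply: (@continuous_comp _ _ _ (fun p : R * R => p.1) v) => //; exact: cv.
    by apply: (@continuous_comp _ _ _ (fun p : R * R => p.2) v) => //; exact: cv.
  apply: cvgM; first exact: cvg_cst.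
  apply: (@continuous_comp _ _ _ (fun p : R * R => p.1 - p.2) (fun t => `|t| `^ b)).
    exact: cvgB.
  exact: continuous_normr_powR.
have [c] := compact_EVT_max Kn cK (continuous_subspaceT cF).
rewrite inE => -[/=]; rewrite !in_itv/= => /andP[c1 c2] /andP[c3 c4] H.
exists c => // x' y' x0 y0 x1 y1.
by apply: (H (x', y')); rewrite inE; split; rewrite /= in_itv/= ?x0 ?y0.
Qed.

End holder_regularity.

Lemma viscosity_solution_holder (R : realType) (alpha b : R)
    (mu ms : {measure set (measurableTypeR R) -> \bar R}) (u f : R -> R) :
  1 < alpha -> alpha < 2 ->
  (\int[ms]_(z in [set~ 0%R])
    (Num.min 1 (`|z| `^ (alpha - 1)))%:E < +oo)%E ->
  (forall A : set (measurableTypeR R), measurable A ->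
    (mu A = mu_star alpha A + ms A)%E) ->
  1 - b = 7 / 8 * (2 - alpha) ->
  bounded_on_half_line f -> bounded_on_half_line u ->
  unif_continuous_half_line u -> viscosity_solution mu f u ->
  exists C : R, forall x y : R, half_line R x -> half_line R y ->
    `|u x - u y| <= C * `|x - y| `^ b.
Proof.
move=> alpha_gt1 alpha_lt2 ms_fin muE bE bf bu ucu [vsub vsup].
have ab : alpha - 1 < b by lra.
have b1 : b < 1 by lra.
have b0 : 0 < b by lra.
have [B B0 uB] := bounded_on_half_lineP bu.
have [Bf Bf0 fB] := bounded_on_half_lineP bf.
have uc := unif_continuous_half_lineP ucu.
have cu : continuous (clamp u).
  move=> t; apply/cvgrPdist_lt => e e0; have [d d0 H] := uc e e0.
  near=> s; rewrite /clamp; apply: H; rewrite ?le_max ?lexx//.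
  have ts : `|t - s| < d.
    by near: s; apply/nbhs_ballP; exists d => // s.
  apply: le_lt_trans ts.
  have [t0|t0] := leP 0 t; have [s0|s0] := leP 0 s => //.
  - by rewrite subr0 !ger0_norm//; lra.
  - by rewrite sub0r normrN ger0_norm// ler0_norm; lra.
  - by rewrite subr0 normr0.
have cu' : continuous (clamp (fun t => - u t)).
  by move=> t; apply: cvgN; exact: cu.
have subN := viscosity_supersolutionN alpha_gt1 alpha_lt2 ms_fin muE cu vsup.
have supN := viscosity_subsolutionN alpha_gt1 alpha_lt2 ms_fin muE cu vsub.
pose A := levy_cst alpha ms; pose C := Csharp alpha ms.
have A0 : 0 <= A by exact: levy_cst_ge0.
have C0 : 0 <= C by exact: Csharp_ge0.
have c00 : 0 <= 2 * Bf + 6 * A + 2 + 2 * B * C by rewrite !addr_ge0 ?mulr_ge0.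
have c10 : 0 <= 2 * A + 2 * C by rewrite addr_ge0 ?mulr_ge0.
have [L L0 LP] := choose_holder_constant b0 (lt_trans b1 alpha_gt1) c00 c10 B0.
pose Phi x' y' := u x' - u y' - L * `|x' - y'| `^ b.
suff key : forall x' y', 0 <= x' -> 0 <= y' -> Phi x' y' <= 0.
  exists L => x y; rewrite !half_lineE => x0 y0.
  have := key _ _ x0 y0; have := key _ _ y0 x0.
  rewrite /Phi (distrC y x) ler_norml => h1 h2.
  by apply/andP; split; lra.
apply: contrapT => /existsNP[x1] /existsNP[y1].
move=> /not_implyP[x10] /not_implyP[y10] /negP; rewrite -ltNge => P0.
pose E := [set t | exists x' y', [/\ 0 <= x', 0 <= y' & t = Phi x' y']].
have PhiB x' y' : 0 <= x' -> 0 <= y' -> Phi x' y' <= 2 * B.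
  move=> h1 h2; have := uB _ h1; have := uB _ h2; rewrite !ler_norml.
  move=> /andP[h3 h4] /andP[h5 h6].
  have : 0 <= L * `|x' - y'| `^ b by rewrite mulr_ge0 ?powR_ge0 ?ltW.
  by rewrite /Phi; lra.
have Esup : has_sup E.
  split; first by exists (Phi x1 y1); exists x1, y1.
  by exists (2 * B) => t [x' [y' [h1 h2 ->]]]; exact: PhiB.
pose M := sup E.
have PhiM x' y' : 0 <= x' -> 0 <= y' -> Phi x' y' <= M.
  by move=> h1 h2; apply: sup_upper_bound => //; exists x', y'.
have M0 : 0 < M by apply: lt_le_trans P0 _; exact: PhiM.
have M20 : 0 < M / 2 by rewrite divr_gt0.
(* The level M/2 separates every near-maximal pair by at least [duc]; this lower bound depends on
   neither delta nor k. *)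
have [duc duc0 ducP] := uc (M / 2) M20.
have a20 : 0 < 2 - alpha by rewrite subr_gt0.
(* The factor, raised to the power 2 - alpha, is exactly 1/4. *)
pose delta := Num.min 1 duc * (4^-1) `^ (2 - alpha)^-1.
have m0 : 0 < Num.min 1 duc by rewrite lt_min ltr01.
have f0 : 0 < (4^-1 : R) `^ (2 - alpha)^-1 by rewrite powR_gt0// invr_gt0.
have delta0 : 0 < delta by rewrite mulr_gt0.
have f1 : (4^-1 : R) `^ (2 - alpha)^-1 <= 1.
  have e1 : 1 `^ (2 - alpha)^-1 = 1 :> R by rewrite powR1.
  rewrite -[leRHS]e1; apply: ge0_ler_powR; rewrite ?nnegrE ?invr_ge0 ?(ltW a20)//.
  by rewrite invf_le1 ?ler1n.
have delta1 : delta <= 1.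
  by rewrite /delta mulr_ile1 ?(ltW m0) ?(ltW f0)// ge_min lexx.
have deltaE d : duc <= d -> delta `^ (2 - alpha) <= d `^ (2 - alpha) / 4.
  move=> dd; rewrite /delta powRM ?(ltW m0) ?(ltW f0)//.
  rewrite -powRrM mulVf ?gt_eqF// powRr1 ?invr_ge0// ler_wpM2r ?invr_ge0//.
  apply: ge0_ler_powR; rewrite ?nnegrE ?(ltW a20) ?(ltW m0)//.
    by rewrite (le_trans _ dd)// ltW.
  by rewrite (le_trans _ dd)// ge_min lexx orbT.
pose Lam := fine (mu (far delta)).
have Lam0 : 0 <= Lam by apply: fine_ge0.
(* Respectively: k <= 1, the sign of the slope at the left point, the loss k mu([far delta]), and
   keeping the maximum above M/2. *)
pose k := Num.min (Num.min 1 (L * b / 2)) (Num.min (Lam + 1)^-1 (M / 2)).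
have k0 : 0 < k.
  by rewrite !lt_min ltr01 !divr_gt0 ?mulr_gt0//= invr_gt0 ltr_wpDl.
have k1 : k <= 1 by rewrite /k !ge_min lexx.
have kL : 2 * k <= L * b.
  have : k <= L * b / 2 by rewrite /k !ge_min lexx !orbT.
  by clear; lra.
have kLam : k * Lam <= 1.
  have : k <= (Lam + 1)^-1 by rewrite /k !ge_min lexx !orbT.
  have L1 : 0 < Lam + 1 by rewrite ltr_wpDl.
  by rewrite -[_^-1]mul1r ler_pdivlMr// mulrDr mulr1; have := ltW k0; clear; lra.
have kM : k <= M / 2 by rewrite /k !ge_min lexx !orbT.
have [t [xb [yb [xb0 yb0 ->]]] tM] := sup_adherent k0 Esup.
have := penalised_max b0 L k cu xb0 yb0.
move=> [[x y] [/= x0 y0 xx1 yy1] pmax].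
have Phixb : M - k < Phi xb yb by [].
have pmax' x' y' : 0 <= x' -> 0 <= y' ->
    Phi x' y' - k * (x' - xb) ^+ 2 - k * (y' - yb) ^+ 2
    <= Phi x y - k * (x - xb) ^+ 2 - k * (y - yb) ^+ 2.
  move=> h1 h2.
  have H0 := pmax _ _ xb0 yb0.
  rewrite !clampE// !subrr expr0n/= !mulr0 !subr0 !lerDl !ler01 in H0.
  have {}H0 := H0 isT isT; rewrite -/(Phi xb yb) -/(Phi x y) in H0.
  have s1 : 0 <= k * (x' - xb) ^+ 2 by rewrite mulr_ge0 ?sqr_ge0// ltW.
  have s2 : 0 <= k * (y' - yb) ^+ 2 by rewrite mulr_ge0 ?sqr_ge0// ltW.
  have PM := PhiM _ _ h1 h2.
  (* Outside the box the penalty is at least k, while Phi is at most M, hence less than k above its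
     value at the centre. The maximum over the box is therefore global. *)
  have big (c c' : R) : 0 <= c -> 0 <= c' -> c' + 1 < c -> k <= k * (c - c') ^+ 2.
    move=> _ _ cc; rewrite ler_peMr ?(ltW k0)//.
    by rewrite -[leLHS](expr1n _ 2) ler_pXn2r ?nnegrE//; clear -cc; lra.
  have [hx|hx] := leP x' (xb + 1); last first.
    have := big _ _ h1 xb0 hx; clear -H0 s2 PM Phixb; lra.
  have [hy|hy] := leP y' (yb + 1); last first.
    have := big _ _ h2 yb0 hy; clear -H0 s1 PM Phixb; lra.
  by have := pmax _ _ h1 h2 hx hy; rewrite !clampE.
have H0 := pmax' _ _ xb0 yb0; rewrite !subrr expr0n/= !mulr0 !subr0 in H0.
have PM := PhiM _ _ x0 y0.
have sx0 : 0 <= k * (x - xb) ^+ 2 by rewrite mulr_ge0 ?sqr_ge0// ltW.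
have sy0 : 0 <= k * (y - yb) ^+ 2 by rewrite mulr_ge0 ?sqr_ge0// ltW.
have near1 (c : R) : k * c ^+ 2 <= k -> `|c| <= 1.
  rewrite -[leRHS]mulr1 ler_pM2l// -[leLHS]real_normK ?num_real//.
  by rewrite expr_le1// normr_ge0.
have xxb : `|x - xb| <= 1.
  by apply: near1; clear -H0 PM Phixb sy0; lra.
have yyb : `|y - yb| <= 1.
  by apply: near1; clear -H0 PM Phixb sx0; lra.
have nearM x' y' : 0 <= x' -> 0 <= y' -> Phi x' y' <= Phi x y + k.
  move=> h1 h2; have := PhiM _ _ h1 h2.
  by clear -H0 PM Phixb sx0 sy0; lra.
have Pxy : M / 2 <= Phi x y by clear -H0 PM Phixb sx0 sy0 kM; lra.
have psi0 : 0 <= L * `|x - y| `^ b by rewrite mulr_ge0 ?powR_ge0 ?ltW.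
have uxy : M / 2 <= u x - u y.
  by move: Pxy; rewrite /Phi; clear -psi0; lra.
have dxy : duc <= `|x - y|.
  rewrite leNgt; apply/negP => /(ducP _ _ x0 y0).
  by rewrite ltNge => /negP; apply; apply: le_trans (ler_norm _).
have dpos : 0 < `|x - y| by exact: lt_le_trans dxy.
have [d1 contra] : `|x - y| <= 1 /\ (2 * Bf + 6 * A + 2 + 2 * B * C) +
    (2 * A + 2 * C) * L < 5 / 64 * (L * b * `|x - y| `^ (b - alpha)).
  apply: LP => //; have := uB _ x0; have := uB _ y0; rewrite !ler_norml.
  move=> /andP[h3 h4] /andP[h5 h6]; move: Pxy; rewrite /Phi.
  by clear -h3 h4 h5 h6 M0; lra.
have uyx : 0 <= u x - u y by clear -uxy M0; lra.
have [xy|yx] := leP y x.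
- have dE : `|x - y| = x - y by rewrite ger0_norm// subr_ge0.
  have xE : y + (x - y) = x by ring.
  rewrite dE in dpos d1 contra dxy.
  apply: (@doubling_absurd _ _ alpha_gt1 alpha_lt2 mu ms ms_fin muE b bE u f
    L B Bf k y (x - y) delta xb yb) => //; rewrite ?xE//; first exact: deltaE.
  + by move=> x' y' h1 h2; have := pmax' _ _ h1 h2; rewrite /Phi dE.
  + by move=> x' y' h1 h2; have := nearM _ _ h1 h2; rewrite /Phi dE; clear; lra.
(* For x < y the argument is applied to -u and -f, with points and penalty centres exchanged. *)
- have dE : `|x - y| = y - x by rewrite distrC gtr0_norm// subr_gt0.
  have xE : x + (y - x) = y by ring.
  rewrite dE in dpos d1 contra dxy.
  apply: (@doubling_absurd _ _ alpha_gt1 alpha_lt2 mu ms ms_fin muE b bE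
    (fun t => - u t) (fun t => - f t)
    L B Bf k x (y - x) delta yb xb) => //; rewrite ?xE//; last 1 first.
  + by clear -uyx; lra.
  + by move=> t' h; rewrite normrN uB.
  + by move=> t' h; rewrite normrN fB.
  + exact: deltaE.
  + by move=> x' y' h1 h2; have := pmax' _ _ h2 h1; rewrite /Phi dE (distrC y'); clear; lra.
  + by move=> x' y' h1 h2; have := nearM _ _ h2 h1; rewrite /Phi dE (distrC y'); clear; lra.
Unshelve. all: by end_near. Qed.

(** * Approximate solutions on a grid *)

Section grid_jump.
Context (R : realType).
Notation TR := (measurableTypeR R).

Definition cell (h z : R) : nat := Num.truncn (`|z| / h).

(** Rounding is strictly away from 0 for z nonzero: a multiple of h moves out by a full step, so no
    nonzero jump is lost. As [Num.sg 0] is 0, the jump 0 stays 0. *)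
Definition grid_jump (h z : R) : R := Num.sg z * ((cell h z).+1%:R * h).

Definition grid (h : R) : set R := [set t | exists i : nat, t = i%:R * h].

Variable h : R.
Hypothesis h0 : 0 < h.

Lemma cell_le z : (cell h z)%:R * h <= `|z|.
Proof.
by rewrite -ler_pdivlMr// truncn_le// divr_ge0// ltW.
Qed.

Lemma cellS_gt z : `|z| < (cell h z).+1%:R * h.
Proof. by rewrite -ltr_pdivrMr// truncnS_gt. Qed.

Lemma cell_lt z (n : nat) : `|z| < n%:R * h -> (cell h z < n)%N.
Proof.
move=> zn; rewrite -(ltr_nat R) -(ltr_pM2r h0).
exact: le_lt_trans (cell_le z) zn.
Qed.

Lemma le_cell z (n : nat) : n%:R * h <= `|z| -> (n <= cell h z)%N.
Proof.
move=> nz; rewrite -ltnS -(ltr_nat R) -(ltr_pM2r h0).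
exact: le_lt_trans nz (cellS_gt z).
Qed.

Lemma normr_grid_jump z : z != 0 -> `|grid_jump h z| = (cell h z).+1%:R * h.
Proof.
move=> z0; rewrite /grid_jump normrM normr_sg z0 mul1r ger0_norm//.
by rewrite mulr_ge0// ltW.
Qed.

Lemma grid_jumpN z : grid_jump h (- z) = - grid_jump h z.
Proof. by rewrite /grid_jump /cell normrN sgrN mulNr. Qed.

Lemma grid_jump_pos z : 0 < z -> grid_jump h z = (cell h z).+1%:R * h.
Proof. by move=> z0; rewrite /grid_jump gtr0_sg// mul1r. Qed.

Lemma grid_jump_neg z : z < 0 -> grid_jump h z = - ((cell h z).+1%:R * h).
Proof. by move=> z0; rewrite /grid_jump ltr0_sg// mulN1r. Qed.

Lemma grid_jump_bounds z : 0 < z -> z <= grid_jump h z <= z + h.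
Proof.
move=> z0; rewrite grid_jump_pos//; have := cellS_gt z; have := cell_le z.
by rewrite gtr0_norm// -natr1 mulrDl mul1r => a1 /ltW ->; rewrite lerD2r.
Qed.

Lemma grid_jump_close z : `|grid_jump h z - z| <= h.
Proof.
have H t : 0 < t -> `|grid_jump h t - t| <= h.
  move=> t0; have /andP[t1 t2] := grid_jump_bounds t0.
  by rewrite ger0_norm ?subr_ge0// lerBlDl.
have [z0|z0|->] := ltgtP z 0; [|exact: H|].
  have := H (- z); rewrite oppr_gt0 grid_jumpN -opprD normrN; exact.
by rewrite /grid_jump sgr0 mul0r subrr normr0 ltW.
Qed.

(** Above the truncation theta h the rounding is comparable to the identity uniformly in h; this is
    the constant K = 1 + 1/theta of the limit argument. *)
Lemma grid_jump_scaled theta z : 0 < theta -> theta * h <= z ->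
  z <= grid_jump h z <= (1 + theta^-1) * z.
Proof.
move=> t0 tz; have z0 : 0 < z by apply: lt_le_trans tz; rewrite mulr_gt0.
have /andP[-> z2] /= := grid_jump_bounds z0; apply: le_trans z2 _.
by rewrite mulrDl mul1r lerD2l mulrC ler_pdivlMr// mulrC.
Qed.

Lemma grid_jump_lt z (n : nat) : z != 0 -> `|z| < n%:R * h ->
  `|grid_jump h z| <= n%:R * h.
Proof.
by move=> z0 zn; rewrite normr_grid_jump// ler_wpM2r ?(ltW h0)// ler_nat; exact: cell_lt.
Qed.

Lemma grid_jump_double z : z != 0 -> h <= `|z| -> `|grid_jump h z| <= 2 * `|z|.
Proof.
move=> z0 hz; rewrite normr_grid_jump// -natr1 mulrDl mul1r.
by have := cell_le z; lra.
Qed.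

(** Both ends of the window are multiples of h, so undoing the rounding, which moves by at most one
    cell, cannot cross them; only the strict end becomes closed. *)
Lemma grid_jump_window z (j n : nat) :
  - (j%:R * h) - n%:R * h <= grid_jump h z -> grid_jump h z < - (j%:R * h) ->
  - (j%:R * h) - n%:R * h <= z <= - (j%:R * h).
Proof.
move=> w1 w2; have z0 : z < 0.
  rewrite ltNge; apply/negP => z0; move: w2; rewrite ltNge => /negP; apply.
  apply: (@le_trans _ _ 0); first by rewrite oppr_le0 mulr_ge0// ltW.
  by rewrite /grid_jump mulr_ge0 ?mulr_ge0 ?(ltW h0)// sgr_ge0.
move: w1 w2; rewrite grid_jump_neg// ltrN2 -opprD lerN2 -mulrDl -natrD.
rewrite ler_pM2r// ltr_pM2r// ler_nat ltr_nat ltnS => c1 c2.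
have := cellS_gt z; have := cell_le z; rewrite ltr0_norm// => z1 z2.
apply/andP; split.
  rewrite lerNl; apply: (le_trans (ltW z2)).
  by rewrite ler_pM2r// ler_nat.
rewrite lerNr; apply: le_trans z1; by rewrite ler_pM2r// ler_nat.
Qed.

Lemma grid_ge0 t : grid h t -> 0 <= t.
Proof. by move=> [i ->]; rewrite mulr_ge0// ltW. Qed.

Lemma grid_jump_closed x z : grid h x -> grid h (x + eta x (grid_jump h z)).
Proof.
move=> [i ->]; rewrite /eta; case: ifP; last by move=> _; exists i; rewrite addr0.
have [z0 _|z0|z0 _] := ltgtP 0 z.
- by exists (i + (cell h z).+1)%N; rewrite grid_jump_pos// natrD mulrDl.
- rewrite grid_jump_neg// -mulrBl pmulr_lge0// subr_ge0 ler_nat => ci.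
  by exists (i - (cell h z).+1)%N; rewrite natrB// mulrBl.
- by exists i; rewrite /grid_jump -z0 sgr0 mul0r addr0.
Qed.

Lemma grid_lt_sub x y : grid h x -> grid h y -> y < x ->
  exists2 n : nat, x - y = n%:R * h & h <= x - y.
Proof.
move=> [i ->] [j ->]; rewrite ltr_pM2r// ltr_nat => ji.
exists (i - j)%N; rewrite -mulrBl -natrB ?(ltnW ji)//.
by rewrite ler_peMl ?(ltW h0)// ler1n subn_gt0.
Qed.

(* The jumps take countably many values, so composition with an arbitrary
   function is measurable. *)
Lemma measurable_grid_jump_comp (g : R -> R) :
  measurable_fun setT (fun z : TR => g (grid_jump h z)).
Proof.
move=> _ Y mY; rewrite setTI.
pose s (i : nat) (c : R) : set TR :=
  [set z | Num.sg z = c] `&` [set z | cell h z = i].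
have ms i c : measurable (s i c).
  apply: measurableI.
    rewrite (_ : [set _ | _] = (if 1 == c then `]0, +oo[%classic else set0) `|`
       ((if 0 == c then [set 0] else set0) `|`
        (if -1 == c then `]-oo, 0[%classic else set0))).
      apply: measurableU; first by case: ifP => // _; exact: measurable_itv.
      apply: measurableU; first by case: ifP => // _; exact: measurable_set1.
      by case: ifP => // _; exact: measurable_itv.
    apply/seteqP; split => z /=.
      move=> <-; have [z0|z0|z0] := ltgtP 0 z.
      - by left; rewrite gtr0_sg// eqxx/= in_itv/= z0.
      - by right; right; rewrite ltr0_sg// eqxx/= in_itv/=.
      - by right; left; rewrite -z0 sgr0 eqxx.
    move=> [|[|]]; case: eqP => //= <-; rewrite ?in_itv/= ?andbT.
    - by move/gtr0_sg.
    - by move=> ->; rewrite sgr0.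
    - by move/ltr0_sg.
  rewrite (_ : [set _ | _] = (fun z : TR => `|z|) @^-1` `[i%:R * h, i.+1%:R * h[).
    by rewrite -[X in measurable X]setTI; apply: (@normr_measurable R setT).
  apply/seteqP; split => z /=; rewrite in_itv/=.
    by move=> <-; rewrite cell_le cellS_gt.
  by move=> /andP[/le_cell z1 /cell_lt]; rewrite ltnS => z2; apply/eqP; rewrite eqn_leq z1 z2.
pose val (c : R) (i : nat) := g (c * (i.+1%:R * h)).
pose piece (c : R) := \bigcup_(i in [set i | Y (val c i)]) s i c.
have mp c : measurable (piece c).
  by apply: bigcup_measurable => i _; exact: ms.
rewrite (_ : _ @^-1` _ = piece 1 `|` (piece 0 `|` piece (-1))).
  by apply: measurableU => //; exact: measurableU.
have HP c z : piece c z <-> Num.sg z = c /\ Y (g (grid_jump h z)).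
  split; first by move=> [i /= Yi [/= sz ci]]; split => //; rewrite /grid_jump sz ci.
  by move=> [sz Yz]; exists (cell h z) => //=; rewrite /val -sz.
apply/seteqP; split => z /=.
  move=> Yz; have [z0|z0|z0] := ltgtP 0 z.
  - by left; apply/HP; rewrite gtr0_sg.
  - by right; right; apply/HP; rewrite ltr0_sg.
  - by right; left; apply/HP; split => //; rewrite -z0 sgr0.
by move=> [|[|]] /HP[].
Qed.

End grid_jump.

(** * Picard iteration for the truncated equation *)

Section approximate_solutions.
Context (R : realType) (alpha : R).
Hypotheses (alpha_gt1 : 1 < alpha) (alpha_lt2 : alpha < 2).
Notation TR := (measurableTypeR R).
Variables mu ms : {measure set (measurableTypeR R) -> \bar R}.
Hypothesis ms_fin : (\int[ms]_(z in [set~ 0%R])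
  (Num.min 1 (`|z| `^ (alpha - 1)))%:E < +oo)%E.
Hypothesis muE : forall A : set TR, measurable A ->
  (mu A = mu_star alpha A + ms A)%E.

Lemma normr_Rintegral_le (r M : R) (S : set TR) (g : TR -> R) :
  0 < r -> measurable S -> S `<=` far r -> measurable_fun S g ->
  (forall z, S z -> `|g z| <= M) ->
  `|\int[mu]_(z in S) g z| <= M * fine (mu S).
Proof.
move=> r0 mS Sr mg gM.
have ig := mu_integrable alpha_gt1 ms_fin muE r0 mS Sr mg gM.
have fS := sub_far_fin (mu_far_fin alpha_gt1 ms_fin muE r0) mS Sr.
apply: le_trans (le_normr_Rintegral mS ig) _.
rewrite -Rintegral_cst//; apply: le_Rintegral => //.
  apply: (@mu_integrable _ _ alpha_gt1 mu ms ms_fin muE r _ _ M) => //.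
    exact: measurableT_comp.
  by move=> z /gM; rewrite normr_id.
apply: (@mu_integrable _ _ alpha_gt1 mu ms ms_fin muE r _ _ `|M|) => //.
Qed.

Variables (r : R) (zeta : TR -> R).
Hypothesis r0 : 0 < r.
Hypothesis zeta_comp : forall g : R -> R, measurable_fun setT (fun z => g (zeta z)).

Let Lam := fine (mu (far r)).

Let Lam0 : 0 <= Lam. Proof. exact: fine_ge0. Qed.

Let mjump (u : R -> R) x :
  measurable_fun (far r) (fun z : TR => u (x + eta x (zeta z))).
Proof.
by apply: measurable_funTS; exact: (zeta_comp (fun w => u (x + eta x w))).
Qed.

Definition picard (F u : R -> R) : R -> R := fun x =>
  (F x + \int[mu]_(z in far r) u (x + eta x (zeta z))) / (1 + Lam).

(** With Lam = mu([far r]) finite, the equation reads (1 + Lam) u = F plus the integral of u after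
    the jump, a contraction of ratio Lam / (1 + Lam) that preserves the bound B. No limit is taken:
    the residual of an iterate is (1 + Lam) times the next increment, which is small for large n. *)
Lemma approximate_solution (F : R -> R) (B e : R) : 0 < e ->
  (forall x, `|F x| <= B) ->
  exists2 u : R -> R, (forall x, `|u x| <= B) &
    forall x, `|u x - \int[mu]_(z in far r) (u (x + eta x (zeta z)) - u x)
               - F x| <= e.
Proof.
move=> e0 FB.
have B0 : 0 <= B by apply: le_trans (FB 0).
have L1 : 0 < 1 + Lam by rewrite ltr_wpDr.
have mF := @measurable_far R r.
have FF : far r `<=` far r by [].
pose u n := iter n (picard F) (fun=> 0).
have uB n x : `|u n x| <= B.
  elim: n x => [|n IH] x; first by rewrite /= normr0.
  rewrite /u /= -/(u n) /picard normrM normfV (gtr0_norm L1) ler_pdivrMr//.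
  apply: le_trans (ler_normD _ _) _; rewrite mulrDr mulr1; apply: lerD => //.
  exact: (normr_Rintegral_le r0 mF FF (mjump _ _)).
pose q := Lam / (1 + Lam).
have q0 : 0 <= q by rewrite divr_ge0// ltW.
have q1 : q < 1 by rewrite /q ltr_pdivrMr// mul1r ltrDr.
have iu n x : mu.-integrable (far r) (EFin \o (fun z => u n (x + eta x (zeta z)))).
  exact: (@mu_integrable _ _ alpha_gt1 mu ms ms_fin muE r _ _ B).
have du n x : `|u n.+1 x - u n x| <= q ^+ n * B.
  elim: n x => [|n IH] x; first by rewrite /= subr0 mul1r; exact: (uB 1%N).
  have -> : u n.+2 x - u n.+1 x =
     (\int[mu]_(z in far r) (u n.+1 (x + eta x (zeta z)) - u n (x + eta x (zeta z)))) / (1 + Lam).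
    have e1 m : u m.+1 x = picard F (u m) x by [].
    by rewrite (e1 n.+1) (e1 n) RintegralB// /picard; field; rewrite gt_eqF.
  rewrite normrM normfV (gtr0_norm L1) ler_pdivrMr//.
  have := @normr_Rintegral_le r (q ^+ n * B) (far r)
    (fun z => u n.+1 (x + eta x (zeta z)) - u n (x + eta x (zeta z))) r0 mF FF.
  move=> /(_ (measurable_funB (mjump _ _) (mjump _ _)) (fun z _ => IH _)) h.
  apply: le_trans h _; rewrite -/Lam exprS /q le_eqVlt; apply/orP; left; apply/eqP.
  by field; rewrite gt_eqF.
have [n nP] : exists n, (1 + Lam) * (q ^+ n * B) <= e.
  have : (1 + Lam) * (q ^+ n * B) @[n --> \oo] --> (1 + Lam) * (0 * B).
    apply: cvgM; first exact: cvg_cst.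
    apply: cvgM; last exact: cvg_cst.
    by apply: cvg_expr; rewrite ger0_norm.
  rewrite mul0r mulr0 => /cvgrPdist_le /(_ e e0) [N _ NP].
  exists N; have := NP N (leqnn N).
  by rewrite sub0r normrN; apply: le_trans; exact: ler_norm.
exists (u n) => // x; apply: le_trans nP.
have -> : u n x - \int[mu]_(z in far r) (u n (x + eta x (zeta z)) - u n x) - F x =
   - ((1 + Lam) * (u n.+1 x - u n x)).
  rewrite RintegralB//; last first.
    exact: (@mu_integrable _ _ alpha_gt1 mu ms ms_fin muE r _ _ `|u n x|).
  rewrite Rintegral_cst// -/Lam.
  have -> : u n.+1 x = picard F (u n) x by [].
  by rewrite /picard; field; rewrite gt_eqF.
by rewrite normrN normrM (gtr0_norm L1) ler_pM2l.
Qed.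

End approximate_solutions.

(** Distinct grid points are at least h apart, so truncating at r is admissible for every such d.
    There is neither an inner operator nor a boundary condition, hence no term in [levy_cst]: the
    constant 2 is the two residuals 1/2 plus 2 k mu([far r]) <= 1, and 2 B bounds the difference of
    F. *)
Lemma grid_doubling_absurd (R : realType) (alpha b : R)
    (mu ms : {measure set (measurableTypeR R) -> \bar R})
    (u F : R -> R) (L B h k y d r : R) :
  1 < alpha -> alpha < 2 ->
  (\int[ms]_(z in [set~ 0%R])
    (Num.min 1 (`|z| `^ (alpha - 1)))%:E < +oo)%E ->
  (forall A : set (measurableTypeR R), measurable A ->
    (mu A = mu_star alpha A + ms A)%E) ->
  1 - b = 7 / 8 * (2 - alpha) ->
  0 < h -> 0 < r -> r <= h -> r `^ (2 - alpha) <= h `^ (2 - alpha) / 4 ->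
  (forall x, `|u x| <= B) -> (forall x, `|F x| <= B) ->
  (forall x, `|u x - \int[mu]_(z in far r) (u (x + eta x (grid_jump h z)) - u x)
               - F x| <= 1 / 2) ->
  0 < L -> 0 < k -> k * fine (mu (far r)) <= 1 / 2 -> 0 < d ->
  grid h y -> grid h (y + d) ->
  (forall x' y', grid h x' -> grid h y' ->
    u x' - u y' <= u (y + d) - u y + L * (`|x' - y'| `^ b - d `^ b) + k) ->
  0 <= u (y + d) - u y ->
  2 * B + 2 + 2 * B * Csharp alpha ms + 2 * Csharp alpha ms * L <
    5 / 64 * (L * b * d `^ (b - alpha)) -> False.
Proof.
move=> a1 a2 ms_fin muE bE h0 r0 rh rh2 uB FB eq L0 k0 kLam d0 Gy Gx near_max pos contra.
have yx : y < y + d by rewrite ltrDl.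
have [n dE hd] := grid_lt_sub h0 Gx Gy yx.
rewrite (_ : y + d - y = d) in dE hd; last by ring.
have [j yE] := Gy.
have a20 : 0 < 2 - alpha by rewrite subr_gt0.
have rd : r `^ (2 - alpha) <= d `^ (2 - alpha) / 4.
  apply: (le_trans rh2); rewrite ler_wpM2r ?invr_ge0//.
  by apply: ge0_ler_powR; rewrite ?nnegrE ?(ltW a20) ?(ltW h0) ?(ltW d0).
have zn z : far r z -> z != 0 by exact: far_ne0.
have := @coupling_estimate _ _ a1 a2 mu ms ms_fin muE b bE L k B d y r u
  (grid h) (grid_jump h) (ltW L0) (ltW k0) d0 (grid_ge0 h0 Gy) r0 rd Gx Gy
  (fun t _ => uB t) near_max.
have j0 (z : measurableTypeR R) : far r z ->
    grid h (y + d + eta (y + d) (grid_jump h z)) /\ grid h (y + eta y (grid_jump h z)).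
  by move=> _; split; exact: grid_jump_closed.
have j1 (z : R) : r <= z -> z <= grid_jump h z.
  move=> rz; have z0 : 0 < z by exact: lt_le_trans rz.
  by have /andP[] := grid_jump_bounds h0 z0.
have j2 (z : measurableTypeR R) : far r z -> `|z| < d -> `|grid_jump h z| <= d.
  by move=> /zn z0; rewrite dE; exact: grid_jump_lt.
have j3 (z : measurableTypeR R) : far r z -> d <= `|z| -> `|grid_jump h z| <= 2 * `|z|.
  by move=> /zn z0 dz; apply: grid_jump_double => //; exact: le_trans dz.
have j4 (z : measurableTypeR R) : far r z -> - y - d <= grid_jump h z ->
    grid_jump h z < - y -> - y - d <= z <= - y.
  by move=> _; rewrite yE dE; exact: grid_jump_window.
move=> /(_ j0 j1 j2 j3 j4).
have mg x : measurable_fun setT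
    (fun z : measurableTypeR R => u (x + eta x (grid_jump h z))).
  exact: (measurable_grid_jump_comp h0 (fun w => u (x + eta x w))).
move=> /(_ (mg _) (mg _)).
have := eq (y + d); have := eq y.
set Iy := \int[mu]_(z in far r) (u (y + _) - u y).
set Ix := \int[mu]_(z in far r) (u (y + d + _) - u (y + d)).
rewrite !ler_norml => /andP[e1 e2] /andP[e3 e4].
have := FB (y + d); have := FB y; rewrite !ler_norml => /andP[f1 f2] /andP[f3 f4].
move: contra kLam pos e1 e2 e3 e4 f1 f2 f3 f4.
set Lm := fine _; set w := d `^ _; set C := Csharp _ _.
move: (Ix) (Iy) (u (y + d)) (u y) (F (y + d)) (F y); clear.
move=> Ix Iy ux uy Fx Fy; lra.
Qed.

(** No continuity of u is assumed: the mesh bounds the distance from below, and since the equation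
    holds at every point a pair within k of the supremum is enough. The mesh h does not enter the
    condition on L. *)
Lemma grid_holder (R : realType) (alpha b : R)
    (mu ms : {measure set (measurableTypeR R) -> \bar R})
    (u F : R -> R) (L B h r : R) :
  1 < alpha -> alpha < 2 ->
  (\int[ms]_(z in [set~ 0%R])
    (Num.min 1 (`|z| `^ (alpha - 1)))%:E < +oo)%E ->
  (forall A : set (measurableTypeR R), measurable A ->
    (mu A = mu_star alpha A + ms A)%E) ->
  1 - b = 7 / 8 * (2 - alpha) ->
  0 < h -> 0 < r -> r <= h -> r `^ (2 - alpha) <= h `^ (2 - alpha) / 4 ->
  (forall x, `|u x| <= B) -> (forall x, `|F x| <= B) ->
  (forall x, `|u x - \int[mu]_(z in far r) (u (x + eta x (grid_jump h z)) - u x)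
               - F x| <= 1 / 2) ->
  0 < L ->
  (forall d, 0 < d -> L * d `^ b <= 2 * B ->
    d <= 1 /\ (2 * B + 2 + 2 * B * Csharp alpha ms) + 2 * Csharp alpha ms * L <
     5 / 64 * (L * b * d `^ (b - alpha))) ->
  forall x y, grid h x -> grid h y -> u x - u y <= L * `|x - y| `^ b.
Proof.
move=> a1 a2 ms_fin muE bE h0 r0 rh rh2 uB FB eq L0 LP.
pose Phi x' y' := u x' - u y' - L * `|x' - y'| `^ b.
suff key : forall x' y', grid h x' -> grid h y' -> Phi x' y' <= 0.
  by move=> x y Gx Gy; have := key _ _ Gx Gy; rewrite /Phi subr_le0.
apply: contrapT => /existsNP[x1] /existsNP[y1].
move=> /not_implyP[x10] /not_implyP[y10] /negP; rewrite -ltNge => P0.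
pose E := [set t | exists x' y', [/\ grid h x', grid h y' & t = Phi x' y']].
have B0 : 0 <= B by apply: le_trans (uB 0).
have PhiB x' y' : Phi x' y' <= 2 * B.
  have := uB x'; have := uB y'; rewrite !ler_norml.
  move=> /andP[h3 h4] /andP[h5 h6].
  have : 0 <= L * `|x' - y'| `^ b by rewrite mulr_ge0 ?powR_ge0 ?ltW.
  by rewrite /Phi; clear -h3 h4 h5 h6; lra.
have Esup : has_sup E.
  split; first by exists (Phi x1 y1); exists x1, y1.
  by exists (2 * B) => t [x' [y' [h1 h2 ->]]]; exact: PhiB.
pose M := sup E.
have PhiM x' y' : grid h x' -> grid h y' -> Phi x' y' <= M.
  by move=> h1 h2; apply: sup_upper_bound => //; exists x', y'.
have M0 : 0 < M by apply: lt_le_trans P0 _; exact: PhiM.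
pose Lam := fine (mu (far r)).
have Lam0 : 0 <= Lam by apply: fine_ge0.
have L1 : 0 < 2 * (Lam + 1) by rewrite mulr_gt0// ltr_wpDl.
pose k := Num.min (2 * (Lam + 1))^-1 (M / 2).
have k0 : 0 < k by rewrite lt_min invr_gt0 L1 divr_gt0.
have kLam : k * Lam <= 1 / 2.
  have : k <= (2 * (Lam + 1))^-1 by rewrite /k ge_min lexx.
  rewrite -[_^-1]mul1r ler_pdivlMr// => hk; clear -hk k0; lra.
have kM : k <= M / 2 by rewrite /k ge_min lexx orbT.
have [t [x [y [Gx Gy ->]]] tM] := sup_adherent k0 Esup.
have Phixy : M - k < Phi x y by [].
have Phi0 : 0 < Phi x y by clear -Phixy kM M0; lra.
have psi0 : 0 <= L * `|x - y| `^ b by rewrite mulr_ge0 ?powR_ge0 ?ltW.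
have uxy : 0 < u x - u y by move: Phi0; rewrite /Phi; clear -psi0; lra.
have xny : x != y by apply: contraTneq uxy => ->; rewrite subrr ltxx.
have dpos : 0 < `|x - y| by rewrite normr_gt0 subr_eq0.
have nearM x' y' : grid h x' -> grid h y' -> Phi x' y' <= Phi x y + k.
  by move=> h1 h2; have := PhiM _ _ h1 h2; clear -Phixy; rewrite -/M; lra.
have [_ contra] : `|x - y| <= 1 /\
   (2 * B + 2 + 2 * B * Csharp alpha ms) + 2 * Csharp alpha ms * L <
     5 / 64 * (L * b * `|x - y| `^ (b - alpha)).
  apply: LP => //; have := uB x; have := uB y; rewrite !ler_norml.
  move=> /andP[h3 h4] /andP[h5 h6]; move: Phi0; rewrite /Phi.
  by clear -h3 h4 h5 h6; lra.
have [xy|yx] := leP y x.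
- have dE : `|x - y| = x - y by rewrite ger0_norm// subr_ge0.
  have xE : y + (x - y) = x by ring.
  rewrite dE in dpos contra.
  apply: (@grid_doubling_absurd _ _ _ mu ms u F L B h k y (x - y) r a1 a2 ms_fin muE bE) => //;
    rewrite ?xE//; last exact: ltW.
  by move=> x' y' h1 h2; have := nearM _ _ h1 h2; rewrite /Phi dE; clear; lra.
(* For x < y the argument is applied to -u and -F. *)
- have dE : `|x - y| = y - x by rewrite distrC gtr0_norm// subr_gt0.
  have xE : x + (y - x) = y by ring.
  rewrite dE in dpos contra.
  apply: (@grid_doubling_absurd _ _ _ mu ms (fun t => - u t) (fun t => - F t)
    L B h k x (y - x) r a1 a2 ms_fin muE bE) => //; rewrite ?xE//.
  + by move=> s; rewrite normrN uB.
  + by move=> s; rewrite normrN FB.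
  + move=> s; apply: le_trans (eq s); rewrite -[leRHS]normrN.
    rewrite (_ : \int[mu]_(z in far r) (- u (s + eta s (grid_jump h z)) - - u s) =
      - \int[mu]_(z in far r) (u (s + eta s (grid_jump h z)) - u s)).
      by rewrite le_eqVlt; apply/orP; left; apply/eqP; congr (`|_|); ring.
    have mF := @measurable_far R r.
    transitivity (\int[mu]_(z in far r) (-1 * (u (s + eta s (grid_jump h z)) - u s))).
      by apply: eq_Rintegral => z _; ring.
    rewrite RintegralZl ?mulN1r//.
    apply: (@mu_integrable _ _ a1 mu ms ms_fin muE r _ _ (B + B)) => //.
      apply: measurable_funTS.
      exact: (measurable_grid_jump_comp h0 (fun w => u (s + eta s w) - u s)).
    by move=> z _; apply: le_trans (ler_normB _ _) _; apply: lerD.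
  + by move=> x' y' h1 h2; have := nearM _ _ h2 h1; rewrite /Phi dE (distrC y'); clear; lra.
  + by clear -uxy; lra.
Qed.

(** * Passage to the limit *)

Section asymptotic_ascoli.
Context (R : realType).

(* The pointwise limit is taken along one ultrafilter on the indices, so that
   no diagonal extraction is needed; an actual subsequence is only chosen after
   the convergence is known to be locally uniform. *)
Lemma ultrafilter_limit (v : nat -> R -> R) (B : R) :
  (forall n x, `|v n x| <= B) ->
  exists (U : set_system nat) (u : R -> R), [/\ ProperFilter U, \oo `<=` U,
    (forall x, `|u x| <= B) &
    forall x e, 0 < e -> U [set n | `|v n x - u x| < e]].
Proof.
move=> vB; have [U [UU ooU]] := @ultraFilterLemma nat \oo _.
have PU : ProperFilter U by exact: ultra_proper.
have H x : exists p : R, `|p| <= B /\ forall e, 0 < e -> U [set n | `|v n x - p| < e].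
  have cB : compact (`[- B, B]%classic : set R) by exact: segment_compact.
  have [|p [pB pcl]] := cB (fmap (fun n => v n x) U) _.
    rewrite /fmap/=; apply: (filterS _ (@filterT _ U _)) => n _ /=.
    by rewrite in_itv/=; have := vB n x; rewrite ler_norml.
  exists p; split; first by move: pB; rewrite /= in_itv/= ler_norml.
  move=> e e0; have [//|UC] := in_ultra_setVsetC [set n | `|v n x - p| < e] UU.
  have nb : nbhs p (ball p e) by exact: nbhsx_ballx.
  have Gc : fmap (fun n => v n x) U [set y | ~ (`|y - p| < e)] by [].
  have [y [yn yb]] := pcl _ _ Gc nb.
  by exfalso; apply: yn; move: yb; rewrite /ball/= distrC.
have [u uP] := choice H.
by exists U, u; split => // x; [case: (uP x)|case: (uP x)].
Qed.

Variables (v : nat -> R -> R) (eps : nat -> R) (L B b : R).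
Hypotheses (b0 : 0 < b) (L0 : 0 < L) (vB : forall n x, `|v n x| <= B).
Hypothesis eps_cvg : forall e, 0 < e -> \forall n \near \oo, 0 <= eps n <= e.
Hypothesis v_holder : forall n x y, 0 <= x -> 0 <= y ->
  `|v n x - v n y| <= L * (`|x - y| + eps n) `^ b.

Let modulus (e : R) : 0 < e -> exists2 t, 0 < t & forall s, 0 <= s -> s <= 2 * t ->
  L * s `^ b <= e.
Proof.
move=> e0; have eL : 0 < e / L by rewrite divr_gt0.
have q0 : 0 < (e / L) `^ b^-1 by exact: powR_gt0.
exists ((e / L) `^ b^-1 / 2); first by rewrite divr_gt0.
move=> s s0; rewrite mulrCA divff// mulr1 => sq.
rewrite mulrC -ler_pdivlMr//.
have eE : ((e / L) `^ b^-1) `^ b = e / L.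
  by rewrite -powRrM mulVf ?gt_eqF// powRr1// ltW.
by rewrite -[leRHS]eE; apply: ge0_ler_powR; rewrite ?nnegrE ?(ltW b0) ?(ltW q0).
Qed.

(** The defect eps allows for step functions. On [0, k] finitely many nodes with spacing t are
    enough: some index n >= k is close to the limit at all of them, and the moduli of v_n and u
    cover the gaps, each of the three errors being at most e / 3. Large indices are available
    because the ultrafilter contains all tails. *)
Lemma asymptotic_ascoli : exists (u : R -> R) (s : nat -> nat),
  [/\ forall x, `|u x| <= B,
      forall x y, 0 <= x -> 0 <= y -> `|u x - u y| <= L * `|x - y| `^ b,
      forall k, (k <= s k)%N &
      forall k x, 0 <= x -> x <= k%:R -> `|v (s k) x - u x| <= k.+1%:R^-1].
Proof.
have [U [u [PU ooU uB uU]]] := ultrafilter_limit vB.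
have Ueps e : 0 < e -> U [set n | 0 <= eps n <= e].
  by move=> /eps_cvg; exact: ooU.
have uh x y : 0 <= x -> 0 <= y -> `|u x - u y| <= L * `|x - y| `^ b.
  move=> x0 y0; have [->|xy] := eqVneq x y.
    by rewrite !subrr normr0 powR0 ?mulr0// gt_eqF.
  have dp : 0 < `|x - y| by rewrite normr_gt0 subr_eq0.
  apply/ler_addgt0Pr => e e0.
  have e4 : 0 < e / 4 by rewrite divr_gt0.
  have cH : L * s `^ b @[s --> `|x - y|] --> L * `|x - y| `^ b.
    apply: cvgM; first exact: cvg_cst.
    exact: powR_continuous_at.
  have [t /= t0 tP] := (cvgrPdist_le _ _).1 cH _ e4.
  have t2 : 0 < t / 2 by rewrite divr_gt0.
  have [n [n1 [n2 n3]]] : [set n | `|v n x - u x| < e / 4] `&`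
      ([set n | `|v n y - u y| < e / 4] `&` [set n | 0 <= eps n <= t / 2]) !=set0.
    apply: (@filter_ex _ U PU); apply: filterI; first exact: (uU _ _ e4).
    by apply: filterI; [exact: (uU _ _ e4)|exact: (Ueps _ t2)].
  have := v_holder n x0 y0; have := tP (`|x - y| + eps n).
  move: n3 => /= /andP[n3 n4].
  rewrite /= opprD addrA subrr sub0r normrN ger0_norm// => /(_ (le_lt_trans n4 _)).
  rewrite ltr_pdivrMr// ltr_pMr// ltr1n => /(_ isT).
  move: n1 n2 => /=; rewrite !ltr_norml !ler_norml => /andP[a1 a2] /andP[a3 a4].
  move=> /andP[a5 a6] /andP[a7 a8].
  by apply/andP; split; lra.
have unif k : exists n, (k <= n)%N /\
    forall x, 0 <= x -> x <= k%:R -> `|v n x - u x| <= k.+1%:R^-1.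
  set e := k.+1%:R^-1; have e0 : 0 < e by rewrite /e invr_gt0 ltr0n.
  have e3 : 0 < e / 3 by rewrite divr_gt0.
  have [t t0 tP] := modulus e3.
  pose P := (Num.truncn (k%:R / t)).+1.
  have UP (m : nat) : U [set n | forall i, (i < m)%N -> `|v n (i%:R * t) - u (i%:R * t)| < e / 3].
    elim: m => [|m IH]; first by apply: (filterS _ (@filterT _ U _)).
    apply: filterS (filterI IH (uU (m%:R * t) _ e3)) => n [/= n1 n2] i.
    by rewrite ltnS leq_eqVlt => /predU1P[->|/n1].
  have [n [n1 [n2 n3]]] : [set n | forall i, (i < P)%N -> `|v n (i%:R * t) - u (i%:R * t)| < e / 3]
      `&` ([set n | 0 <= eps n <= t] `&` [set n | (k <= n)%N]) !=set0.
    apply: (@filter_ex _ U PU); apply: filterI; first exact: UP.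
    apply: filterI; first exact: Ueps.
    by apply: ooU; exact: nbhs_infty_ge.
  exists n; split => // x x0 xk.
  pose i := Num.truncn (x / t).
  have xt0 : 0 <= x / t by rewrite divr_ge0// ltW.
  have iP : (i < P)%N.
    by rewrite /i /P ltnS; apply: le_truncn; rewrite ler_wpM2r// invr_ge0 ltW.
  have i1 : i%:R * t <= x by rewrite -ler_pdivlMr// truncn_le.
  have i2 : x < i.+1%:R * t by rewrite -ltr_pdivrMr// truncnS_gt.
  have it0 : 0 <= i%:R * t by rewrite mulr_ge0// ltW.
  have d1 : 0 <= x - i%:R * t by rewrite subr_ge0.
  have d2 : x - i%:R * t <= t by move: i2; rewrite -natr1 mulrDl mul1r; lra.
  have h1 := v_holder n x0 it0; have h2 := uh _ _ x0 it0; have h3 := n1 _ iP.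
  move: n2 => /= /andP[en0 en1].
  have h4 : L * (`|x - i%:R * t| + eps n) `^ b <= e / 3.
    by apply: tP; rewrite ?addr_ge0// ger0_norm//; lra.
  have h5 : L * `|x - i%:R * t| `^ b <= e / 3.
    by apply: tP; rewrite ?normr_ge0// ger0_norm//; lra.
  move: h1 h2 h3 h4 h5; rewrite !ler_norml ltr_norml.
  set p1 := L * _ `^ _; set p2 := L * _ `^ _.
  by move=> /andP[a1 a2] /andP[a3 a4] /andP[a5 a6] a7 a8; apply/andP; split; lra.
have [s sP] := choice unif.
exists u, s; split => // k; first by case: (sP k).
by move=> x; case: (sP k) => _; apply.
Qed.

End asymptotic_ascoli.

Lemma C2D (R : realType) (f g : R -> R) : C2 f -> C2 g ->
  C2 (fun t => f t + g t) /\
  derive1 (fun t => f t + g t) = fun t => derive1 f t + derive1 g t.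
Proof.
move=> [f1 f2 f3] [g1 g2 g3].
have e1 : derive1 (fun t => f t + g t) = fun t => derive1 f t + derive1 g t.
  by apply/funext => t; rewrite !derive1E deriveD.
split; last exact: e1.
split.
- by move=> t; exact: derivableD.
- by rewrite e1 => t; exact: derivableD.
- have e2 : derive1 (fun t => derive1 f t + derive1 g t) =
      fun t => derive1 (derive1 f) t + derive1 (derive1 g) t.
    by apply/funext => t; rewrite !derive1E deriveD.
  by rewrite e1 e2 => t; apply: cvgD; [exact: f3|exact: g3].
Qed.

Lemma finite_argmax (R : realType) (P : pred nat) (f : nat -> R) (n i0 : nat) :
  (i0 < n)%N -> P i0 -> exists i, [/\ (i < n)%N, P i &
    forall j, (j < n)%N -> P j -> f j <= f i].
Proof.
move=> i0n Pi0.
pose a := [arg max_(i > Ordinal i0n | P i) f i]%O.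
exists a; rewrite /a; case: Order.TotalTheory.arg_maxP => //= i Pi H; split => // j jn Pj.
exact: (H (Ordinal jn) Pj).
Qed.

(** * Discrete maxima near a test point *)

Section stability.
Context (R : realType) (alpha : R).
Hypotheses (alpha_gt1 : 1 < alpha) (alpha_lt2 : alpha < 2).
Notation TR := (measurableTypeR R).
Variables mu ms : {measure set (measurableTypeR R) -> \bar R}.
Hypothesis ms_fin : (\int[ms]_(z in [set~ 0%R])
  (Num.min 1 (`|z| `^ (alpha - 1)))%:E < +oo)%E.
Hypothesis muE : forall A : set TR, measurable A ->
  (mu A = mu_star alpha A + ms A)%E.
Notation mstar := (@mu_star R alpha).

Variables (theta B : R) (h : nat -> R) (w : nat -> R -> R) (u F : R -> R).
Hypothesis theta0 : 0 < theta.
Hypotheses (h0 : forall k, 0 < h k) (h_le : forall k, h k <= k.+1%:R^-1).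
Hypotheses (wB : forall k x, `|w k x| <= B) (uB : forall x, `|u x| <= B).
Hypothesis FB : forall x, `|F x| <= B.
Hypothesis cF : continuous F.
Hypothesis cu : continuous (clamp u).
Hypothesis w_u : forall k x, grid (h k) x -> x <= k%:R ->
  `|w k x - u x| <= k.+1%:R^-1.
Notation r k := (theta * h k).
Notation zeta k := (grid_jump (h k)).
Hypothesis w_eq : forall k x,
  `|w k x - \int[mu]_(z in far (r k)) (w k (x + eta x (zeta k z)) - w k x)
    - F x| <= k.+1%:R^-1.

Let inv_cvg : (fun k => k.+1%:R^-1 : R) @ \oo --> 0.
Proof. exact: cvg_harmonic. Qed.

Let h_cvg : h @ \oo --> 0.
Proof.
apply: (@squeeze_cvgr _ _ _ _ (fun=> 0) (fun k => k.+1%:R^-1 : R)) => //.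
- by apply: nearW => k; rewrite h_le ltW.
- exact: cvg_cst.
Qed.

Let grid_floor k x : 0 <= x -> grid (h k) ((cell (h k) x)%:R * h k) /\
  `|(cell (h k) x)%:R * h k - x| <= h k.
Proof.
move=> x0; split; first by exists (cell (h k) x).
have := cell_le (h0 k) x; have := cellS_gt (h0 k) x; rewrite ger0_norm//.
rewrite -natr1 mulrDl mul1r => a1 a2.
by rewrite distrC ger0_norm ?subr_ge0//; lra.
Qed.

Lemma grid_argmax (g : nat -> R -> R) (x0 rho : R) : 0 <= x0 -> 0 < rho ->
  exists x : nat -> R, forall k, grid (h k) (x k) /\ (h k <= rho ->
    `|x k - x0| <= rho /\ forall y, grid (h k) y -> `|y - x0| <= rho ->
      g k y <= g k (x k)).
Proof.
move=> x00 rho0.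
suff H k : exists x, grid (h k) x /\ (h k <= rho ->
    `|x - x0| <= rho /\ forall y, grid (h k) y -> `|y - x0| <= rho ->
      g k y <= g k x).
  by have [x xP] := choice H; exists x.
have [hk|hk] := leP (h k) rho; last first.
  exists 0; split; first by exists 0%N; rewrite mul0r.
  by [].
pose P i := `|i%:R * h k - x0| <= rho.
pose n := (Num.truncn ((x0 + rho) / h k)).+1.
have Pn i : P i -> (i < n)%N.
  rewrite /P ler_norml => /andP[_ i1].
  have i2 : i%:R * h k <= x0 + rho by lra.
  rewrite /n -(ltr_nat R) -(ltr_pM2r (h0 k)); apply: le_lt_trans i2 _.
  by rewrite -ltr_pdivrMr// truncnS_gt.
have [_ g1] := grid_floor k x00.
have P0 : P (cell (h k) x0) by exact: le_trans g1 hk.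
have [i [_ Pi H]] := finite_argmax (fun i => g k (i%:R * h k)) (Pn _ P0) P0.
exists (i%:R * h k); split; first by exists i.
move=> _; split => // _ [j ->] Pj.
by apply: H => //; exact: Pn.
Qed.

(** Adding (y - x0)^2 makes the maximum at x0 strict, which forces the discrete maxima towards x0;
    the perturbation changes neither the value nor the slope of phi at x0. *)
Lemma approximating_maxima (phi : R -> R) (x0 delta : R) : continuous phi ->
  0 <= x0 -> 0 < delta ->
  (forall y, nbhd_half_line x0 delta y -> u y - phi y <= u x0 - phi x0) ->
  exists x : nat -> R, [/\ forall k, grid (h k) (x k), x @ \oo --> x0 &
    \forall k \near \oo, forall y, grid (h k) y -> `|y - x0| <= delta / 2 ->
      w k y - (phi y + (y - x0) ^+ 2) <=
      w k (x k) - (phi (x k) + (x k - x0) ^+ 2)].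
Proof.
move=> cphi x00 d0 umax; set rho := delta / 2.
have rho0 : 0 < rho by rewrite divr_gt0.
have [x xP] := @grid_argmax (fun k y => w k y - (phi y + (y - x0) ^+ 2)) x0 rho x00 rho0.
have hrho : \forall k \near \oo, h k <= rho.
  near=> k; apply: le_trans (ler_norm _) _.
  by near: k; exact: cvgr0_norm_le h_cvg _ rho0.
exists x; split; last 2 first.
- pose g k := (cell (h k) x0)%:R * h k.
  have gP k : grid (h k) (g k) /\ `|g k - x0| <= h k by exact: grid_floor.
  have gcvg : g @ \oo --> x0.
    apply/cvgrPdist_le => e e0.
    near=> k; have hk : `|h k| <= e by near: k; exact: cvgr0_norm_le h_cvg _ e0.
    have [_ gk] := gP k; rewrite distrC; apply: le_trans gk _.
    exact: le_trans (ler_norm _) hk.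
  (* Comparing the discrete maximum with the grid point just below x0 gives (x_k - x0)^2 <= q k,
     where the two inverses are the errors between w and u. *)
  pose q k := k.+1%:R^-1 + k.+1%:R^-1 + (u x0 - phi x0 - (clamp u (g k) - phi (g k)))
     + (g k - x0) * (g k - x0).
  have qcvg : q @ \oo --> 0.
    have -> : 0 = 0 + 0 + (u x0 - phi x0 - (clamp u x0 - phi x0)) + (x0 - x0) * (x0 - x0).
      by rewrite clampE// !subrr mulr0 !addr0.
    have cg : g k - x0 @[k --> \oo] --> x0 - x0.
      by apply: cvgB => //; exact: cvg_cst.
    apply: cvgD; last exact: cvgM.
    apply: cvgD; first exact: cvgD.
    apply: cvgB; first exact: cvg_cst.
    apply: cvgB; first by apply: (cvg_comp _ _ gcvg); exact: cu.
    by apply: (cvg_comp _ _ gcvg); exact: cphi.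
  have xq : \forall k \near \oo, (x k - x0) ^+ 2 <= q k.
    near=> k.
    have hk : h k <= rho by near: k; exact: hrho.
    have kx : x0 + rho <= k%:R by near: k; exact: nbhs_infty_ger.
    have [Gx /(_ hk)[xx0 xmax]] := xP k.
    have [Gg gx0] := gP k.
    have g0 := grid_ge0 (h0 k) Gg; have x0' := grid_ge0 (h0 k) Gx.
    have := xmax _ Gg (le_trans gx0 hk).
    have xl : x k <= x0 + rho by move: xx0; rewrite ler_norml => /andP[_]; lra.
    have gl : g k <= x0 + rho.
      by move: (le_trans gx0 hk); rewrite ler_norml => /andP[_]; lra.
    have := w_u Gx (le_trans xl kx); have := w_u Gg (le_trans gl kx).
    have : u (x k) - phi (x k) <= u x0 - phi x0.
      apply: umax; split; last by rewrite half_lineE.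
      rewrite /= in_itv/=; move: xx0; rewrite ler_norml /rho => /andP[a3 a4].
      by apply/andP; split; lra.
    rewrite /q clampE// !ler_norml; move: (k.+1%:R^-1 : R) => e.
    by move=> a1 /andP[a2 a3] /andP[a4 a5] a6; lra.
  apply/cvgrPdist_le => e e0.
  have e2 : 0 < e ^+ 2 by rewrite exprn_gt0.
  near=> k.
  have h1 : (x k - x0) ^+ 2 <= q k by near: k; exact: xq.
  have h2 : `|q k| <= e ^+ 2 by near: k; exact: cvgr0_norm_le qcvg _ e2.
  rewrite distrC -(ler_pXn2r (ltn0Sn 1)) ?nnegrE ?(ltW e0)// real_normK ?num_real//.
  by apply: (le_trans h1); apply: le_trans (ler_norm _) h2.
- near=> k; have hk : h k <= rho by near: k; exact: hrho.
  by move=> y; have [_ /(_ hk)[_]] := xP k; apply.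
- by move=> k; case: (xP k).
Unshelve. all: by end_near. Qed.

Let measurable_w k x : measurable_fun setT (fun z : TR =>
  w k (x + eta x (zeta k z)) - w k x).
Proof. exact: (measurable_grid_jump_comp (h0 k) (fun s => w k (x + eta x s) - w k x)). Qed.

Let w_bound k x z : `|w k (x + eta x (zeta k z)) - w k x| <= B + B.
Proof. by apply: le_trans (ler_normB _ _) _; apply: lerD. Qed.

Lemma measurable_gt_far (c : R) : measurable [set z : TR | c < `|z|].
Proof.
rewrite (_ : [set _ | _] = Num.norm @^-1` `]c, +oo[); last first.
  by apply/seteqP; split => z; rewrite /= in_itv/= andbT.
by rewrite -[X in measurable X]setTI; apply: (@normr_measurable R setT).
Qed.

Let Rintegral_far_split k x c : 0 < c -> r k <= c ->
  \int[mu]_(z in far (r k)) (w k (x + eta x (zeta k z)) - w k x) =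
  \int[mu]_(z in [set z : TR | r k <= `|z| <= c]) (w k (x + eta x (zeta k z)) - w k x) +
  \int[mu]_(z in [set z : TR | c < `|z|]) (w k (x + eta x (zeta k z)) - w k x).
Proof.
move=> c0 rc.
have r0 : 0 < r k by rewrite mulr_gt0.
have e1 : far (r k) = [set z : TR | r k <= `|z| <= c] `|` [set z : TR | c < `|z|].
  apply/seteqP; split => z /=; rewrite /far/=.
    by move=> ->; have [|] := leP `|z| c; [left|right].
  by move=> [/andP[->]//|/ltW]; exact: le_trans.
rewrite [in LHS]e1 Rintegral_setU//.
- exact: (measurable_annulus true true).
- exact: measurable_gt_far.
- rewrite -e1; apply: (@mu_integrable _ _ alpha_gt1 mu ms ms_fin muE (r k) _ _ (B + B)) => //.
    exact: measurable_far.
  by apply: measurable_funTS; exact: measurable_w.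
- by apply/disj_setPS => z [] /= /andP[_ zc]; rewrite ltNge zc.
Qed.

(* phi plays the role of the strictly perturbed test function. *)
Lemma approximate_inequality (phi : R -> R) (C rho c x0 x : R) (k : nat) :
  0 <= C ->
  (forall s t, x0 - rho <= s <= x0 + rho -> x0 - rho <= t <= x0 + rho ->
     `|phi t - phi s - derive1 phi s * (t - s)| <= C * (t - s) ^+ 2) ->
  `|derive1 phi x| <= C ->
  grid (h k) x -> `|x - x0| <= rho / 2 -> 0 < c -> c <= 1 ->
  (1 + theta^-1) * c <= rho / 2 -> r k < c ->
  (forall y, grid (h k) y -> `|y - x0| <= rho -> w k y - phi y <= w k x - phi x) ->
  w k x <= F x + k.+1%:R^-1 +
    derive1 phi x * (\int[mstar]_(z in [set z : TR | r k <= `|z| <= c])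
       eta x (zeta k z)) +
    (C + C) * (1 + theta^-1) ^+ 2 * levy_cst alpha ms * c `^ (2 - alpha) +
    \int[mu]_(z in [set z : TR | c < `|z|]) (w k (x + eta x (zeta k z)) - w k x).
Proof.
move=> C0 taylor dphiC Gx xx0 c0 c1 cK rc wmax.
have r0 : 0 < r k by rewrite mulr_gt0.
have K1 : 1 <= 1 + theta^-1 by rewrite lerDl invr_ge0 ltW.
set S : set TR := [set z | r k <= `|z| <= c].
have mS : measurable S by exact: (measurable_annulus true true).
have Sr z : S z -> r k <= `|z| <= c by [].
have zP z : r k <= z -> z <= zeta k z <= (1 + theta^-1) * z.
  by move=> rz; exact: (grid_jump_scaled (h0 k) theta0 rz).
have mz : measurable_fun setT (fun z : TR => zeta k z).
  exact: (measurable_grid_jump_comp (h0 k) id).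
have mG : measurable_fun S (fun z : TR => w k (x + eta x (zeta k z)) - w k x).
  by apply: measurable_funTS; exact: measurable_w.
have x_ge0 := grid_ge0 (h0 k) Gx.
have rho0 : 0 < rho.
  have : 0 < (1 + theta^-1) * c by rewrite mulr_gt0// (lt_le_trans _ K1).
  by move/lt_le_trans => /(_ _ cK); rewrite pmulr_lgt0// invr_gt0.
have inw t : `|t - x0| <= rho -> x0 - rho <= t <= x0 + rho.
  by rewrite ler_norml => /andP[t1 t2]; apply/andP; split; lra.
have xin : `|x - x0| <= rho by apply: le_trans xx0 _; have := rho0; lra.
have Gle z : S z -> w k (x + eta x (zeta k z)) - w k x <=
    derive1 phi x * eta x (zeta k z) + C * zeta k z ^+ 2.
  move=> Sz; set e := eta x (zeta k z).
  have /andP[rz zc] := Sr _ Sz.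
  have ez : `|e| <= `|zeta k z| by exact: normr_eta.
  have zb : `|zeta k z| <= rho / 2.
    apply: le_trans (normr_zeta K1 (@grid_jumpN R (h k)) zP rz) _.
    by apply: le_trans cK; rewrite ler_wpM2l// (le_trans _ K1).
  have yin : `|x + e - x0| <= rho.
    rewrite addrAC; apply: le_trans (ler_normD _ _) _.
    by have := le_trans ez zb; move: xx0; lra.
  have := wmax _ (grid_jump_closed (h0 k) z Gx) yin.
  have := taylor _ _ (inw _ xin) (inw _ yin).
  rewrite [x + e - x]addrAC subrr add0r ler_norml => /andP[_ t1] t2.
  have e2 : C * e ^+ 2 <= C * zeta k z ^+ 2.
    rewrite ler_wpM2l// -[leLHS]real_normK ?num_real// -[leRHS]real_normK ?num_real//.
    by rewrite ler_pXn2r ?nnegrE.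
  by rewrite -/e in t2; lra.
have := @Rintegral_jump_le _ _ alpha_gt1 alpha_lt2 mu ms ms_fin muE (r k) c
  (1 + theta^-1) (zeta k) S r0 rc c1 K1 mz (@grid_jumpN R (h k)) zP mS Sr
  x (derive1 phi x) C (B + B) _ x_ge0 C0 mG (fun z _ => w_bound _ _ _) Gle.
have lc0 : 0 <= levy_cst alpha ms by exact: levy_cst_ge0.
have : (`|derive1 phi x| + C) * (1 + theta^-1) ^+ 2 * levy_cst alpha ms * c `^ (2 - alpha)
    <= (C + C) * (1 + theta^-1) ^+ 2 * levy_cst alpha ms * c `^ (2 - alpha).
  by rewrite !ler_wpM2r ?powR_ge0 ?sqr_ge0// lerD2r.
have := w_eq k x; rewrite (Rintegral_far_split x c0 (ltW rc)) ler_norml.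
rewrite -/S.
set I1 := \int[mu]_(z in S) _; set I2 := \int[mu]_(z in _) _.
set J := _ * \int[mstar]_(z in S) _.
move: (_ * c `^ _) => X; move: (_ * c `^ _) => Y.
move=> /andP[_ h2] h3 h4; clearbody I1 I2 J; move: (k.+1%:R^-1 : R) h2 => e h2.
by move: (w k x) (F x) h2 h3 h4 => a1 a2; lra.
Qed.

End stability.

(** * Interior and boundary inequalities in the limit *)

Section stability_limit.
Context (R : realType) (alpha : R).
Hypotheses (alpha_gt1 : 1 < alpha) (alpha_lt2 : alpha < 2).
Notation TR := (measurableTypeR R).
Variables mu ms : {measure set (measurableTypeR R) -> \bar R}.
Hypothesis ms_fin : (\int[ms]_(z in [set~ 0%R])
  (Num.min 1 (`|z| `^ (alpha - 1)))%:E < +oo)%E.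
Hypothesis muE : forall A : set TR, measurable A ->
  (mu A = mu_star alpha A + ms A)%E.
Hypothesis mu_atom : forall a : R, a < 0 -> mu [set a] = 0%E.
Notation mstar := (@mu_star R alpha).

Variables (theta B : R) (h : nat -> R) (w : nat -> R -> R) (u F : R -> R).
Hypothesis theta0 : 0 < theta.
Hypotheses (h0 : forall k, 0 < h k) (h_le : forall k, h k <= k.+1%:R^-1).
Hypotheses (wB : forall k x, `|w k x| <= B) (uB : forall x, `|u x| <= B).
Hypothesis FB : forall x, `|F x| <= B.
Hypothesis cF : continuous F.
Hypothesis cu : continuous (clamp u).
Hypothesis w_u : forall k x, grid (h k) x -> x <= k%:R ->
  `|w k x - u x| <= k.+1%:R^-1.
Notation r k := (theta * h k).
Notation zeta k := (grid_jump (h k)).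
Hypothesis w_eq : forall k x,
  `|w k x - \int[mu]_(z in far (r k)) (w k (x + eta x (zeta k z)) - w k x)
    - F x| <= k.+1%:R^-1.

Let inv_cvg : (fun k => k.+1%:R^-1 : R) @ \oo --> 0.
Proof. exact: cvg_harmonic. Qed.

Let h_cvg : h @ \oo --> 0.
Proof.
apply: (@squeeze_cvgr _ _ _ _ (fun=> 0) (fun k => k.+1%:R^-1 : R)) => //.
- by apply: nearW => k; rewrite h_le ltW.
- exact: cvg_cst.
Qed.

Let h_small e : 0 < e -> \forall k \near \oo, h k <= e.
Proof.
move=> e0; near=> k; apply: le_trans (ler_norm _) _.
by near: k; exact: cvgr0_norm_le h_cvg _ e0.
Unshelve. all: by end_near. Qed.

Let cvg_w (y : nat -> R) (y0 : R) : (forall k, grid (h k) (y k)) ->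
  y @ \oo --> y0 -> w k (y k) @[k --> \oo] --> clamp u y0.
Proof.
move=> Gy ycvg; apply/cvgrPdist_le => e e0.
have e2 : 0 < e / 2 by rewrite divr_gt0.
have uy : clamp u (y k) @[k --> \oo] --> clamp u y0.
  by apply: (cvg_comp _ _ ycvg); exact: cu.
near=> k.
have a1 : `|clamp u y0 - clamp u (y k)| <= e / 2.
  by near: k; exact: (cvgrPdist_le _ _).1 uy _ e2.
have a2 : `|y0 - y k| <= 1.
  by near: k; exact: (cvgrPdist_le _ _).1 ycvg _ ltr01.
have a3 : y0 + 1 <= k%:R by near: k; exact: nbhs_infty_ger.
have a4 : `|(k.+1%:R^-1 : R)| <= e / 2.
  by near: k; exact: cvgr0_norm_le inv_cvg _ e2.
have yk : y k <= k%:R.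
  by apply: le_trans a3; move: a2; rewrite ler_norml => /andP[]; lra.
have := w_u (Gy k) yk; rewrite -(clampE u (grid_ge0 (h0 k) (Gy k))).
move=> a5; rewrite (_ : clamp u y0 - w k (y k) =
  clamp u y0 - clamp u (y k) - (w k (y k) - clamp u (y k))); last by ring.
apply: le_trans (ler_normB _ _) _; rewrite [leRHS](splitr e) lerD//.
by apply: (le_trans a5); apply: le_trans (ler_norm _) a4.
Unshelve. all: by end_near. Qed.

Let cvg_eta (x : nat -> R) (x0 z : R) : x @ \oo --> x0 -> x0 + z != 0 ->
  eta (x k) (zeta k z) @[k --> \oo] --> eta x0 z.
Proof.
move=> xcvg xz; apply/cvgrPdist_le => e e0.
have d0 : 0 < `|x0 + z| / 3 by rewrite divr_gt0// normr_gt0.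
near=> k.
have a1 : `|x0 - x k| <= `|x0 + z| / 3.
  by near: k; exact: (cvgrPdist_le _ _).1 xcvg _ d0.
have a2 : h k <= `|x0 + z| / 3 by near: k; exact: h_small.
have a3 : h k <= e by near: k; exact: h_small.
have gz := grid_jump_close (h0 k) z.
have gz2 := le_trans gz a2.
have sgE : (0 <= x k + grid_jump (h k) z) = (0 <= x0 + z).
  move: a1 gz2; rewrite !ler_norml.
  have [xz0|xz0|xz0] := ltgtP (x0 + z) 0; last by move: xz; rewrite xz0 eqxx.
    rewrite (ltr0_norm xz0) => /andP[b1 b2] /andP[b3 b4].
    by apply/negbTE; rewrite -ltNge; lra.
  by rewrite (gtr0_norm xz0) => /andP[b1 b2] /andP[b3 b4]; lra.
rewrite /eta sgE; case: ifP => _; last by rewrite subrr normr0 ltW.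
by rewrite distrC; exact: le_trans gz a3.
Unshelve. all: by end_near. Qed.

Let T (c : R) : set TR := [set z | c < `|z|].

Let T_far c : T c `<=` far c. Proof. by move=> z /ltW. Qed.

Let mT c : measurable (T c). Proof. exact: measurable_gt_far. Qed.

(** Dominated convergence. The censoring rule jumps only at z = -x0, a negative point that [mu] does
    not charge; elsewhere the status of the rounded jump from x_k is eventually that of z from
    x0. *)
Lemma tail_cvg (x : nat -> R) (x0 c : R) : (forall k, grid (h k) (x k)) ->
  x @ \oo --> x0 -> 0 < x0 -> 0 < c ->
  \int[mu]_(z in T c) (w k (x k + eta (x k) (zeta k z)) - w k (x k)) @[k --> \oo]
   --> \int[mu]_(z in T c) (u (x0 + eta x0 z) - u x0).
Proof.
move=> Gx xcvg x00 c0.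
pose f_ k (z : TR) := w k (x k + eta (x k) (zeta k z)) - w k (x k).
pose f (z : TR) := u (x0 + eta x0 z) - u x0.
have bu : bounded_on_half_line u by apply: (@bounded_on_half_line_intro _ _ B) => t _.
have if_ := integrable_outer alpha_gt1 ms_fin muE cu bu (ltW x00) c0 (mT c) (@T_far c).
have mf_ k : measurable_fun (T c) (EFin \o f_ k).
  apply/measurable_EFinP; apply: measurable_funTS.
  exact: (measurable_grid_jump_comp (h0 k) (fun s => w k (x k + eta (x k) s) - w k (x k))).
have mf : measurable_fun (T c) (EFin \o f) by exact: measurable_int if_.
have ig : mu.-integrable (T c) (EFin \o (fun=> B + B)).
  exact: (@mu_integrable _ _ alpha_gt1 mu ms ms_fin muE c _ _ `|B + B|).
have f_f : {ae mu, forall z, T c z -> (EFin \o f_ k) z @[k --> \oo] --> (EFin \o f) z}.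
  exists [set - x0]; split.
  - exact: measurable_set1.
  - by apply: mu_atom; rewrite oppr_lt0.
  - move=> z /= H; apply: contrapT => zx0; apply: H => _.
    have xz : x0 + z != 0.
      by apply/eqP => E; apply: zx0; apply/eqP; rewrite -addr_eq0 addrC E.
    apply: cvg_EFin; first exact: nearW.
    have c1 : w k (x k) @[k --> \oo] --> clamp u x0 by exact: cvg_w.
    have c2 : w k (x k + eta (x k) (zeta k z)) @[k --> \oo] --> clamp u (x0 + eta x0 z).
      apply: (@cvg_w (fun k => x k + eta (x k) (zeta k z))).
        by move=> k; exact: grid_jump_closed.
      by apply: cvgD => //; exact: cvg_eta.
    rewrite /= /f -(clampE u (ltW x00)) -(clampE u (add_eta_ge0 z (ltW x00))).
    exact: cvgB.
have f_g : {ae mu, forall z k, T c z -> (`|(EFin \o f_ k) z| <= (EFin \o (fun=> (B + B)%R)) z)%E}.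
  apply: aeW => z k _ /=; rewrite lee_fin.
  by apply: le_trans (ler_normB _ _) _; apply: lerD.
have [_ _] := dominated_convergence (mT c) mf_ mf f_f ig f_g.
have -> : (\int[mu]_(z in T c) (EFin \o f) z)%E = (\int[mu]_(z in T c) f z)%:E.
  by rewrite /Rintegral fineK//; exact: integrable_fin_num.
by move=> /fine_cvg.
Qed.

Let perturbed_C2 (phi : R -> R) x0 : C2 phi ->
  C2 (fun t => phi t + (t - x0) ^+ 2) /\
  derive1 (fun t => phi t + (t - x0) ^+ 2) = fun t => derive1 phi t + 2 * (t - x0).
Proof.
move=> Cphi; have := C2D Cphi (C2_quadratic_test 0 1 x0).
have -> : (fun t => phi t + quadratic_test 0 1 x0 t) = fun t => phi t + (t - x0) ^+ 2.
  by apply/funext => t; rewrite /quadratic_test mul0r add0r mul1r.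
move=> [c2 ->]; split => //; apply/funext => t.
by rewrite derive1_quadratic_test add0r mulr1.
Qed.

(** Jumps up to a fixed c are estimated through the test function, longer ones pass to the limit as
    k grows; then u is replaced by phi on c < |z| < delta, and c tends to 0. *)
Let interior_test (phi : R -> R) (x0 delta : R) : C2 phi -> 0 < x0 -> 0 < delta ->
  (forall y, nbhd_half_line x0 delta y -> u y - phi y <= u x0 - phi x0) ->
  u x0 - I_inner mu delta phi x0 - I_outer mu delta u x0 <= F x0.
Proof.
move=> Cphi x00 d0 umax.
have [x [Gx xcvg xmax]] := approximating_maxima h0 h_le cu w_u
  (C2_continuous Cphi) (ltW x00) d0 umax.
have [Cpsi dpsi] := perturbed_C2 x0 Cphi.
set psi := fun t => _ in Cpsi dpsi.
pose rho := delta / 2.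
have rho0 : 0 < rho by rewrite divr_gt0.
have [C C0 [C1 CT]] := C2_bounds (x0 - rho) (x0 + rho) Cpsi.
set K := 1 + theta^-1.
have K1 : 1 <= K by rewrite lerDl invr_ge0 ltW.
have K0 : 0 < K by exact: lt_le_trans K1.
set X := (C + C) * K ^+ 2 * levy_cst alpha ms.
have bu : bounded_on_half_line u by apply: (@bounded_on_half_line_intro _ _ B) => t _.
(* With K c <= x0 / 2 rounded jumps of size up to c are uncensored at x_k for large k, so the drift
   vanishes. *)
have tail c : 0 < c -> c <= 1 -> K * c <= rho / 2 -> K * c <= x0 / 2 ->
    u x0 - F x0 - \int[mu]_(z in T c) (u (x0 + eta x0 z) - u x0) <= X * c `^ (2 - alpha).
  move=> c0 c1 cr cx.
  have cw : w k (x k) @[k --> \oo] --> u x0.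
    by rewrite -(clampE u (ltW x00)); exact: cvg_w.
  have cF' : F (x k) @[k --> \oo] --> F x0.
    by apply: (cvg_comp _ _ xcvg); exact: cF.
  have H : w k (x k) - F (x k) - k.+1%:R^-1 -
     \int[mu]_(z in T c) (w k (x k + eta (x k) (zeta k z)) - w k (x k)) @[k --> \oo]
     --> u x0 - F x0 - 0 - \int[mu]_(z in T c) (u (x0 + eta x0 z) - u x0).
    apply: cvgB; last exact: tail_cvg.
    by apply: cvgB => //; exact: cvgB.
  rewrite subr0 in H.
  have rho2 : 0 < rho / 2 by rewrite divr_gt0.
  have x2 : 0 < x0 / 2 by rewrite divr_gt0.
  have ct : 0 < c / (2 * theta) by rewrite divr_gt0// mulr_gt0.
  apply: (cvgr_to_le H); near=> k.
  have b1 : `|x0 - x k| <= rho / 2.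
    by near: k; exact: (cvgrPdist_le _ _).1 xcvg _ rho2.
  have b2 : `|x0 - x k| <= x0 / 2.
    by near: k; exact: (cvgrPdist_le _ _).1 xcvg _ x2.
  have b3 : h k <= c / (2 * theta) by near: k; exact: h_small.
  have rc : r k < c.
    move: b3; rewrite ler_pdivlMr ?mulr_gt0// mulrCA [h k * _]mulrC => b3.
    have rp : 0 < r k by rewrite mulr_gt0.
    by move: b3 rp; lra.
  have r0 : 0 < r k by rewrite mulr_gt0.
  have xrho : x0 - rho <= x k <= x0 + rho.
    by move: b1; rewrite ler_norml => /andP[b4 b5]; apply/andP; split; lra.
  have wmax : forall y, grid (h k) y -> `|y - x0| <= rho -> w k y - psi y <= w k (x k) - psi (x k).
    by near: k; exact: xmax.
  rewrite distrC in b1.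
  have := approximate_inequality alpha_gt1 alpha_lt2 ms_fin muE theta0 h0 wB w_eq
    C0 CT (C1 _ xrho) (Gx k) b1 c0 c1 cr rc wmax.
  have -> : \int[mstar]_(z in [set z : TR | r k <= `|z| <= c]) eta (x k) (zeta k z) = 0.
    apply: (@mean_jump_eq0 _ _ alpha_gt1 (r k) c K) => //.
    - exact: (measurable_grid_jump_comp (h0 k) id).
    - exact: grid_jumpN.
    - by move=> z; exact: (grid_jump_scaled (h0 k) theta0).
    - exact: (measurable_annulus true true).
    - by move=> z /=; rewrite normrN.
    - by apply: (le_trans cx); move: b2; rewrite ler_norml => /andP[]; lra.
  rewrite mulr0 addr0 -/K -/X -/(T c).
  set I1 := \int[mu]_(z in T c) _; move: (k.+1%:R^-1 : R) => e; clearbody I1.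
  by move: (w k (x k)) (F (x k)) (X * _) => p1 p2 p3; lra.
have Hlim := inner_cvg alpha_gt1 alpha_lt2 ms_fin muE Cphi x00 d0.
have a20 : 0 < 2 - alpha by rewrite subr_gt0.
have XL : X * c `^ (2 - alpha) @[c --> 0^'+] --> X * 0.
  by apply: cvgM; [exact: cvg_cst|exact: powR_cvg0].
(* A term tending to 0 may be added without changing the limit, so the truncated inequality with its
   error X c^(2 - alpha) is enough. *)
have SL := cvgD Hlim XL; rewrite mulr0 addr0 in SL.
suff : u x0 - F x0 - I_outer mu delta u x0 <= I_inner mu delta phi x0.
  by move: (I_outer _ _ _ _) (I_inner _ _ _ _) => p1 p2; lra.
have rho2K : 0 < rho / 2 / K by rewrite !divr_gt0.
have x2K : 0 < x0 / 2 / K by rewrite !divr_gt0.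
rewrite /I_inner; apply: (cvgr_to_ge (SL _)); near=> c.
have c0 : 0 < c by near: c; exact: nbhs_right_gt.
have c1 : c <= 1 by near: c; exact: nbhs_right_le.
have c2 : c <= rho / 2 / K by near: c; exact: nbhs_right_le.
have c3 : c <= x0 / 2 / K by near: c; exact: nbhs_right_le.
have c4 : c < delta by near: c; exact: nbhs_right_lt.
rewrite ler_pdivlMr// mulrC in c2; rewrite ler_pdivlMr// mulrC in c3.
change (u x0 - F x0 - I_outer mu delta u x0 <=
  \int[mu]_(z in [set z : TR | c < `|z| < delta]) (phi (x0 + eta x0 z) - phi x0)
  + X * c `^ (2 - alpha)).
have := tail c c0 c1 c2 c3.
have TE : T c = [set z : TR | c < `|z| < delta] `|` far delta.
  apply/seteqP; split => z; rewrite /T/far/=.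
    by move=> ->; have [|] := leP delta `|z|; [right|left].
  by move=> [/andP[]//|]; exact: lt_le_trans.
have iT := integrable_outer alpha_gt1 ms_fin muE cu bu (ltW x00) c0 (mT c) (@T_far c).
have mA : measurable [set z : TR | c < `|z| < delta] by exact: (measurable_annulus false false).
have iA : mu.-integrable [set z : TR | c < `|z| < delta]
    (EFin \o (fun z : TR => u (x0 + eta x0 z) - u x0)).
  by apply: integrableS iT => // z /andP[].
have -> : \int[mu]_(z in T c) (u (x0 + eta x0 z) - u x0) =
    \int[mu]_(z in [set z : TR | c < `|z| < delta]) (u (x0 + eta x0 z) - u x0)
    + I_outer mu delta u x0.
  rewrite TE Rintegral_setU//.
  - exact: measurable_far.
  - by rewrite -TE.
  - apply/disj_setPS => z [] /= /andP[_ zd]; rewrite /far/= => dz.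
    by move: zd; rewrite ltNge dz.
have : \int[mu]_(z in [set z : TR | c < `|z| < delta]) (u (x0 + eta x0 z) - u x0) <=
    \int[mu]_(z in [set z : TR | c < `|z| < delta]) (phi (x0 + eta x0 z) - phi x0).
  apply: le_Rintegral => //.
    exact: (integrable_inner alpha_gt1 ms_fin muE _ _ (C2_continuous Cphi)).
  move=> z /andP[_ zd].
  have nb : nbhd_half_line x0 delta (x0 + eta x0 z).
    split; last by rewrite half_lineE add_eta_ge0// ltW.
    have := le_lt_trans (normr_eta x0 z) zd; rewrite ltr_norml /= in_itv/=.
    by move=> /andP[e1 e2]; rewrite !ltrD2l e1 e2.
  by have := umax _ nb; lra.
move: (\int[mu]_(z in _) (u _ - _)) (\int[mu]_(z in _) (phi _ - _)) (I_outer _ _ _ _) => p1 p2 p3.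
by move: (X * _) (u x0) (F x0) => p4 p5 p6; lra.
Unshelve. all: by end_near. Qed.

(** The bracket equals 2^(-(1 + alpha)) s^(1 - alpha), which tends to infinity as s decreases to
    0. *)
Let boundary_blowup (q Z : R) : 0 < q -> 0 <= Z -> exists2 s0 : R, 0 < s0 &
  forall s, 0 < s -> s <= s0 -> Z < q * (s * (s * (2 * s) `^ (- (1 + alpha)))).
Proof.
move=> q0 Z0.
have a10 : 0 < alpha - 1 by rewrite subr_gt0.
pose c2 := 2 `^ (- (1 + alpha)) : R.
have c20 : 0 < c2 by exact: powR_gt0.
have Z1 : 0 < Z + 1 by rewrite ltr_wpDl.
pose m := q * c2 / (Z + 1).
have m0 : 0 < m by rewrite divr_gt0 ?mulr_gt0.
exists (m `^ (alpha - 1)^-1); first exact: powR_gt0.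
move=> s s_gt0 sle; have sn : s != 0 by rewrite gt_eqF.
have -> : s * (s * (2 * s) `^ (- (1 + alpha))) = c2 * (s `^ (alpha - 1))^-1.
  rewrite powRM ?(ltW s_gt0)// -/c2 -powRN !mulrA [s * s * c2]mulrC -mulrA; congr (_ * _).
  rewrite -expr2 -powR_mulrn ?(ltW s_gt0)// -powRD ?sn ?implybT//.
  by congr (_ `^ _); ring.
have sm : s `^ (alpha - 1) <= m.
  have mE : (m `^ (alpha - 1)^-1) `^ (alpha - 1) = m.
    by rewrite -powRrM mulVf ?gt_eqF// powRr1// ltW.
  rewrite -[leRHS]mE; apply: ge0_ler_powR; rewrite ?nnegrE ?(ltW a10) ?(ltW s_gt0) ?powR_ge0//.
have sp : 0 < s `^ (alpha - 1) by exact: powR_gt0.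
rewrite mulrA ltr_pdivlMr//; apply: (@le_lt_trans _ _ (Z * m)).
  by rewrite ler_wpM2l.
rewrite /m mulrCA gtr_pMr ?mulr_gt0// ltr_pdivrMr// mul1r.
by rewrite ltrDl.
Qed.

(** If phi'(0) < 0, the discrete maxima near 0 have slope at most -q, and the unbounded mean jump
    makes the drift negative beyond anything the other terms can balance. The argument is the same
    whether the maxima lie on the boundary or inside. *)
Let boundary_test (phi : R -> R) (delta : R) : C2 phi -> 0 < delta ->
  (forall y, nbhd_half_line 0 delta y -> u y - phi y <= u 0 - phi 0) ->
  - derive1 phi 0 <= 0.
Proof.
move=> Cphi d0 umax; rewrite leNgt; apply/negP; rewrite oppr_gt0 => dphi.
have [x [Gx xcvg xmax]] := approximating_maxima h0 h_le cu w_u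
  (C2_continuous Cphi) (lexx 0) d0 umax.
have [Cpsi dpsi] := perturbed_C2 0 Cphi.
set psi := fun t => _ in Cpsi dpsi.
pose rho := delta / 2.
have rho0 : 0 < rho by rewrite divr_gt0.
have [C C0 [C1 CT]] := C2_bounds (0 - rho) (0 + rho) Cpsi.
set K := 1 + theta^-1.
have K1 : 1 <= K by rewrite lerDl invr_ge0 ltW.
have K0 : 0 < K by exact: lt_le_trans K1.
set X := (C + C) * K ^+ 2 * levy_cst alpha ms.
have X0 : 0 <= X.
  by rewrite mulr_ge0 ?levy_cst_ge0// mulr_ge0 ?sqr_ge0// addr_ge0.
have rho2 : 0 < rho / 2 by rewrite divr_gt0.
pose c := Num.min 1 (rho / 2 / K).
have c0 : 0 < c by rewrite lt_min ltr01 divr_gt0.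
have c1 : c <= 1 by rewrite /c ge_min lexx.
have cr : K * c <= rho / 2.
  by rewrite mulrC -ler_pdivlMr// /c ge_min lexx orbT.
have B0 : 0 <= B by apply: le_trans (uB 0).
pose q := - derive1 phi 0 / 2.
have q0 : 0 < q by rewrite divr_gt0// oppr_gt0.
(* Z bounds all of the discrete inequality but the drift: -w, F with its residual, the second-order
   error and the tail. *)
pose Z := B + (B + 1) + X * c `^ (2 - alpha) + (B + B) * fine (mu (T c)).
have Z0 : 0 <= Z.
  by rewrite !addr_ge0// mulr_ge0 ?powR_ge0 ?addr_ge0 ?fine_ge0.
have [s0 s00 s0P] := boundary_blowup q0 Z0.
have dpsic : derive1 psi t @[t --> (0 : R)] --> derive1 psi 0.
  case: Cpsi => _ d2 _.
  by apply: differentiable_continuous; exact/derivable1_diffP.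
have dx : derive1 psi (x k) @[k --> \oo] --> derive1 psi 0.
  exact: (cvg_comp _ _ xcvg dpsic).
have psi0 : derive1 psi 0 = - (2 * q).
  by rewrite dpsi subrr mulr0 addr0 /q mulrC divfK ?opprK.
have [c2p [s02 [ct s02t]]] : 0 < c / 2 /\ 0 < s0 / 2 /\
    0 < c / (4 * theta) /\ 0 < s0 / (2 * theta).
  by split; [|split; [|split]]; rewrite divr_gt0// mulr_gt0.
have c4 : 0 < c / 4 by rewrite divr_gt0.
suff [k [p1 p2]] : exists k, [/\ derive1 psi (x k) <= - q &
    [/\ `|x k| <= rho / 2, x k <= c / 4, x k <= s0 / 2,
       h k <= c / (4 * theta) & h k <= s0 / (2 * theta)] /\
     forall y, grid (h k) y -> `|y - 0| <= rho -> w k y - psi y <= w k (x k) - psi (x k)].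
  move: p2 => [[b1 b2 b3 b4 b5] wmax].
  rewrite ler_pdivlMr ?mulr_gt0// in b4; rewrite ler_pdivlMr ?mulr_gt0// in b5.
  have x0 := grid_ge0 (h0 k) (Gx k).
  have r0 : 0 < r k by rewrite mulr_gt0.
  have rc4 : r k <= c / 4.
    by move: b4; move: (h k) => hk; lra.
  have rs2 : r k <= s0 / 2.
    by move: b5; move: (h k) => hk; lra.
  have rc : r k < c by move: (r k) rc4 r0 => rk; lra.
  have xrho : 0 - rho <= x k <= 0 + rho.
    by move: b1; rewrite ler_norml => /andP[e1 e2]; apply/andP; split; lra.
  have b1' : `|x k - 0| <= rho / 2 by rewrite subr0.
  have := approximate_inequality alpha_gt1 alpha_lt2 ms_fin muE theta0 h0 wB w_eq
    C0 CT (C1 _ xrho) (Gx k) b1' c0 c1 cr rc wmax.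
  (* The scale must exceed x_k strictly and be at least the truncation; the sum does both, even when
     x_k = 0. *)
  pose s := x k + r k.
  have s_gt0 : 0 < s by rewrite ltr_wpDl.
  have s_le : s <= s0 by rewrite /s; move: (r k) rs2 => rk; lra.
  have sc : 2 * s <= c by rewrite /s; move: (r k) rc4 => rk; lra.
  have := @mean_jump_ge _ _ alpha_gt1 (r k) c K (zeta k)
    [set z : TR | r k <= `|z| <= c] r0 K1
    (measurable_grid_jump_comp (h0 k) id) (@grid_jumpN R (h k))
    (fun z => @grid_jump_scaled R (h k) (h0 k) theta z theta0)
    (measurable_annulus true true (r k) c) _ (fun z H => H) (x k) s x0 _ _ _.
  have j1 (z : TR) : r k <= `|z| <= c -> r k <= `|- z| <= c by rewrite normrN.
  have j2 : x k < s by rewrite ltrDl.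
  have j3 : r k <= s by rewrite lerDr.
  have j4 : `[s, 2 * s] `<=` [set z : TR | r k <= `|z| <= c].
    move=> z; rewrite /= in_itv/= => /andP[z1 z2].
    have zp : 0 < z by exact: lt_le_trans z1.
    by rewrite gtr0_norm// (le_trans j3 z1) (le_trans z2 sc).
  move=> /(_ j1 j2 j3 j4).
  have := s0P _ s_gt0 s_le.
  have := normr_Rintegral_le alpha_gt1 ms_fin muE c0 (mT c) (@T_far c)
    (measurable_funTS (measurable_grid_jump_comp (h0 k)
      (fun s => w k (x k + eta (x k) s) - w k (x k))))
    (fun z _ => le_trans (ler_normB _ _) (lerD (wB k _) (wB k _))).
  have := Z0; have := wB k (x k); have := FB (x k).
  have e1 : (k.+1%:R^-1 : R) <= 1 by rewrite invf_le1 ?ler1n ?ltr0n.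
  rewrite -/K -/X -/(T c) !ler_norml /Z.
  move: e1; move: (k.+1%:R^-1 : R) => e e1.
  move: (\int[mu]_(z in T c) _) (\int[mstar]_(z in _) _) => I1 J.
  move: (s * _) p1; move: (derive1 psi (x k)) (w k (x k)) (F (x k)) (X * _).
  move: ((B + B) * _) => m p wk Fk Xc sp p1.
  move=> /andP[_ f2] /andP[w1 _] zz /andP[_ i2] zq sJ fin.
  have pJ : p * J <= - q * J.
    apply: ler_wpM2r => //; apply: le_trans sJ.
    rewrite -(pmulr_rge0 _ q0); apply: (@le_trans _ _ (B + (B + 1) + Xc + m)).
      exact: zz.
    apply: (le_trans (ltW zq)); by rewrite ler_pM2l.
  have qJ : q * sp <= q * J by rewrite ler_pM2l.
  by lra.
near \oo => k; exists k; split.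
  have : `|derive1 psi 0 - derive1 psi (x k)| <= q.
    by near: k; exact: (cvgrPdist_le _ _).1 dx _ q0.
  by rewrite psi0 ler_norml => /andP[e1 e2]; lra.
split; last by near: k; exact: xmax.
split.
- rewrite -[x k]subr0 distrC; near: k; exact: (cvgrPdist_le _ _).1 xcvg _ rho2.
- apply: le_trans (ler_norm _) _; rewrite -[x k]subr0 distrC; near: k.
  exact: (cvgrPdist_le _ _).1 xcvg _ c4.
- apply: le_trans (ler_norm _) _; rewrite -[x k]subr0 distrC; near: k.
  exact: (cvgrPdist_le _ _).1 xcvg _ s02.
- by near: k; exact: h_small.
- by near: k; exact: h_small.
Unshelve. all: by end_near. Qed.

Lemma continuous_clamp_lsc (g : R -> R) : continuous (clamp g) -> lsc_half_line g.
Proof.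
move=> cg; have cw : {within half_line R, continuous g}.
  apply/subspace_continuousP => x; rewrite half_lineE => x0.
  change (g t @[t --> within (half_line R) (nbhs x)] --> g x).
  apply/cvgrPdist_lt => e e0; rewrite near_withinE.
  have H : \forall t \near x, `|clamp g x - clamp g t| < e.
    exact: (cvgrPdist_lt _ _).1 (cg x) _ e0.
  near=> t; rewrite half_lineE => t0.
  by rewrite -(clampE g x0) -(clampE g t0); near: t.
move=> x a; rewrite lte_fin => ax.
exists ((g : subspace (half_line R) -> R) @^-1` [set y | a < y]).
  by apply: cw; exact: lt_nbhsr.
by move=> y; rewrite lte_fin.
Unshelve. all: by end_near. Qed.

Lemma stability_subsolution : viscosity_subsolution mu F u.
Proof.
split.
- by apply: (@bounded_on_half_line_intro _ _ B) => t _.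
- apply: continuous_clamp_lsc => t; apply: cvgN; exact: cu.
move=> delta phi x d0 Cphi xh umax; rewrite half_lineE in xh; split.
- by move=> x0; exact: interior_test.
- by move=> xE; rewrite xE in umax; exact: (boundary_test Cphi d0 umax).
Qed.

End stability_limit.

(** The Holder constant is fixed before the mesh, so the grid solutions share one bound and the
    limit inherits it. Only the subsolution property is proved in the limit; the other half is the
    same statement for the negated data. *)
Lemma viscosity_solution_exists (R : realType) (alpha b : R)
    (mu ms : {measure set (measurableTypeR R) -> \bar R}) (f : R -> R) :
  1 < alpha -> alpha < 2 ->
  (\int[ms]_(z in [set~ 0%R])
    (Num.min 1 (`|z| `^ (alpha - 1)))%:E < +oo)%E ->
  (forall A : set (measurableTypeR R), measurable A ->
    (mu A = mu_star alpha A + ms A)%E) ->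
  (forall a : R, a < 0 -> mu [set a] = 0%E) ->
  1 - b = 7 / 8 * (2 - alpha) -> Cb_half_line f ->
  exists u : R -> R, viscosity_solution mu f u /\ C0_half_line b u.
Proof.
move=> a1 a2 ms_fin muE mu_atom bE [cf bf].
have ab : alpha - 1 < b by lra.
have b1 : b < 1 by lra.
have b0 : 0 < b by lra.
have a20 : 0 < 2 - alpha by rewrite subr_gt0.
have [B B0 fB] := bounded_on_half_lineP bf.
pose F := clamp f.
have cF : continuous F by exact: continuous_clamp.
have FB x : `|F x| <= B by apply: fB; rewrite le_max lexx.
pose C := Csharp alpha ms.
have C0 : 0 <= C by exact: Csharp_ge0.
have c00 : 0 <= 2 * B + 2 + 2 * B * C by rewrite !addr_ge0 ?mulr_ge0.
have c10 : 0 <= 2 * C by rewrite mulr_ge0.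
have [L L0 LP] := choose_holder_constant b0 (lt_trans b1 a1) c00 c10 B0.
(* With r = theta h one has r^(2 - alpha) = h^(2 - alpha) / 4, the truncation that the estimate
   tolerates. *)
pose theta := (4^-1 : R) `^ (2 - alpha)^-1.
have theta0 : 0 < theta by rewrite powR_gt0// invr_gt0.
have theta1 : theta <= 1.
  have e1 : 1 `^ (2 - alpha)^-1 = 1 :> R by rewrite powR1.
  rewrite -[leRHS]e1; apply: ge0_ler_powR; rewrite ?nnegrE ?invr_ge0 ?(ltW a20)//.
  by rewrite invf_le1 ?ler1n.
pose h (n : nat) : R := n.+1%:R^-1.
have h0 n : 0 < h n by rewrite invr_gt0 ltr0n.
have th0 n : 0 < theta * h n by rewrite mulr_gt0.
have thE n : (theta * h n) `^ (2 - alpha) <= h n `^ (2 - alpha) / 4.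
  rewrite powRM ?(ltW theta0) ?(ltW (h0 n))//.
  by rewrite -powRrM mulVf ?gt_eqF// powRr1 ?invr_ge0// mulrC.
(* The residual 1/(n + 2), instead of 1/(n + 1), is at most 1/2 already for n = 0, as the Holder
   bound requires. *)
have approx n : exists w : R -> R, (forall x, `|w x| <= B) /\
    forall x, `|w x - \int[mu]_(z in far (theta * h n))
        (w (x + eta x (grid_jump (h n) z)) - w x) - F x| <= (n.+2%:R^-1 : R).
  have e0 : 0 < (n.+2%:R^-1 : R) by rewrite invr_gt0 ltr0n.
  have [w wB weq] := approximate_solution a1 ms_fin muE (th0 n)
    (@measurable_grid_jump_comp R (h n) (h0 n)) e0 FB.
  by exists w.
have [w /all_and2[wB weq]] := choice approx.
have wholder n x y : grid (h n) x -> grid (h n) y ->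
    `|w n x - w n y| <= L * `|x - y| `^ b.
  move=> Gx Gy.
  have weq2 t : `|w n t - \int[mu]_(z in far (theta * h n))
        (w n (t + eta t (grid_jump (h n) z)) - w n t) - F t| <= 1 / 2.
    apply: le_trans (weq n t) _; rewrite div1r lef_pV2 ?posrE ?ltr0n//.
    by rewrite ler_nat.
  have th1 : theta * h n <= h n by rewrite ler_piMl ?(ltW (h0 n)).
  have H := grid_holder a1 a2 ms_fin muE bE (h0 n) (th0 n) th1 (thE n) (wB n) FB weq2 L0 LP.
  have := H _ _ Gx Gy; have := H _ _ Gy Gx; rewrite (distrC y) ler_norml => g1 g2.
  by apply/andP; split => //; rewrite lerNl opprB.
(* Off the grid the value at the grid point just below is used; distances change by at most h, which
   is the defect in the modulus. *)
pose fl n x := (cell (h n) x)%:R * h n.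
pose v n x := w n (fl n x).
have flP n x : 0 <= x -> [/\ grid (h n) (fl n x), fl n x <= x & x <= fl n x + h n].
  move=> x0; split; first by exists (cell (h n) x).
  - by have := cell_le (h0 n) x; rewrite ger0_norm.
  - have := cellS_gt (h0 n) x; rewrite ger0_norm// -natr1 mulrDl mul1r.
    exact: ltW.
have flE n x : grid (h n) x -> fl n x = x.
  move=> [i ->]; rewrite /fl; congr (_%:R * _).
  have ih0 : 0 <= i%:R * h n by rewrite mulr_ge0// ltW.
  apply/eqP; rewrite eqn_leq le_cell ?ger0_norm// andbT -ltnS.
  by apply: (cell_lt (h0 n)); rewrite ger0_norm// ltr_pM2r// ltr_nat.
have vB n x : `|v n x| <= B by exact: wB.
have hcvg (e : R) : 0 < e -> \forall n \near \oo, 0 <= h n <= e.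
  move=> e0; near=> n; rewrite (ltW (h0 n))/=.
  apply: le_trans (ler_norm _) _; near: n.
  exact: cvgr0_norm_le (@cvg_harmonic R) _ e0.
have vh n x y : 0 <= x -> 0 <= y -> `|v n x - v n y| <= L * (`|x - y| + h n) `^ b.
  move=> x0 y0; have [Gx gx1 gx2] := flP n x x0; have [Gy gy1 gy2] := flP n y y0.
  apply: (le_trans (wholder _ _ _ Gx Gy)); rewrite ler_wpM2l ?(ltW L0)//.
  apply: ge0_ler_powR; rewrite ?nnegrE ?(ltW b0) ?addr_ge0 ?(ltW (h0 n))//.
  have := ler_norm (x - y); have := ler_norm (y - x); rewrite (distrC y).
  rewrite ler_norml; move: (h n) gx2 gy2 => hn gx2 gy2 d1 d2.
  by apply/andP; split; clear -gx1 gx2 gy1 gy2 d1 d2; lra.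
have [u [s [uB uh sk us]]] := asymptotic_ascoli b0 L0 vB hcvg vh.
pose w' k := w (s k).
pose h' k := h (s k).
have inv_le k : (h' k : R) <= k.+1%:R^-1.
  by rewrite /h' /h lef_pV2 ?posrE ?ltr0n// ler_nat ltnS.
have cu : continuous (clamp u).
  move=> t; apply/cvgrPdist_le => e e0.
  have cg : L * `|t - s0| `^ b @[s0 --> t] --> L * `|t - t| `^ b.
    apply: cvgM; first exact: cvg_cst.
    apply: (@continuous_comp _ _ _ (fun s0 : R => t - s0) (fun s0 => `|s0| `^ b)).
      by apply: cvgB; [exact: cvg_cst|exact: cvg_id].
    exact: continuous_normr_powR.
  rewrite subrr normr0 powR0 ?gt_eqF// mulr0 in cg.
  near=> s0.
  have g1 : `|L * `|t - s0| `^ b| <= e by near: s0; exact: cvgr0_norm_le cg _ e0.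
  apply: le_trans (le_trans (ler_norm _) g1); rewrite /clamp.
  apply: (le_trans (uh _ _ _ _)); rewrite ?le_max ?lexx//.
  rewrite ler_wpM2l ?(ltW L0)//; apply: ge0_ler_powR; rewrite ?nnegrE ?(ltW b0)//.
  have [t0|t0] := leP 0 t; have [q0|q0] := leP 0 s0 => //.
  - by rewrite subr0 !ger0_norm//; clear -t0 q0; lra.
  - by rewrite sub0r normrN ger0_norm// ler0_norm; clear -t0 q0; lra.
  - by rewrite subr0 normr0.
have w_u k x : grid (h' k) x -> x <= k%:R -> `|w' k x - u x| <= k.+1%:R^-1.
  move=> Gx xk; have := us k x (grid_ge0 (h0 _) Gx) xk.
  by rewrite /v flE.
have w_eq k x : `|w' k x - \int[mu]_(z in far (theta * h' k))
     (w' k (x + eta x (grid_jump (h' k) z)) - w' k x) - F x| <= k.+1%:R^-1.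
  apply: (le_trans (weq _ _)); rewrite lef_pV2 ?posrE ?ltr0n// ler_nat ltnS.
  by apply: leq_trans (sk k) _.
have h'0 k : 0 < h' k by exact: h0.
have w'B k x : `|w' k x| <= B by exact: wB.
have sub := stability_subsolution a1 a2 ms_fin muE mu_atom theta0 h'0 inv_le
  w'B uB FB cF cu w_u w_eq.
have FfE x : half_line R x -> F x = f x by rewrite half_lineE => x0; exact: clampE.
have cNu : continuous (clamp (fun t => - u t)).
  by move=> t; apply: cvgN; exact: cu.
have supN : viscosity_subsolution mu (fun t => - F t) (fun t => - u t).
  apply: (@stability_subsolution R alpha a1 a2 mu ms ms_fin muE mu_atom theta B
    h' (fun k t => - w' k t) (fun t => - u t) (fun t => - F t) theta0 h'0 inv_le) => //.
  - by move=> k x; rewrite normrN.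
  - by move=> x; rewrite normrN.
  - by move=> x; rewrite normrN.
  - by move=> t; apply: cvgN; exact: cF.
  - by move=> k x Gx xk; rewrite -opprD normrN; exact: w_u.
  - move=> k x; apply: le_trans (w_eq k x); rewrite -[leRHS]normrN.
    have mF := @measurable_far R (theta * h' k).
    rewrite (_ : \int[mu]_(z in far (theta * h' k))
        (- w' k (x + eta x (grid_jump (h' k) z)) - - w' k x) =
      - \int[mu]_(z in far (theta * h' k)) (w' k (x + eta x (grid_jump (h' k) z)) - w' k x)).
      by rewrite le_eqVlt; apply/orP; left; apply/eqP; congr (`|_|); ring.
    transitivity (\int[mu]_(z in far (theta * h' k))
        (-1 * (w' k (x + eta x (grid_jump (h' k) z)) - w' k x))).
      by apply: eq_Rintegral => z _; ring.
    rewrite RintegralZl ?mulN1r//.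
    apply: (@mu_integrable _ _ a1 mu ms ms_fin muE (theta * h' k) _ _ (B + B)) => //.
    + exact: th0.
    + apply: measurable_funTS.
      exact: (measurable_grid_jump_comp (h'0 k) (fun s => w' k (x + eta x s) - w' k x)).
    + by move=> z _; apply: le_trans (ler_normB _ _) _; apply: lerD.
have := viscosity_subsolutionN a1 a2 ms_fin muE cNu supN.
rewrite (_ : (fun t => - - F t) = F); last by apply/funext => t; rewrite opprK.
rewrite (_ : (fun t => - - u t) = u); last by apply/funext => t; rewrite opprK.
move=> sup; exists u; split; last first.
  split; first by apply: (@bounded_on_half_line_intro _ _ B) => t _.
  by exists L => x y; rewrite !half_lineE; exact: uh.
split.
- have [bu usc subP] := sub; split => // delta phi x d0 Cphi xh xmax.
  by have := subP delta phi x d0 Cphi xh xmax; rewrite FfE.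
- have [bu lsc supP] := sup; split => // delta phi x d0 Cphi xh xmin.
  by have := supP delta phi x d0 Cphi xh xmin; rewrite FfE.
Unshelve. all: by end_near. Qed.

Theorem theorem6p2 (R : realType) (alpha beta_bar : R)
    (mu : {measure set (measurableTypeR R) -> \bar R}) (f : R -> R)
    (alpha_gt1 : 1 < alpha) (alpha_lt2 : alpha < 2)
    (beta_barE : beta_bar = alpha - 1)
    (f_Cb : Cb_half_line f)
    (mu_H : H_mu'' alpha beta_bar mu) :
  (forall u : R -> R, bounded_on_half_line u -> unif_continuous_half_line u ->
     viscosity_solution mu f u ->
     exists beta : R, [/\ beta_bar < beta, beta <= 1 & C0_half_line beta u]) /\
  (exists (u : R -> R) (beta : R),
     [/\ beta_bar < beta, beta <= 1, viscosity_solution mu f u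
       & C0_half_line beta u]).
Proof.
have [ms [_ _ ms_fin ms_atom muE]] := mu_H.
have bE := holder_exponentE alpha.
have b1 : holder_exponent alpha <= 1 by exact/ltW/holder_exponent_lt1.
have bb : beta_bar < holder_exponent alpha.
  by rewrite beta_barE; exact: holder_exponent_gt.
rewrite beta_barE in ms_fin; split.
  move=> u bu ucu vu; exists (holder_exponent alpha); split => //; split => //.
  have [_ bf] := f_Cb.
  exact: (viscosity_solution_holder alpha_gt1 alpha_lt2 ms_fin muE bE bf).
(* [mu_star] charges no point, so negative atoms are excluded for the sum as well. *)
have mu_atom (a : R) : a < 0 -> mu [set a] = 0%E.
  move=> a0; rewrite muE; last exact: measurable_set1.
  by rewrite ms_atom// mu_star_set1 adde0.
have [u [vu hu]] := viscosity_solution_exists alpha_gt1 alpha_lt2 ms_fin muE mu_atom bE f_Cb.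
by exists u, (holder_exponent alpha).
Qed.
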